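(* Let $(\mathbf{x}_e,\mathbf{x}_p)$ be a musical orbit with image trajectory $\mathbf{X}_\mu$ and time shift $\tau$, and let $\Delta_s^{\pm}(t,\mathbf{x})=\phi_p^{\pm}(t,\mathbf{x})-\phi_\mu^{\pm}(t+\tau,\mathbf{x})$. Let $\alpha,\beta\in\mathbb{C}$, let $k_q,\varpi_q,\varpi_o\in\mathbb{R}$, write $r=|\mathbf{x}|$, and set $$\varphi=\alpha e^{-\mathrm{i}k_qr-\mathrm{i}\varpi_qt}\Delta_s^++\beta e^{\mathrm{i}k_qr-\mathrm{i}\varpi_qt}\Delta_s^-,\qquad \varphi^\dagger=\alpha e^{-\mathrm{i}k_qr-\mathrm{i}\varpi_qt}\Delta_s^+-\beta e^{\mathrm{i}k_qr-\mathrm{i}\varpi_qt}\Delta_s^-.$$ Let $\mathcal{P}$ be a quasi-polynomial in one variable. Then for any $q>0$ the functions $$\Psi(t,\mathbf{x})=\mathcal{P}(\varphi(t,\mathbf{x}))\,e^{\mathrm{i}\varpi_ot-qr},\qquad \Psi^\dagger(t,\mathbf{x})=\mathcal{P}(\varphi^\dagger(t,\mathbf{x}))\,e^{\mathrm{i}\varpi_ot-qr}$$ belong to $\mathbb{W}^{2,2}(\mathbb{R}^3)$ (as complex-valued functions of $\mathbf{x}$, for each $t$).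
   Context: Units: speed of light $c=1$; electron (index $e$ or $1$) has charge $e_1=-1$ and mass $m_1=1$; proton (index $p$ or $2$) has charge $e_2=1$ and mass $m_2=M_p>0$. Trajectories and delays. A bounded trajectory is a continuous $\mathbf{x}_j:\mathbb{R}\to\mathbb{R}^3$ with bounded image; it is sub-luminal if $|\dot{\mathbf{x}}_j(t)|<1$ for all $t$ except possibly a countable set. For such a trajectory the delay functions $\phi_j^{\pm}(t,\mathbf{x})\ge0$ are the unique solutions of $\phi_j^{\pm}=|\mathbf{x}-\mathbf{x}_j(t\pm\phi_j^{\pm})|$ on $\mathbb{R}\times\mathbb{R}^3$; put $t_j^{\pm}(t,\mathbf{x})=t\pm\phi_j^{\pm}(t,\mathbf{x})$. Quantities $\mathbf{x}_j^\pm,\mathbf{v}_j^\pm,\mathbf{a}_j^\pm$ are position, velocity, acceleration of $j$ at time $t_j^\pm(t,\mathbf{x})$, and $\hat{\mathbf{n}}_j^{\pm}(t,\mathbf{x})=(\mathbf{x}-\mathbf{x}_j^\pm)/|\mathbf{x}-\mathbf{x}_j^\pm|$. Where defined, $\vec\nabla\phi_j^\pm=\hat{\mathbf{n}}_j^\pm/(1\pm\hat{\mathbf{n}}_j^\pm\cdot\mathbf{v}_j^\pm)$. Orbits. An orbit is a pair of bounded trajectories $(\mathbf{x}_e,\mathbf{x}_p)$, each possessing two derivatives defined piecewise, such that: (a) on each $C^2$ segment the Wheeler–Feynman equations hold: for $i\in\{1,2\}$, $j=3-i$, $\frac{m_i\mathbf{a}_i(t)}{\sqrt{1-\mathbf{v}_i^2}}=e_i[\mathbf{E}_j-(\mathbf{v}_i\cdot\mathbf{E}_j)\mathbf{v}_i+\mathbf{v}_i\times\mathbf{B}_j]$,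 where $\mathbf{E}_j=\frac12(\mathbf{E}_j^++\mathbf{E}_j^-)$, $\mathbf{B}_j=\frac12(\mathbf{B}_j^++\mathbf{B}_j^-)$ are evaluated at $(t,\mathbf{x}_i(t))$, with $\mathbf{E}_j^\pm(t,\mathbf{x})=e_j(1-|\mathbf{v}_j^\pm|^2)\frac{|\vec\nabla\phi_j^\pm|^3}{(\phi_j^\pm)^2}(\hat{\mathbf{n}}_j^\pm\pm\mathbf{v}_j^\pm)+e_j\frac{\hat{\mathbf{n}}_j^\pm\times(\hat{\mathbf{n}}_j^\pm\times\mathbf{J}_j^\pm)}{\phi_j^\pm}$, $\mathbf{B}_j^\pm=\mp\hat{\mathbf{n}}_j^\pm\times\mathbf{E}_j^\pm$, $\mathbf{J}_j^\pm=|\vec\nabla\phi_j^\pm|^3(\mathbf{a}_j^\pm\mp\hat{\mathbf{n}}_j^\pm\times(\mathbf{v}_j^\pm\times\mathbf{a}_j^\pm))$; (b) at velocity discontinuities the left and right values agree (Weierstrass–Erdmann conditions) for $\mathbf{P}_i=\frac{m_i\mathbf{v}_i}{\sqrt{1-\mathbf{v}_i^2}}-\Big(\frac{\mathbf{v}_j^-}{2r_{ji}^-D_{ji}^-}+\frac{\mathbf{v}_j^+}{2r_{ji}^+D_{ji}^+}\Big)$ and $E_i=\frac{m_i}{\sqrt{1-\mathbf{v}_i^2}}-\Big(\frac{1}{2r_{ji}^-D_{ji}^-}+\frac{1}{2r_{ji}^+D_{ji}^+}\Big)$, where $r_{ji}^\pm=\phi_j^\pm(t,\mathbf{x}_i(t))$,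 $D_{ji}^\pm=1/|\vec\nabla\phi_j^\pm(t,\mathbf{x}_i(t))|$. A type-(ii) orbit is a periodic orbit whose velocities have modulus less than $1$ wherever defined and are discontinuous on a countable set of points (breaking points; the corresponding times are breaking times). A musical orbit is a type-(ii) orbit satisfying (P1), (P2), (P3): (P1) Both trajectories are periodic and have the same integer number $2N$ of breaking points inside each period $T$. (P2) There are $\mu\in\mathbb{R}$, a bounded $C^2$ function $\mathtt{G}:\mathbb{R}\to\mathbb{R}^3$ and $\tau\in\{0,T/2\}$ such that the image trajectory $\mathbf{X}_\mu(t)=-\mathtt{G}(t)+\mu\,\mathbf{x}_e(t)$ is sub-luminal ($|\dot{\mathbf{X}}_\mu|<1$ except possibly on a countable set), the map $t^*\mapsto t^*+\tau$ is a one-to-one correspondence from the protonic breaking times onto the breaking times (velocity discontinuities) of $\mathbf{X}_\mu$ (these being also the times of the electronic breaking points), and $\mathbf{x}_p(t^* )=\mathbf{X}_\mu(t^*+\tau)$ for every protonic breaking time $t^*$. The image trajectory is $T$-periodic. (P3) At each protonic breaking time $t^*$, the one-sided velocities (left $\ell$, right $r$) satisfy $\mathbf{v}_p^{\ell}(t^* )=\mathbf{V}_\mu^{\ell}(t^*+\tau)$ and $\mathbf{v}_p^{r}(t^* )=\mathbf{V}_\mu^{r}(t^*+\tau)$, where $\mathbf{V}_\mu=\dot{\mathbf{X}}_\mu=-\dot{\mathtt{G}}+\mu\mathbf{v}_e$. The synchronization functions $\phi_\mu^\pm$ are the delay functions of $\mathbf{X}_\mu$: $\phi_\mu^\pm(t,\mathbf{x})=|\mathbf{x}-\mathbf{X}_\mu(t\pm\phi_\mu^\pm)|$.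 A quasi-polynomial in one variable $z$ is a finite sum $\sum_k p_k(z)e^{\lambda_kz}$ with $p_k$ complex polynomials and $\lambda_k\in\mathbb{C}$ (in particular any polynomial). The space $\mathbb{W}^{2,2}(\mathbb{R}^3)$ of complex functions carries the norm $\big(\sum_{|\kappa|\le2}\int_{\mathbb{R}^3}|D^\kappa\Psi|^2d^3\mathbf{x}\big)^{1/2}$.
   Formalization: The countable exceptional set in ''sub-luminal'' for the image trajectory is taken to be the times where its velocity does not exist; isolated smooth instants with speed 1 are excluded, since there the second derivatives of the delay are not square integrable and the claim fails. *)

(* Defs.v *)
From HB Require Import structures.
From mathcomp Require Import all_boot all_order all_algebra.
From mathcomp Require Import complex.
From mathcomp Require Import all_classical all_reals all_analysis.

Set Implicit Arguments.
Unset Strict Implicit.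
Unset Printing Implicit Defensive.

Import Order.TTheory GRing.Theory Num.Theory.
Import numFieldNormedType.Exports.

Local Open Scope classical_set_scope.
Local Open Scope ring_scope.
Local Open Scope complex_scope.

(* The library norm `|u| on 'rV[R]_3 is the sup norm; lengths are measured
   with [enorm].  The topologies agree. *)
Definition dot (R : realType) (u v : 'rV[R]_3) : R :=
  \sum_(i < 3) u 0 i * v 0 i.

Definition enorm (R : realType) (u : 'rV[R]_3) : R := Num.sqrt (dot u u).

(* Indices are added modulo 3, 'I_3 being convertible to 'Z_3. *)
Definition cross (R : realType) (u v : 'rV[R]_3) : 'rV[R]_3 :=
  \row_(i < 3) (u 0 (i + 1) * v 0 (i + 2%:R) - u 0 (i + 2%:R) * v 0 (i + 1)).

Definition bounded_map (R : realType) (x : R -> 'rV[R]_3) : Prop :=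
  exists M : R, forall t, enorm (x t) <= M.

Definition bounded_trajectory (R : realType) (x : R -> 'rV[R]_3) : Prop :=
  continuous x /\ bounded_map x.

Definition vel (R : realType) (x : R -> 'rV[R]_3) : R -> 'rV[R]_3 := derive1 x.

Definition acc (R : realType) (x : R -> 'rV[R]_3) : R -> 'rV[R]_3 := derive1 (vel x).

Definition lvel (R : realType) (x : R -> 'rV[R]_3) (t : R) : 'rV[R]_3 :=
  lim (vel x @ t^'-).

Definition rvel (R : realType) (x : R -> 'rV[R]_3) (t : R) : 'rV[R]_3 :=
  lim (vel x @ t^'+).

(* The countable exceptional set is the set where the velocity does not
   exist: no instant with a well-defined velocity of modulus >= 1. *)
Definition sub_luminal (R : realType) (x : R -> 'rV[R]_3) : Prop :=
  countable [set t | ~ derivable x t 1] /\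
  forall t, derivable x t 1 -> enorm (vel x t) < 1.

Definition C2_at (R : realType) (x : R -> 'rV[R]_3) (t : R) : Prop :=
  \forall u \near t, [/\ derivable x u 1, derivable (vel x) u 1
                       & {for u, continuous (acc x)}].

(* C^2 up to the end points on each of locally finitely many segments. *)
Definition piecewise_C2 (R : realType) (x : R -> 'rV[R]_3) : Prop :=
  (forall a b : R, finite_set [set t | a <= t <= b /\ ~ C2_at x t]) /\
  forall t, [/\ cvg (vel x @ t^'-), cvg (vel x @ t^'+),
                cvg (acc x @ t^'-) & cvg (acc x @ t^'+)].

Definition breaking_times (R : realType) (x : R -> 'rV[R]_3) : set R :=
  [set t | ~ (derivable x t 1 /\ {for t, continuous (vel x)})].

Definition periodic (R : realType) (T : R) (x : R -> 'rV[R]_3) : Prop :=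
  forall t, x (t + T) = x t.

(* Throughout, the parameter s stands for the superscript: s = 1 for + and
   s = -1 for -. *)

Definition delay (R : realType) (s : R) (x : R -> 'rV[R]_3)
    (t : R) (y : 'rV[R]_3) : R :=
  get [set d | 0 <= d /\ d = enorm (y - x (t + s * d))].

Definition deviating_time (R : realType) (s : R) (x : R -> 'rV[R]_3)
    (t : R) (y : 'rV[R]_3) : R :=
  t + s * delay s x t y.

Definition nhat (R : realType) (s : R) (x : R -> 'rV[R]_3)
    (t : R) (y : 'rV[R]_3) : 'rV[R]_3 :=
  let w := y - x (deviating_time s x t y) in (enorm w)^-1 *: w.

Definition grad_delay (R : realType) (s : R) (x : R -> 'rV[R]_3)
    (t : R) (y : 'rV[R]_3) : 'rV[R]_3 :=
  let n := nhat s x t y in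
  (1 + s * dot n (vel x (deviating_time s x t y)))^-1 *: n.

Definition J_vec (R : realType) (s : R) (x : R -> 'rV[R]_3)
    (t : R) (y : 'rV[R]_3) : 'rV[R]_3 :=
  let n := nhat s x t y in
  let v := vel x (deviating_time s x t y) in
  let a := acc x (deviating_time s x t y) in
  enorm (grad_delay s x t y) ^+ 3 *: (a - s *: cross n (cross v a)).

Definition E_field_s (R : realType) (s : R) (e : R) (x : R -> 'rV[R]_3)
    (t : R) (y : 'rV[R]_3) : 'rV[R]_3 :=
  let n := nhat s x t y in
  let v := vel x (deviating_time s x t y) in
  let d := delay s x t y in
  (e * (1 - enorm v ^+ 2) * (enorm (grad_delay s x t y) ^+ 3 / d ^+ 2))
     *: (n + s *: v)
  + (e / d) *: cross n (cross n (J_vec s x t y)).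

Definition B_field_s (R : realType) (s : R) (e : R) (x : R -> 'rV[R]_3)
    (t : R) (y : 'rV[R]_3) : 'rV[R]_3 :=
  - s *: cross (nhat s x t y) (E_field_s s e x t y).

Definition E_field (R : realType) (e : R) (x : R -> 'rV[R]_3)
    (t : R) (y : 'rV[R]_3) : 'rV[R]_3 :=
  2^-1 *: (E_field_s 1 e x t y + E_field_s (-1) e x t y).

Definition B_field (R : realType) (e : R) (x : R -> 'rV[R]_3)
    (t : R) (y : 'rV[R]_3) : 'rV[R]_3 :=
  2^-1 *: (B_field_s 1 e x t y + B_field_s (-1) e x t y).

Definition gamma_inv (R : realType) (v : 'rV[R]_3) : R :=
  Num.sqrt (1 - enorm v ^+ 2).

(* The fields and currents divide by these delays; since 1 / 0 = 0 here, that
   they are defined has to be said. *)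
Definition delays_pos (R : realType) (xi xj : R -> 'rV[R]_3) (t : R) : Prop :=
  0 < delay 1 xj t (xi t) /\ 0 < delay (-1) xj t (xi t).

(* Imposed at the times where all the accelerations entering the equation
   exist: the fields at (t, xi t) involve xj at its two deviating times. *)
Definition wheeler_feynman (R : realType) (mi ei : R) (xi : R -> 'rV[R]_3)
    (ej : R) (xj : R -> 'rV[R]_3) : Prop :=
  forall t,
    C2_at xi t ->
    C2_at xj (deviating_time 1 xj t (xi t)) ->
    C2_at xj (deviating_time (-1) xj t (xi t)) ->
    let v := vel xi t in
    let E := E_field ej xj t (xi t) in
    let B := B_field ej xj t (xi t) in
    delays_pos xi xj t /\
    (mi / gamma_inv v) *: acc xi t = ei *: (E - dot v E *: v + cross v B).

(* 1 / (2 r D), with r = phi(t, xi t) and D = 1 / |grad phi(t, xi t)| *)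
Definition inv_2rD (R : realType) (s : R) (xi xj : R -> 'rV[R]_3) (t : R) : R :=
  let r := delay s xj t (xi t) in
  let D := (enorm (grad_delay s xj t (xi t)))^-1 in
  (2 * r * D)^-1.

Definition WE_momentum (R : realType) (mi : R) (xi xj : R -> 'rV[R]_3)
    (t : R) : 'rV[R]_3 :=
  let vj s := vel xj (deviating_time s xj t (xi t)) in
  (mi / gamma_inv (vel xi t)) *: vel xi t
  - (inv_2rD (-1) xi xj t *: vj (-1) + inv_2rD 1 xi xj t *: vj 1).

Definition WE_energy (R : realType) (mi : R) (xi xj : R -> 'rV[R]_3)
    (t : R) : R :=
  mi / gamma_inv (vel xi t) - (inv_2rD (-1) xi xj t + inv_2rD 1 xi xj t).

Definition weierstrass_erdmann (R : realType) (mi : R)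
    (xi xj : R -> 'rV[R]_3) : Prop :=
  forall t, breaking_times xi t ->
    [/\ delays_pos xi xj t,
        exists P : 'rV[R]_3, WE_momentum mi xi xj @ t^'- --> P /\
                             WE_momentum mi xi xj @ t^'+ --> P
      & exists E : R, WE_energy mi xi xj @ t^'- --> E /\
                      WE_energy mi xi xj @ t^'+ --> E].

(* Electron: mass 1, charge -1; proton: mass Mp, charge 1. *)
Record orbit (R : realType) (Mp : R) (xe xp : R -> 'rV[R]_3) : Prop := Orbit {
  orbit_bounded_e : bounded_trajectory xe;
  orbit_bounded_p : bounded_trajectory xp;
  orbit_C2_e : piecewise_C2 xe;
  orbit_C2_p : piecewise_C2 xp;
  orbit_WF_e : wheeler_feynman 1 (-1) xe 1 xp;
  orbit_WF_p : wheeler_feynman Mp 1 xp (-1) xe;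
  orbit_WE_e : weierstrass_erdmann 1 xe xp;
  orbit_WE_p : weierstrass_erdmann Mp xp xe
}.

(* "Modulus less than 1 wherever defined", the one-sided velocities being
   defined everywhere, at the breaking times included. *)
Definition velocities_lt1 (R : realType) (x : R -> 'rV[R]_3) : Prop :=
  forall t, [/\ derivable x t 1 -> enorm (vel x t) < 1,
                enorm (lvel x t) < 1 & enorm (rvel x t) < 1].

Record type_ii_orbit (R : realType) (Mp : R) (xe xp : R -> 'rV[R]_3) (T : R)
    : Prop := TypeIIOrbit {
  type_ii_orbit_orbit : orbit Mp xe xp;
  type_ii_T_gt0 : 0 < T;
  type_ii_periodic_e : periodic T xe;
  type_ii_periodic_p : periodic T xp;
  type_ii_lt1_e : velocities_lt1 xe;
  type_ii_lt1_p : velocities_lt1 xp;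
  type_ii_countable_e : countable (breaking_times xe);
  type_ii_countable_p : countable (breaking_times xp)
}.

Definition breaking_per_period (R : realType) (T : R) (n : nat)
    (x : R -> 'rV[R]_3) : Prop :=
  forall a : R, ([set t | breaking_times x t /\ a <= t < a + T] #= `I_n)%card.

Definition image_trajectory (R : realType) (mu : R) (G xe : R -> 'rV[R]_3)
    (t : R) : 'rV[R]_3 :=
  - G t + mu *: xe t.

Record musical_P2 (R : realType) (xe xp : R -> 'rV[R]_3)
    (T mu : R) (G : R -> 'rV[R]_3) (tau : R) : Prop := MusicalP2 {
  P2_G_bounded : bounded_map G;
  P2_G_C2 : forall t, C2_at G t;
  P2_tau : tau = 0 \/ tau = T / 2;
  P2_periodic : periodic T (image_trajectory mu G xe);
  P2_sub_luminal : sub_luminal (image_trajectory mu G xe);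
  P2_correspondence :
    set_bij (breaking_times xp) (breaking_times (image_trajectory mu G xe))
            (fun t => t + tau);
  P2_electronic :
    breaking_times (image_trajectory mu G xe) = breaking_times xe;
  P2_position : forall t, breaking_times xp t ->
    xp t = image_trajectory mu G xe (t + tau)
}.

Definition musical_P3 (R : realType) (xe xp : R -> 'rV[R]_3)
    (mu : R) (G : R -> 'rV[R]_3) (tau : R) : Prop :=
  forall t, breaking_times xp t ->
    lvel xp t = lvel (image_trajectory mu G xe) (t + tau) /\
    rvel xp t = rvel (image_trajectory mu G xe) (t + tau).

Record musical_orbit (R : realType) (Mp : R) (xe xp : R -> 'rV[R]_3)
    (T mu : R) (G : R -> 'rV[R]_3) (tau : R) : Prop := MusicalOrbit {
  musical_type_ii : type_ii_orbit Mp xe xp T;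
  musical_1 : exists N : nat,
    breaking_per_period T (2 * N) xe /\ breaking_per_period T (2 * N) xp;
  musical_2 : musical_P2 xe xp T mu G tau;
  musical_3 : musical_P3 xe xp mu G tau
}.

Definition cexp (R : realType) (z : R[i]) : R[i] :=
  (expR (complex.Re z))%:C * (cos (complex.Im z) +i* sin (complex.Im z)).

Definition quasi_polynomial (R : realType) (P : R[i] -> R[i]) : Prop :=
  exists s : seq ({poly R[i]} * R[i]),
    forall z, P z = \sum_(pl <- s) pl.1.[z] * cexp (pl.2 * z).

Definition lebesgue3 (R : realType) :
    {measure set (measurableTypeR R * measurableTypeR R * measurableTypeR R)
      -> \bar R} :=
  ((@lebesgue_measure R \x @lebesgue_measure R) \x @lebesgue_measure R)%E.

Definition vec3 (R : realType) (p : R * R * R) : 'rV[R]_3 :=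
  \row_(i < 3) [:: p.1.1; p.1.2; p.2]`_i.

Definition L2_complex (R : realType) (f : 'rV[R]_3 -> R[i]) : Prop :=
  (fun p => complex.Re (f (vec3 p))) \in Lfun (@lebesgue3 R) 2%:E /\
  (fun p => complex.Im (f (vec3 p))) \in Lfun (@lebesgue3 R) 2%:E.

Definition partial (R : realType) (i : 'I_3) (f : 'rV[R]_3 -> R)
    (x : 'rV[R]_3) : R :=
  'D_(delta_mx 0 i) f x.

Definition smooth (R : realType) (f : 'rV[R]_3 -> R) : Prop :=
  forall s : seq 'I_3,
    let g := foldr (@partial R) f s in
    continuous g /\ forall i x, derivable g x (delta_mx 0 i).

Definition test_function (R : realType) (f : 'rV[R]_3 -> R) : Prop :=
  smooth f /\ compact (closure [set x | f x != 0]).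

Definition mi_order (kappa : 'I_3 -> nat) : nat := (\sum_(i < 3) kappa i)%N.

Definition mi_deriv (R : realType) (kappa : 'I_3 -> nat)
    (f : 'rV[R]_3 -> R) : 'rV[R]_3 -> R :=
  foldr (fun i => iter (kappa i) (partial i)) f (enum 'I_3).

(* g = D^kappa f in the sense of distributions; real test functions suffice
   by linearity. *)
Definition weak_deriv (R : realType) (kappa : 'I_3 -> nat)
    (f g : 'rV[R]_3 -> R[i]) : Prop :=
  forall eta : 'rV[R]_3 -> R, test_function eta ->
    \int[@lebesgue3 R]_p
        (complex.Re (f (vec3 p)) * mi_deriv kappa eta (vec3 p)) =
      (-1) ^+ mi_order kappa *
      \int[@lebesgue3 R]_p (complex.Re (g (vec3 p)) * eta (vec3 p))
    /\
    \int[@lebesgue3 R]_p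
        (complex.Im (f (vec3 p)) * mi_deriv kappa eta (vec3 p)) =
      (-1) ^+ mi_order kappa *
      \int[@lebesgue3 R]_p (complex.Im (g (vec3 p)) * eta (vec3 p)).

(* Finiteness of the W^{2,2} norm: f and its weak derivatives D^kappa f,
   |kappa| <= 2, are square integrable. *)
Definition W22 (R : realType) (f : 'rV[R]_3 -> R[i]) : Prop :=
  L2_complex f /\
  forall kappa : 'I_3 -> nat, (mi_order kappa <= 2)%N ->
    exists2 g, L2_complex g & weak_deriv kappa f g.

Definition Delta_s (R : realType) (s : R) (xe xp : R -> 'rV[R]_3)
    (mu : R) (G : R -> 'rV[R]_3) (tau t : R) (x : 'rV[R]_3) : R :=
  delay s xp t x - delay s (image_trajectory mu G xe) (t + tau) x.

(* exp(-i s k |x| - i w t) Delta_s^s(t,x), for s = 1 and s = -1 *)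
Definition wave (R : realType) (s : R) (xe xp : R -> 'rV[R]_3)
    (mu : R) (G : R -> 'rV[R]_3) (tau k w t : R) (x : 'rV[R]_3) : R[i] :=
  cexp ('i%C * (- s * k * enorm x - w * t)%:C)
  * (Delta_s s xe xp mu G tau t x)%:C.

Definition varphi (R : realType) (xe xp : R -> 'rV[R]_3)
    (mu : R) (G : R -> 'rV[R]_3) (tau : R) (alpha beta : R[i]) (k w t : R)
    (x : 'rV[R]_3) : R[i] :=
  alpha * wave 1 xe xp mu G tau k w t x
  + beta * wave (-1) xe xp mu G tau k w t x.

Definition varphi_dagger (R : realType) (xe xp : R -> 'rV[R]_3)
    (mu : R) (G : R -> 'rV[R]_3) (tau : R) (alpha beta : R[i]) (k w t : R)
    (x : 'rV[R]_3) : R[i] :=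
  alpha * wave 1 xe xp mu G tau k w t x
  - beta * wave (-1) xe xp mu G tau k w t x.

(* Main.v *)
(* On a light cone through a breaking point of the proton, the two deviating
   times, positions and one-sided velocities agree by (P2) and (P3), so that
   Delta_s and its gradient extend continuously across it although the gradient
   of each delay jumps.  Away from these cones the delays are as regular as the
   trajectories, up to a 1/r singularity of the second derivatives at the tip of
   each cone, the three points 0, x_p(t), X_mu(t + tau) at which |x|, phi_p and
   phi_mu are not differentiable.  Hence Delta_s is Lipschitz, and its gradient g
   satisfies |g x - g y| <= C (1 + \sum_a 1/|x - a|) |x - y|.  The class of
   functions with these bounds is stable under products and smooth functions; by
   translation invariance and dominated convergence applied to difference
   quotients, their almost everywhere derivatives are weak derivatives, and
   (1/r) exp(-q r) is square integrable in dimension three. *)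

From HB Require Import structures.
Require Import Defs.
From mathcomp Require Import all_boot all_order all_algebra.
From mathcomp Require Import complex.
From mathcomp Require Import all_classical all_reals all_analysis.
From mathcomp Require Import measurable_realfun.
From mathcomp Require Import ring lra.

Set Implicit Arguments.
Unset Strict Implicit.
Unset Printing Implicit Defensive.

Import Order.TTheory GRing.Theory Num.Theory.
Import numFieldNormedType.Exports.

Local Open Scope classical_set_scope.
Local Open Scope ring_scope.

(** * Euclidean geometry and Lebesgue measure of R^3 *)

Section EuclideanNorm.
Context {R : realType}.
Implicit Types (u v w : 'rV[R]_3) (a : R).

(** Two obstacles shape the proof. The gradient of a single delay jumps on the breaking cones, so
    terms cannot be paired across a cone. The difference of gradients is bounded instead by a scalar
    [gap] that is weighted Lipschitz everywhere and vanishes where a deviating time is a breaking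
    time. If a cone separates x and y, the segment between them meets it at some z, and the values
    at x and at y are each bounded through [gap], hence by a weighted multiple of |x - y|. That the
    two trajectories meet at a breaking time also puts every x on the same side of the cone for
    both. Secondly, every estimate needs one speed bound c < 1, whereas the hypotheses give speeds
    below 1 pointwise. Compactness of a period yields c once the one-sided velocities are below 1
    too; for the image trajectory this is a second use of (P3). The velocity is represented by its
    right limit, defined at all times. Second derivatives exist off countably many spheres, the
    sections at time t of the light cones through the times where a trajectory is not C^2, and these
    form a null set. *)

Definition i0 : 'I_3 := @Ordinal 3 0 isT.
Definition i1 : 'I_3 := @Ordinal 3 1 isT.
Definition i2 : 'I_3 := @Ordinal 3 2 isT.

Lemma big_ord3 (V : nmodType) (F : 'I_3 -> V) :
  \sum_(i < 3) F i = F i0 + F i1 + F i2.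
Proof.
rewrite !big_ord_recr big_ord0 /= add0r.
by congr (F _ + F _ + F _); apply/val_inj.
Qed.

Lemma ord3P (Q : 'I_3 -> Prop) : Q i0 -> Q i1 -> Q i2 -> forall i, Q i.
Proof.
move=> q0 q1 q2 [[|[|[|//]]] h]; [move: q0 | move: q1 | move: q2];
by congr Q; apply/val_inj.
Qed.

Lemma dotE u v : dot u v = u 0 i0 * v 0 i0 + u 0 i1 * v 0 i1 + u 0 i2 * v 0 i2.
Proof. by rewrite /dot big_ord3. Qed.

Lemma dotC u v : dot u v = dot v u.
Proof. by rewrite !dotE; ring. Qed.

Lemma dotDl u v w : dot (u + v) w = dot u w + dot v w.
Proof. by rewrite !dotE !mxE; ring. Qed.

Lemma dotZl a u w : dot (a *: u) w = a * dot u w.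
Proof. by rewrite !dotE !mxE; ring. Qed.

Lemma dotBl u v w : dot (u - v) w = dot u w - dot v w.
Proof. by rewrite !dotE !mxE; ring. Qed.

Lemma dotDr u v w : dot w (u + v) = dot w u + dot w v.
Proof. by rewrite !dotE !mxE; ring. Qed.

Lemma dotZr a u w : dot w (a *: u) = a * dot w u.
Proof. by rewrite !dotE !mxE; ring. Qed.

Lemma dotBr u v w : dot w (u - v) = dot w u - dot w v.
Proof. by rewrite !dotE !mxE; ring. Qed.

Lemma dot_ge0 u : 0 <= dot u u.
Proof. by rewrite dotE; nra. Qed.

Lemma enorm_ge0 u : 0 <= enorm u.
Proof. exact: sqrtr_ge0. Qed.

Lemma sqr_enorm u : enorm u ^+ 2 = dot u u.
Proof. by rewrite /enorm sqr_sqrtr // dot_ge0. Qed.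

Lemma enorm_le u a : 0 <= a -> dot u u <= a ^+ 2 -> enorm u <= a.
Proof. by move=> a0 h; rewrite -(ler_pXn2r (n := 2)) ?nnegrE ?enorm_ge0// sqr_enorm. Qed.

Lemma enorm0 : enorm (0 : 'rV[R]_3) = 0.
Proof. by rewrite /enorm dotE !mxE !mul0r !addr0 sqrtr0. Qed.

Lemma enormZ a u : enorm (a *: u) = `|a| * enorm u.
Proof. by rewrite /enorm dotZl dotZr mulrA -expr2 sqrtrM ?sqr_ge0// sqrtr_sqr. Qed.

Lemma enormN u : enorm (- u) = enorm u.
Proof. by rewrite -scaleN1r enormZ normrN1 mul1r. Qed.

Lemma enormC u v : enorm (u - v) = enorm (v - u).
Proof. by rewrite -opprB enormN. Qed.

Lemma ler_dot u v : `|dot u v| <= enorm u * enorm v.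
Proof.
rewrite -(ler_pXn2r (n := 2)) ?nnegrE ?mulr_ge0 ?enorm_ge0//.
rewrite exprMn !sqr_enorm real_normK ?num_real// !dotE.
have := sqr_ge0 (u 0 i0 * v 0 i1 - u 0 i1 * v 0 i0).
have := sqr_ge0 (u 0 i0 * v 0 i2 - u 0 i2 * v 0 i0).
have := sqr_ge0 (u 0 i1 * v 0 i2 - u 0 i2 * v 0 i1).
by nra.
Qed.

Lemma ler_enormD u v : enorm (u + v) <= enorm u + enorm v.
Proof.
apply: enorm_le; first by rewrite addr_ge0 ?enorm_ge0.
have /ler_normlP[_ h] := ler_dot u v.
by rewrite dotDl !dotDr (dotC v u) sqrrD !sqr_enorm; nra.
Qed.

Lemma ler_enormB u v : enorm (u - v) <= enorm u + enorm v.
Proof. by rewrite -(enormN v); exact: ler_enormD. Qed.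

Lemma ler_enorm_dist u v : `|enorm u - enorm v| <= enorm (u - v).
Proof.
rewrite ler_distl; apply/andP; split.
  by have := ler_enormD (v - u) u; rewrite subrK enormC; lra.
by have := ler_enormD (u - v) v; rewrite subrK; lra.
Qed.

Lemma ler_enorm_distD w u v : enorm (u - v) <= enorm (u - w) + enorm (w - v).
Proof. by have := ler_enormD (u - w) (w - v); rewrite addrA subrK. Qed.

Lemma enorm_eq0 u : enorm u = 0 -> u = 0.
Proof.
move=> u0; have := sqr_enorm u; rewrite u0 expr0n/= dotE => h.
by apply/rowP => i; rewrite mxE; move: i; apply: ord3P; nra.
Qed.

Lemma enorm_gt0 u : u != 0 -> 0 < enorm u.
Proof.
by move=> u0; rewrite lt_def enorm_ge0 andbT; apply: contra u0 => /eqP/enorm_eq0->.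
Qed.

Lemma ler_coord_enorm u i : `|u 0 i| <= enorm u.
Proof.
rewrite -(ler_pXn2r (n := 2)) ?nnegrE ?enorm_ge0// real_normK ?num_real// sqr_enorm dotE.
by move: i; apply: ord3P; nra.
Qed.

Lemma enorm_delta i : enorm (delta_mx 0 i : 'rV[R]_3) = 1.
Proof.
rewrite /enorm dotE !mxE/=.
by move: i; apply: ord3P; rewrite /= ?(mulr0,mul0r,addr0,add0r,mulr1) sqrtr1.
Qed.

Lemma dot_delta u i : dot (delta_mx 0 i) u = u 0 i.
Proof.
rewrite dotE !mxE/=; move: i.
by apply: ord3P; rewrite /= ?(mulr0,mul0r,addr0,add0r,mul1r).
Qed.

Lemma ler_enorm_norm u : enorm u <= 3 * `|u|.
Proof.
apply: enorm_le; first by rewrite mulr_ge0.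
have h i : u 0 i ^+ 2 <= `|u| ^+ 2.
  rewrite -real_normK ?num_real// ler_pXn2r ?nnegrE//.
  by rewrite [leRHS]/Num.Def.normr/= mx_normrE (le_bigmax _ (fun ij => `|u ij.1 ij.2|) (0, i)).
by have := (h i0, h i1, h i2); rewrite dotE => -[[]]; nra.
Qed.

Lemma ler_norm_enorm u : `|u| <= enorm u.
Proof.
rewrite [leLHS]/Num.Def.normr/= mx_normrE; apply: bigmax_le; first exact: enorm_ge0.
by move=> [i j] _ /=; rewrite ord1; exact: ler_coord_enorm.
Qed.

Lemma nbhs_enormP u (Q : set 'rV[R]_3) :
  nbhs u Q <-> exists2 e, 0 < e & forall v, enorm (u - v) < e -> Q v.
Proof.
split=> [/(iffLR (@nbhs_normP _ 'rV[R]_3 u Q))[e /= e0 h]|[e e0 h]].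
  by exists e => // v uv; apply: h; exact: le_lt_trans (ler_norm_enorm _) uv.
apply: (iffRL (@nbhs_normP _ 'rV[R]_3 u Q)); exists (3^-1 * e) => /=.
  by rewrite mulr_gt0// invr_gt0.
move=> v /= uv; apply: h; apply: le_lt_trans (ler_enorm_norm _) _.
by rewrite -ltr_pdivlMl.
Qed.

Lemma continuous_enorm : continuous (@enorm R).
Proof.
move=> u; apply: (iffRL (@cvgrPdist_lt _ _ _ (nbhs u) _ _ _)) => e e0.
apply/nbhs_enormP; exists e => // v.
by apply: le_lt_trans; exact: ler_enorm_dist.
Qed.

End EuclideanNorm.

Notation R3 R := (measurableTypeR R * measurableTypeR R * measurableTypeR R)%type.

(** * Translation invariance of Lebesgue measure on R^3 *)

Section Translation.
Context {R : realType}.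
Notation mu := (@lebesgue_measure R).

(* The library's instance of a sigma-finite product is shadowed by the one for
   finite measures, hence this copy of the two-dimensional measure. *)
Definition lebesgue2 := (mu \x mu)%E.

HB.instance Definition _ := Measure.on lebesgue2.

Lemma sigma_finite_lebesgue2 : sigma_finite setT lebesgue2.
Proof.
have /sigma_finiteP[F [TF ndF Foo]] := sigma_finiteT mu.
exists (fun n => F n `*` F n).
  rewrite -setXTT TF predeqE => -[x y]; split.
    move=> [/= [n _ Fnx] [k _ Gky]]; exists (maxn n k) => //; split.
    - by move: x Fnx; exact/subsetPset/ndF/leq_maxl.
    - by move: y Gky; exact/subsetPset/ndF/leq_maxr.
  by move=> [n _ []/= ? ?]; split; exists n.
move=> k; have [? ?] := Foo k.
split; first exact: measurableX.
by rewrite [ltLHS]product_measure1E// lte_mul_pinfty// ge0_fin_numE.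
Qed.

HB.instance Definition _ :=
  Measure_isSigmaFinite.Build _ _ _ lebesgue2 sigma_finite_lebesgue2.

Definition shift3 (v p : R3 R) : R3 R := (p.1.1 + v.1.1, p.1.2 + v.1.2, p.2 + v.2).

Definition shift1 (a s : measurableTypeR R) : measurableTypeR R := s + a.

Lemma measurable_shift1 a : measurable_fun setT (shift1 a).
Proof. exact: measurable_funD. Qed.

HB.instance Definition _ a :=
  isMeasurableFun.Build _ _ _ _ (shift1 a) (measurable_shift1 a).

(** Lebesgue measure is determined by its values on half-open intervals, whose length a shift
    preserves. *)
Lemma lebesgue_measure_shift1 a (A : set (measurableTypeR R)) : measurable A ->
  pushforward mu (shift1 a) A = mu A.
Proof.
move=> mA; apply/esym/lebesgue_measure_unique => // X.
case/ocitvP => [->|[[x y] /= xy ->]]; first by rewrite !measure0.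
rewrite /pushforward/= (_ : shift1 a @^-1` _ = `]x - a, y - a]%classic).
  by rewrite !lebesgue_measure_itv/= !lte_fin ltrD2r -!EFinB; congr (if _ then _%:E else _); ring.
by apply/seteqP; split => s; rewrite /= !in_itv/= /shift1 ltrBlDr lerBrDr.
Qed.

Lemma measurable_shift3 v : measurable_fun setT (shift3 v).
Proof.
apply: measurable_fun_pair; [apply: measurable_fun_pair|].
- apply: (measurableT_comp (measurable_shift1 v.1.1)).
  by apply: (measurableT_comp measurable_fst); exact: measurable_fst.
- apply: (measurableT_comp (measurable_shift1 v.1.2)).
  by apply: (measurableT_comp measurable_snd); exact: measurable_fst.
- by apply: (measurableT_comp (measurable_shift1 v.2)); exact: measurable_snd.
Qed.

HB.instance Definition _ v :=
  isMeasurableFun.Build _ _ _ _ (shift3 v) (measurable_shift3 v).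

Definition shift2 (v p : measurableTypeR R * measurableTypeR R) := (shift1 v.1 p.1, shift1 v.2 p.2).

Lemma measurable_shift2 v : measurable_fun setT (shift2 v).
Proof.
apply: measurable_fun_pair.
- by apply: (measurableT_comp (measurable_shift1 v.1)); exact: measurable_fst.
- by apply: (measurableT_comp (measurable_shift1 v.2)); exact: measurable_snd.
Qed.

HB.instance Definition _ v :=
  isMeasurableFun.Build _ _ _ _ (shift2 v) (measurable_shift2 v).

(** Uniqueness of product measures, used twice: the preimage of a rectangle is a rectangle, with the
    planar shift [shift2] on its base, which is treated in the same way. *)
Lemma lebesgue_measure_shift3 v (A : set (R3 R)) : measurable A ->
  pushforward (@lebesgue3 R) (shift3 v) A = @lebesgue3 R A.
Proof.
move=> mA; apply/esym; rewrite /lebesgue3.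
have := @product_measure_unique _ _ _ _ R lebesgue2 mu (pushforward (@lebesgue3 R) (shift3 v)).
move=> /(_ (measurable_shift3 v) _ A mA); apply => B C mB mC.
rewrite /lebesgue3/= /pushforward/= (_ : shift3 v @^-1` (B `*` C) =
  (shift2 v.1 @^-1` B) `*` (shift1 v.2 @^-1` C)); last by [].
have mpre1 := measurable_funPTI (shift1 v.2) mC.
have mpre2 := measurable_funPTI (shift2 v.1) mB.
rewrite [LHS]product_measure1E//; congr (_ * _)%E; last exact: lebesgue_measure_shift1.
have := @product_measure_unique _ _ _ _ R mu mu (pushforward lebesgue2 (shift2 v.1)).
move=> /(_ (measurable_shift2 v.1) _ B mB) h; apply/esym; apply: h => {mpre1 mpre2 mA A mB mC} B' C' mB mC.
transitivity (lebesgue2 ((shift1 v.1.1 @^-1` B') `*` (shift1 v.1.2 @^-1` C'))); first by [].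
rewrite [LHS]product_measure1E//; [|exact: measurable_funPTI..].
by congr (_ * _)%E; exact: lebesgue_measure_shift1.
Qed.

Lemma Rintegral_shift3 v (f : R3 R -> R) :
  (@lebesgue3 R).-integrable setT (EFin \o f) ->
  \int[@lebesgue3 R]_p f (shift3 v p) = \int[@lebesgue3 R]_p f p.
Proof.
move=> fi; congr fine.
have mf : measurable_fun setT (EFin \o f) := measurable_int _ fi.
have fvi : (@lebesgue3 R).-integrable (shift3 v @^-1` setT) ((EFin \o f) \o shift3 v).
  rewrite preimage_setT; apply/integrableP; split; first exact: measurableT_comp.
  have /integrableP[_] := fi; apply: le_lt_trans.
  have mfa : measurable_fun setT (fun p => `|(f p)%:E|%E) by exact: measurableT_comp.
  have := ge0_integral_pushforward (measurable_shift3 v) (@lebesgue3 R) measurableT mfa (fun=> fun=> abse_ge0 _).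
  rewrite preimage_setT => <-.
  rewrite le_eqVlt; apply/orP; left; apply/eqP.
  by apply: eq_measure_integral => A mA _; exact: lebesgue_measure_shift3.
have := integral_pushforward (measurable_shift3 v) mf fvi measurableT.
rewrite preimage_setT => <-.
apply: eq_measure_integral => A mA _; exact: lebesgue_measure_shift3.
Qed.

End Translation.

(** * Integrability of exponentials at infinity and of 1/r^2 near a point *)

Section Integrability.
Context {R : realType}.
Notation mu := (@lebesgue_measure R).

(** The integrand is even, and on the half-line it is an exponential density up to the factor
    [c^-1]. *)
Lemma integrable_expRN_abs (c : R) : 0 < c ->
  mu.-integrable setT (fun s => (expR (- c * `|s|))%:E).
Proof.
move=> c0.
have cf : continuous (fun s : R => expR (- c * `|s|)).
  move=> s; apply: continuous_comp; last exact: continuous_expR.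
  by apply: continuousM; [exact: cst_continuous|exact: norm_continuous].
apply/integrableP; split.
  by apply/measurable_EFinP; exact: continuous_measurable_fun.
under eq_integral do rewrite /= ger0_norm ?expR_ge0//.
rewrite (ge0_symfun_integralT (fun s => expR_ge0 _) cf); last by move=> s /=; rewrite normrN.
apply: lte_mul_pinfty; [by rewrite lee_fin|by []|].
have pi : mu.-integrable `[0, +oo[%classic (EFin \o exponential_pdf c).
  by apply: integrableS (integrable_exponential_pdf c0) => //.
have ei : mu.-integrable `[0, +oo[%classic (fun s => (expR (- c * `|s|))%:E).
  have := integrableZl _ c^-1 pi; move=> /(_ (measurable_itv _)); apply: eq_integrable => //.
  move=> s; rewrite inE/= in_itv/= andbT => s0.
  by rewrite exponential_pdfE// -EFinM mulKf ?gt_eqF// ger0_norm.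
have /integrableP[_] := ei; rewrite set_itvcy.
by under eq_integral do rewrite /= ger0_norm ?expR_ge0//.
Qed.

Lemma integrable_mul_prod d1 d2 (T1 : measurableType d1) (T2 : measurableType d2)
    (m1 : {sigma_finite_measure set T1 -> \bar R})
    (m2 : {sigma_finite_measure set T2 -> \bar R}) (f : T1 -> R) (g : T2 -> R) :
  (forall x, 0 <= f x) -> (forall y, 0 <= g y) ->
  m1.-integrable setT (EFin \o f) -> m2.-integrable setT (EFin \o g) ->
  (m1 \x m2)%E.-integrable setT (fun p => (f p.1 * g p.2)%:E).
Proof.
move=> f0 g0 /integrableP[mf fi] /integrableP[mg gi].
have {}mf : measurable_fun setT f by apply/measurable_EFinP.
have {}mg : measurable_fun setT g by apply/measurable_EFinP.
have mfg : measurable_fun setT (fun p : T1 * T2 => f p.1 * g p.2).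
  apply: measurable_funM.
    by apply: (measurableT_comp mf).
  by apply: (measurableT_comp mg).
apply/integrable12ltyP; first by apply/measurable_EFinP.
under eq_integral => x _.
  under eq_integral => y _ do rewrite /= normrM EFinM.
  rewrite ge0_integralZl//; last first.
    by apply/measurable_EFinP; exact: measurableT_comp.
  over.
rewrite ge0_integralZr//.
- by rewrite lte_mul_pinfty ?integral_ge0// ge0_fin_numE ?integral_ge0.
- by apply/measurable_EFinP; exact: measurableT_comp.
- exact: integral_ge0.
Qed.

Lemma vec3E (p : R * R * R) i :
  vec3 p 0 i = if i == i0 then p.1.1 else if i == i1 then p.1.2 else p.2.
Proof. by rewrite mxE; move: i; apply: ord3P. Qed.

Lemma measurable_coord_vec3 i :
  measurable_fun setT (fun p : R3 R => vec3 p 0 i : measurableTypeR R).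
Proof.
rewrite (_ : (fun p => _) = fun p => if i == i0 then p.1.1 else if i == i1 then p.1.2 else p.2); last first.
  by apply/funext => p; rewrite vec3E.
case: (i == i0); [|case: (i == i1)].
- by apply: (measurableT_comp measurable_fst); exact: measurable_fst.
- by apply: (measurableT_comp measurable_snd); exact: measurable_fst.
- exact: measurable_snd.
Qed.

Lemma measurable_enorm_vec3 a :
  measurable_fun setT (fun p : R3 R => enorm (vec3 p - a)).
Proof.
apply: (@measurableT_comp _ _ _ _ _ _ (@Num.sqrt R)).
  by apply: continuous_measurable_fun; exact: sqrt_continuous.
have m i : measurable_fun setT (fun p : R3 R => (vec3 p - a) 0 i : R).
  rewrite (_ : (fun p => _) = fun p => vec3 p 0 i - a 0 i); last first.
    by apply/funext => p; rewrite !mxE.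
  by apply: measurable_funB => //; exact: measurable_coord_vec3.
rewrite (_ : (fun p => _) = fun p => dot (vec3 p - a) (vec3 p - a)); last by [].
under eq_fun do rewrite dotE.
by repeat apply: measurable_funD; apply: measurable_funM.
Qed.

(** Each coordinate is at most |x|, so |x| is at least one third of the sum of their absolute
    values, and a product of three one-dimensional exponentials of rate c / 3 dominates. *)
Lemma integrable_expRN_enorm (c : R) : 0 < c ->
  (@lebesgue3 R).-integrable setT (fun p => (expR (- c * enorm (vec3 p)))%:E).
Proof.
move=> c0.
have c30 : 0 < c / 3 by rewrite divr_gt0.
have e1 := integrable_expRN_abs c30.
have e2 := @integrable_mul_prod _ _ _ _ mu mu _ _ (fun=> expR_ge0 _) (fun=> expR_ge0 _) e1 e1.
have e3 := @integrable_mul_prod _ _ _ _ lebesgue2 mu _ _ (fun=> mulr_ge0 (expR_ge0 _) (expR_ge0 _)) (fun=> expR_ge0 _) e2 e1.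
apply: le_integrable e3 => //.
  apply/measurable_EFinP; apply: measurableT_comp => //.
  apply: measurable_funM => //.
  by have := measurable_enorm_vec3 0; under eq_fun do rewrite subr0.
move=> p _ /=; rewrite lee_fin (ger0_norm (expR_ge0 _)).
rewrite (ger0_norm (mulr_ge0 (mulr_ge0 (expR_ge0 _) (expR_ge0 _)) (expR_ge0 _))).
rewrite -!expRD ler_expR.
have h i := ler_wpM2l (ltW c0) (ler_coord_enorm (vec3 p) i).
have : - c * enorm (vec3 p) <= - (c / 3) * `|vec3 p 0 i0|
    + - (c / 3) * `|vec3 p 0 i1| + - (c / 3) * `|vec3 p 0 i2|.
  by have := (h i0, h i1, h i2) => -[[]]; lra.
by rewrite !vec3E.
Qed.

Definition cube (a : 'rV[R]_3) (r : R) : set (R3 R) :=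
  ([set` `[a 0 i0 - r, a 0 i0 + r]] `*` [set` `[a 0 i1 - r, a 0 i1 + r]])
    `*` [set` `[a 0 i2 - r, a 0 i2 + r]].

Lemma measurable_cube a r : measurable (cube a r).
Proof. by apply: measurableX => //; exact: measurableX. Qed.

Lemma lebesgue3_cube a r : 0 <= r -> @lebesgue3 R (cube a r) = ((2 * r) ^+ 3)%:E.
Proof.
move=> r0; have h (b : R) : mu [set` `[b - r, b + r]] = (2 * r)%:E.
  rewrite lebesgue_measure_itv/= lte_fin; case: ltP => brr.
    by rewrite -EFinD; congr _%:E; ring.
  by congr _%:E; lra.
have h2 : lebesgue2 ([set` `[a 0 i0 - r, a 0 i0 + r]] `*` [set` `[a 0 i1 - r, a 0 i1 + r]]) =
    ((2 * r) ^+ 2)%:E.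
  rewrite [LHS]product_measure1E// expr2 EFinM.
  by congr (_ * _)%E; exact: h.
rewrite /cube [LHS]product_measure1E//; last exact: measurableX.
have -> : ((2 * r) ^+ 3)%:E = (((2 * r) ^+ 2)%:E * (2 * r)%:E)%E by rewrite -EFinM -exprSr.
by congr (_ * _)%E; [exact: h2|exact: h].
Qed.

Lemma cubeP a r p : cube a r p <-> forall i, `|(vec3 p - a) 0 i| <= r.
Proof.
have e i : (vec3 p - a) 0 i = vec3 p 0 i - a 0 i by rewrite !mxE.
split=> [[[/=]]|h].
  rewrite !in_itv/= => h0 h1 h2; apply: ord3P; rewrite e vec3E/= ler_distl;
  lra.
by have := (h i0, h i1, h i2); rewrite !e !vec3E/= !ler_distl => -[[h0 h1] h2];
  split; [split|]; rewrite /= in_itv/=.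
Qed.

Lemma geometric_scale (m : R) : 0 < m <= 1 ->
  exists n, 2^-1 ^+ n.+1 < m <= 2^-1 ^+ n.
Proof.
move=> /andP[m0 m1].
have ex : exists n, 2^-1 ^+ n.+1 < m.
  have := cvg_geometric 1 (_ : `|2^-1 : R| < 1); rewrite ger0_norm// invf_lt1// ltr1n => /(_ isT).
  move=> /cvgr_lt /(_ _ m0) [n _ /(_ n.+1)]; rewrite /geometric/= mul1r => h.
  by exists n; apply: h.
case: (ex_minnP ex) => n nm nmin; exists n; rewrite nm/=.
case: n nm nmin => [|n] nm nmin; first by rewrite expr0.
by rewrite leNgt; apply/negP => /nmin; rewrite ltnn.
Qed.

Lemma measurable_funV d (T : measurableType d) (f : T -> R) :
  (forall x, 0 <= f x) -> measurable_fun setT f ->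
  measurable_fun setT (fun x => (f x)^-1).
Proof.
move=> f0 mf; rewrite (_ : (fun x => _) = fun x => f x `^ (-1)); last first.
  by apply/funext => x; rewrite powR_inv1.
exact: (measurableT_comp (measurable_powR _)).
Qed.

(* Near the singularity, [1 / r^2 <= \sum_n 4^(n+1) 1_(C_n)], where [C_n] is
   the cube of half-side [2^-n]: the series of integrals is geometric. *)
Lemma integrable_invsqr_enorm (a : 'rV[R]_3) :
  (@lebesgue3 R).-integrable (cube a 1)
    (fun p => ((enorm (vec3 p - a))^-2)%:E).
Proof.
pose f n p : \bar R := (4 ^+ n.+1 * \1_(cube a (2^-1 ^+ n)) p)%:E.
have f0 n p : (0 <= f n p)%E by rewrite lee_fin mulr_ge0// exprn_ge0.
have mfn n : measurable_fun setT (f n).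
  apply/measurable_EFinP; apply: measurable_funM => //.
  by apply: measurable_indic; exact: measurable_cube.
have mf : measurable_fun setT (fun p : R3 R => ((enorm (vec3 p - a))^-2)%:E).
  apply/measurable_EFinP; apply: measurable_funV => [p|]; first exact: sqr_ge0.
  by apply: measurable_funX; exact: measurable_enorm_vec3.
apply/integrableP; split; first exact: measurable_funTS.
have mS : measurable_fun setT (fun p => \sum_(n <oo) f n p)%E.
  by apply: ge0_emeasurable_sum => // n p _; exact: f0.
apply: (@le_lt_trans _ _ (\int[@lebesgue3 R]_p (\sum_(n <oo) f n p)%E)%E).
  apply: (@le_trans _ _ (\int[@lebesgue3 R]_(p in cube a 1) (\sum_(n <oo) f n p)%E)%E).
    apply: ge0_le_integral => //.
    - exact: measurable_cube.
    - by apply: measurable_funTS; exact: measurableT_comp.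
    - by apply: measurable_funTS; exact: mS.
    move=> p /cubeP pa; rewrite gee0_abs ?lee_fin ?invr_ge0 ?sqr_ge0//.
    (* At the centre the inverse is 0 by convention and the bound is trivial. *)
    have [pa0|pa0] := eqVneq (vec3 p - a) 0.
      by rewrite pa0 enorm0 expr0n/= invr0; exact: nneseries_ge0.
    (* [m] is the sup norm: [m <= 2^-n] puts the point in the n-th cube, and 2^-(n+1) < m <= r gives
       1/r^2 <= 4^(n+1). *)
    pose m := \big[Num.max/0]_i `|(vec3 p - a) 0 i|.
    have [n /andP[nm mn]] : exists n, 2^-1 ^+ n.+1 < m <= 2^-1 ^+ n.
      apply: geometric_scale; apply/andP; split; last by apply: bigmax_le.
      rewrite lt_neqAle; apply/andP; split; last exact: bigmax_ge_id.
      apply: contra_neq pa0 => m0; apply/rowP => i; rewrite [RHS]mxE.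
      by apply/eqP; rewrite -normr_le0 m0 (le_bigmax _ (fun i => `|(vec3 p - a) 0 i|) i).
    have fnp : (((enorm (vec3 p - a))^-2)%:E <= f n p)%E.
      rewrite lee_fin indicE mem_set; last first.
        apply/cubeP => i; apply: le_trans mn.
        exact: (le_bigmax _ (fun i => `|(vec3 p - a) 0 i|) i).
      rewrite mulr1 -[leRHS]invrK lef_pV2 ?posrE ?exprn_gt0 ?invr_gt0 ?exprn_gt0 ?enorm_gt0//.
      rewrite -exprVn (_ : 4^-1 = 2^-1 ^+ 2); last by rewrite exprVn -natrX.
      rewrite exprAC lerXn2r ?nnegrE ?exprn_ge0 ?enorm_ge0 ?invr_ge0//.
      apply: (le_trans (ltW nm)); apply: bigmax_le => [|i _]; first exact: enorm_ge0.
      exact: ler_coord_enorm.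
    apply: le_trans fnp _; rewrite (@nneseriesD1 _ (f^~ p) n xpredT)//.
    by rewrite leeDl// nneseries_ge0.
  apply: ge0_subset_integral => //; first exact: measurable_cube.
  by move=> p _; exact: nneseries_ge0.
rewrite integral_nneseries//.
(* 4^(n+1) times the volume (2 * 2^-n)^3 is 32 * 2^-n; these sum to 64. *)
have fi n : (\int[@lebesgue3 R]_p f n p = (32 * 2^-1 ^+ n)%R%:E)%E.
  rewrite /f; under eq_integral do rewrite EFinM.
  have mI : measurable_fun setT (fun p : R3 R => (\1_(cube a (2^-1 ^+ n)) p)%:E : \bar R).
    by apply/measurable_EFinP; apply: measurable_indic; exact: measurable_cube.
  rewrite ge0_integralZl// ?lee_fin ?exprn_ge0//.
  rewrite integral_indic ?setIT//; last exact: measurable_cube.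
  rewrite [X in (_ * X)%E](lebesgue3_cube a (_ : 0 <= 2^-1 ^+ n)) ?exprn_ge0 ?invr_ge0//.
  rewrite -EFinM; congr _%:E; rewrite exprS.
  have h : (4 : R) ^+ n * (2^-1 ^+ n) ^+ 3 = 2^-1 ^+ n.
    by rewrite -exprM mulnC exprM -exprMn; congr (_ ^+ n); field.
  rewrite -[in RHS]h; move: (4 ^+ n) (2^-1 ^+ n) => x y; ring.
apply: (@le_lt_trans _ _ (64%:E)); last exact: ltry.
apply: lime_le; first by apply: is_cvg_nneseries => n _ _; exact: integral_ge0.
apply: nearW => n /=; under eq_bigr do rewrite fi.
rewrite sumEFin lee_fin.
suff -> : \sum_(0 <= i < n) (32 * 2^-1 ^+ i) = 64 * (1 - 2^-1 ^+ n) :> R.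
  have : (0 : R) <= 2^-1 ^+ n by rewrite exprn_ge0// invr_ge0.
  lra.
elim: n => [|n ih]; first by rewrite big_geq// expr0; ring.
by rewrite big_nat_recr//= ih exprS; field.
Qed.

End Integrability.

(** * Measurability of functions continuous off finitely many points *)

Section Measurability.
Context {R : realType}.
Notation mu := (@lebesgue_measure R).

(** [F] is arbitrary: every preimage is a countable union of fibres of [g]. *)
Lemma countable_range_measurable d (T : measurableType d) U (g : T -> U)
    (C : set U) (F : U -> R) :
  countable C -> (forall x, C (g x)) ->
  (forall u, measurable (g @^-1` [set u])) -> measurable_fun setT (F \o g).
Proof.
move=> /countable_injP[f finj] Cg mg _ Y mY; rewrite setTI.
rewrite (_ : _ @^-1` Y = \bigcup_n [set x | f (g x) = n /\ Y (F (g x))]); last first.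
  by apply/seteqP; split=> [x Yx|x [n _ [_ ?]]//]; exists (f (g x)).
apply: bigcupT_measurable => n.
have [[x0 [fx0 Yx0]]|nex] := pselect (exists x, f (g x) = n /\ Y (F (g x))); last first.
  rewrite (_ : [set x | _] = set0)//; apply/seteqP; split=> x // h.
  by apply: nex; exists x.
rewrite (_ : [set x | _] = g @^-1` [set g x0])//.
apply/seteqP; split=> x /=; last by move->.
by move=> [fx _]; apply: finj; rewrite ?inE// fx.
Qed.

Definition rnd (n : nat) (s : R) : R := (Num.floor (s * n.+1%:R))%:~R / n.+1%:R.

Lemma rnd_dist n s : `|rnd n s - s| <= n.+1%:R^-1.
Proof.
have n0 : (0 : R) < n.+1%:R by rewrite ltr0n.
have e : s = s * n.+1%:R / n.+1%:R by rewrite mulfK// gt_eqF.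
rewrite {2}e /rnd -mulrBl normrM [X in _ * X]gtr0_norm ?invr_gt0//.
apply: ler_piMl; first by rewrite invr_ge0 ltW.
have := floor_le (s * n.+1%:R); have := floorD1_gt (s * n.+1%:R).
by rewrite intrD ler_distl; lra.
Qed.

Lemma measurable_rnd n : measurable_fun setT (rnd n).
Proof.
apply: nondecreasing_measurable => // x y xy.
rewrite /rnd ler_pM2r ?invr_gt0 ?ltr0n// ler_int le_floor// ler_pM2r ?ltr0n//.
Qed.

Definition rnd3 n (p : R3 R) : R3 R := (rnd n p.1.1, rnd n p.1.2, rnd n p.2).

Lemma measurable_rnd3_comp n (F : R3 R -> R) : measurable_fun setT (F \o rnd3 n).
Proof.
pose C := range (rnd n).
have cC : countable C.
  apply: (@sub_countable _ _ _ (range (fun k : int => k%:~R / n.+1%:R))).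
    by apply: subset_card_le => _ [s _ <-]; exists (Num.floor (s * n.+1%:R)).
  by apply: (@sub_countable _ _ _ [set: int]); [exact: card_image_le|exact: countableP].
apply: (@countable_range_measurable _ _ _ _ ((C `*` C) `*` C)).
- by apply: countableX => //; exact: countableX.
- by move=> [[a b] c]; split; [split; [exists a|exists b]|exists c].
move=> [[a b] c].
have m (g : R3 R -> R) r : measurable_fun setT g -> measurable ((rnd n \o g) @^-1` [set r]).
  move=> mg; rewrite -[X in measurable X]setTI.
  by apply: (measurableT_comp (measurable_rnd n) mg).
rewrite (_ : _ @^-1` _ = ((rnd n \o (fun p : R3 R => p.1.1)) @^-1` [set a]
    `&` (rnd n \o (fun p : R3 R => p.1.2)) @^-1` [set b])
    `&` (rnd n \o snd) @^-1` [set c]).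
  apply: measurableI; [apply: measurableI|]; apply: m.
  - by apply: (measurableT_comp measurable_fst); exact: measurable_fst.
  - by apply: (measurableT_comp measurable_snd); exact: measurable_fst.
  - exact: measurable_snd.
apply/seteqP; split=> [p [<- <- <-]//|p [[/= pa pb] pc]].
by rewrite /rnd3 pa pb pc.
Qed.

Lemma rnd3_dist n (p : R3 R) : enorm (vec3 p - vec3 (rnd3 n p)) <= 3 * n.+1%:R^-1.
Proof.
apply: (le_trans (ler_enorm_norm _)); rewrite ler_pM2l//.
rewrite [leLHS]/Num.Def.normr/= mx_normrE; apply: bigmax_le => [|[i j] _ /=].
  by rewrite invr_ge0 ler0n.
by rewrite ord1; move: j; apply: ord3P; rewrite !mxE/= distrC rnd_dist.
Qed.

(** [Y] is arbitrary: the set is finite and points are measurable. This absorbs whatever values a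
    function takes at its singular points. *)
Lemma measurable_vec3_in (A : seq 'rV[R]_3) (Y : set (R3 R)) :
  measurable [set p | vec3 p \in A /\ Y p].
Proof.
have vec3_inj : injective (@vec3 R).
  move=> [[a b] c] [[a' b'] c'] /rowP e.
  by have := (e i0, e i1, e i2); rewrite !mxE/= => -[[-> ->] ->].
elim: A => [|a A ih]; first by rewrite (_ : mkset _ = set0)//; apply/seteqP; split=> p [].
rewrite (_ : mkset _ = [set p | vec3 p = a /\ Y p] `|` [set p | vec3 p \in A /\ Y p]); last first.
  apply/seteqP; split=> p /=; rewrite inE.
    by move=> [/orP[/eqP|] ? ?]; [left|right].
  by move=> [[->]|[->]] ?; rewrite ?eqxx ?orbT.
apply: measurableU => //.
have [[q [qa Yq]]|nex] := pselect (exists p, vec3 p = a /\ Y p); last first.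
  rewrite (_ : [set x | _] = set0)//; apply/seteqP; split=> x // h.
  by apply: nex; exists x.
rewrite (_ : mkset _ = [set q]).
  rewrite (_ : [set q] = ([set q.1.1] `*` [set q.1.2]) `*` [set q.2]).
    by apply: measurableX => //; exact: measurableX.
  by apply/seteqP; split=> [_ ->//|[[? ?] ?] [[/= -> ->] ->]]; case: q {qa Yq} => -[].
apply/seteqP; split=> p /=; last by move=> ->.
by move=> [pa _]; apply: vec3_inj; rewrite pa.
Qed.

(** The measurable structure is the product one, so [f] is approximated: composed with the rounding
    to a grid it factors through a countable set, and the composites converge to [f] wherever [f] is
    continuous. *)
Lemma measurable_vec3 (A : seq 'rV[R]_3) (f : 'rV[R]_3 -> R) :
  (forall x, x \notin A -> {for x, continuous f}) ->
  measurable_fun setT (fun p : R3 R => f (vec3 p)).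
Proof.
move=> cf.
pose D : set (R3 R) := ~` [set p | vec3 p \in A].
have mD : measurable D.
  apply: measurableC; rewrite (_ : mkset _ = [set p | vec3 p \in A /\ setT p]).
    exact: measurable_vec3_in.
  by apply/seteqP; split=> p //= [].
have mfD : measurable_fun D (fun p => f (vec3 p)).
  apply: (@measurable_fun_cvg _ _ _ _ (fun n p => f (vec3 (rnd3 n p)))).
    move=> n; apply: measurable_funTS.
    exact: (@measurable_rnd3_comp n (fun p => f (vec3 p))).
  move=> p /negP pA; have /cvgrPdist_lt cfp := cf _ pA.
  apply/cvgrPdist_lt => e e0.
  have /nbhs_enormP[d d0 hd] := cfp _ e0.
  near=> n; apply: hd; apply: le_lt_trans (rnd3_dist _ _) _.
  rewrite -ltr_pdivlMl//; near: n.
  have d3 : 0 < 3^-1 * d by rewrite mulr_gt0// invr_gt0.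
  exact: (near_infty_natSinv_lt (PosNum d3)).
move=> _ Y mY; rewrite setTI.
rewrite (_ : _ @^-1` Y = (D `&` (fun p => f (vec3 p)) @^-1` Y) `|`
   [set p | vec3 p \in A /\ Y (f (vec3 p))]).
  by apply: measurableU; [exact: mfD|exact: measurable_vec3_in].
apply/seteqP; split=> [p Yp|p [[]//|[]//]].
by have [pA|pA] := boolP (vec3 p \in A); [right|left; split => //; exact/negP].
Unshelve. all: by end_near. Qed.

End Measurability.

(** * Functions with square integrable singularities *)

Section Weight.
Context {R : realType}.
Notation mu := (@lebesgue_measure R).

(** Since 0^-1 = 0, the weight is finite at the points of [A] and does not see the singularity
    there; estimates are therefore stated off [A]. *)
Definition wt (A : seq 'rV[R]_3) (x : 'rV[R]_3) : R :=
  1 + \sum_(a <- A) (enorm (x - a))^-1.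

Lemma wt_ge1 A x : 1 <= wt A x.
Proof. by rewrite lerDl sumr_ge0// => a _; rewrite invr_ge0 enorm_ge0. Qed.

Lemma wt_gt0 A x : 0 < wt A x.
Proof. exact: lt_le_trans ltr01 (wt_ge1 A x). Qed.

Lemma wt_cons a A x : wt (a :: A) x = wt A x + (enorm (x - a))^-1.
Proof. by rewrite /wt big_cons; ring. Qed.

Lemma measurable_wt A : measurable_fun setT (fun p : R3 R => wt A (vec3 p)).
Proof.
elim: A => [|a A ih].
  by rewrite /wt; under eq_fun do rewrite big_nil addr0; exact: measurable_cst.
under eq_fun do rewrite wt_cons.
apply: measurable_funD => //; apply: measurable_funV => [p|]; first exact: enorm_ge0.
exact: measurable_enorm_vec3.
Qed.

Lemma measurable_expRN_enorm (c : R) :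
  measurable_fun setT (fun p : R3 R => expR (- c * enorm (vec3 p))).
Proof.
apply: measurableT_comp => //; apply: measurable_funM => //.
by have := measurable_enorm_vec3 (0 : 'rV[R]_3); under eq_fun do rewrite subr0.
Qed.

(** In the unit cube about [a] the exponential is at most 1 and 1/r^2 is integrable; outside it r >
    1, and the exponential alone dominates. *)
Lemma integrable_invsqr_expRN (a : 'rV[R]_3) (c : R) : 0 < c ->
  (@lebesgue3 R).-integrable setT
    (fun p => ((enorm (vec3 p - a))^-2 * expR (- c * enorm (vec3 p)))%:E).
Proof.
move=> c0; have ie := integrable_expRN_enorm c0.
have ia := (integrable_mkcond _ (measurable_cube a 1)).1 (integrable_invsqr_enorm a).
apply: le_integrable (integrableD measurableT ia ie) => //.
  apply/measurable_EFinP; apply: measurable_funM; last exact: measurable_expRN_enorm.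
  apply: measurable_funV => [p|]; first exact: sqr_ge0.
  by apply: measurable_funX; exact: measurable_enorm_vec3.
move=> p _; set b := (enorm (vec3 p - a)) ^- 2; set e := expR _.
have b0 : 0 <= b by rewrite invr_ge0 sqr_ge0.
have e0 : 0 <= e by exact: expR_ge0.
have e1 : e <= 1.
  by rewrite -expR0 ler_expR mulNr oppr_le0 mulr_ge0 ?enorm_ge0// ltW.
rewrite /= patchE -/e; case: ifPn => [_|pc].
  by rewrite -EFinD lee_fin !ger0_norm ?mulr_ge0 ?addr_ge0// -/b; nra.
have {}pc : 1 < enorm (vec3 p - a).
  rewrite ltNge; apply: contra pc => pa; rewrite inE; apply/cubeP => i.
  exact: le_trans (ler_coord_enorm _ _) pa.
have b1 : b <= 1 by rewrite invf_le1 ?exprn_gt0 ?(lt_trans _ pc)// exprn_ege1// ltW.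
by rewrite add0e lee_fin !ger0_norm ?mulr_ge0//; nra.
Qed.

(** Induction on the list by (w + b)^2 <= 2 w^2 + 2 b^2, which removes the cross terms between
    distinct singular points. *)
Lemma integrable_wt_sqr A (c : R) : 0 < c ->
  (@lebesgue3 R).-integrable setT
    (fun p => (wt A (vec3 p) ^+ 2 * expR (- c * enorm (vec3 p)))%:E).
Proof.
move=> c0; elim: A => [|a A ih].
  apply: eq_integrable (integrable_expRN_enorm c0) => // p _.
  by rewrite /wt big_nil addr0 expr1n mul1r.
have := integrableD measurableT (integrableZl measurableT 2 ih)
  (integrableZl measurableT 2 (integrable_invsqr_expRN a c0)).
apply: le_integrable => //.
  apply/measurable_EFinP; apply: measurable_funM; last exact: measurable_expRN_enorm.
  by apply: measurable_funX; exact: measurable_wt.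
move=> p _; rewrite /=. rewrite lee_fin wt_cons -exprVn.
have := expR_ge0 (- c * enorm (vec3 p)); have := ltW (wt_gt0 A (vec3 p)).
have : 0 <= (enorm (vec3 p - a))^-1 by rewrite invr_ge0 enorm_ge0.
move: (wt _ _) (_^-1) (expR _) => w b e b0 w0 e0.
rewrite !ger0_norm ?addr_ge0 ?mulr_ge0 ?addr_ge0//.
rewrite !mulrA -mulrDl ler_wpM2r//; have := sqr_ge0 (w - b); nra.
Qed.

Lemma Lfun2P (f : R3 R -> R) : measurable_fun setT f ->
  (@lebesgue3 R).-integrable setT (fun p => (f p ^+ 2)%:E) -> f \in Lfun (@lebesgue3 R) 2%:E.
Proof.
move=> mf /integrableP[_ fi]; apply/andP; split; rewrite inE//=.
rewrite /finite_norm unlock poweR_lty//.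
apply: le_lt_trans fi; rewrite le_eqVlt; apply/orP; left; apply/eqP.
apply: eq_integral => p _; rewrite /= (ger0_norm (sqr_ge0 _)).
by rewrite powR_mulrn// real_normK// num_real.
Qed.

Lemma Lfun2_le_wt A (c C : R) (f : R3 R -> R) : 0 < c -> measurable_fun setT f ->
  {ae @lebesgue3 R, forall p, `|f p| <= C * (wt A (vec3 p) * expR (- c * enorm (vec3 p)))} ->
  f \in Lfun (@lebesgue3 R) 2%:E.
Proof.
move=> c0 mf fle; apply: Lfun2P => //.
have mf2 : measurable_fun setT (fun p => (f p ^+ 2)%:E).
  by apply/measurable_EFinP; exact: measurable_funX.
have c20 : 0 < 2 * c by rewrite mulr_gt0.
have := integrableZl measurableT (C ^+ 2) (integrable_wt_sqr A c20).
move=> /integrableP[mg gi]; apply/integrableP; split => //.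
apply: le_lt_trans gi; apply: ae_ge0_le_integral => //.
- exact: measurableT_comp.
- exact: measurableT_comp.
apply: filterS fle => p fp _.
rewrite /= lee_fin (ger0_norm (sqr_ge0 _)).
have e2 : expR (- (2 * c) * enorm (vec3 p)) = expR (- c * enorm (vec3 p)) ^+ 2.
  by rewrite -expRM_natl; congr expR; ring.
rewrite e2 -!exprMn (ger0_norm (sqr_ge0 _)) -(real_normK (num_real (f p))).
by rewrite ler_sqr ?nnegrE// (le_trans _ fp).
Qed.

(** Fubini: a line parallel to the third axis meets the sphere in at most two points. Radius 0 gives
    the negligibility of points. *)
Lemma negligible_sphere (a : 'rV[R]_3) (r : R) :
  (@lebesgue3 R).-negligible [set p | enorm (vec3 p - a) = r].
Proof.
have mS : measurable [set p : R3 R | enorm (vec3 p - a) = r].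
  have := measurable_enorm_vec3 a measurableT (measurable_set1 r).
  by rewrite setTI.
apply/negligibleP => //; rewrite [LHS]integral0_eq// => -[u v] _ /=.
apply: countable_lebesgue_measure0; apply: finite_set_countable.
pose k := r ^+ 2 - (u - a 0 i0) ^+ 2 - (v - a 0 i1) ^+ 2.
apply: (@sub_finite_set _ _ [set a 0 i2 + Num.sqrt k; a 0 i2 - Num.sqrt k]); last first.
  by apply: finite_set2.
move=> z; rewrite /xsection/= inE/= => zr.
have : (z - a 0 i2) ^+ 2 = k.
  have := sqr_enorm (vec3 (u, v, z) - a); rewrite [enorm _]zr dotE !mxE/= /k; lra.
move=> zk; have : `|z - a 0 i2| = Num.sqrt k by rewrite -zk sqrtr_sqr.
by case: (ler0P (z - a 0 i2)) => _ h; [right|left]; lra.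
Qed.

(** Serves for the sections, at a fixed time, of the light cones through countably many events. *)
Lemma negligible_spheres (S : set R) (X : R -> 'rV[R]_3) (r : R -> R) : countable S ->
  (@lebesgue3 R).-negligible [set p | exists2 u, S u & enorm (vec3 p - X u) = r u].
Proof.
move=> /countable_injP[f finj].
apply: (@negligibleS _ _ _ _ (\bigcup_n [set p : R3 R | exists u,
    [/\ S u, f u = n & enorm (vec3 p - X u) = r u]])).
  by move=> p [u Su pu]; exists (f u) => //; exists u.
apply: negligible_bigcup => n.
have [[u [Su fu]]|nex] := pselect (exists u, S u /\ f u = n); last first.
  by apply: negligibleS (negligible_set0 _) => p [u [Su fu _]]; apply: nex; exists u.
apply: negligibleS (negligible_sphere (X u) (r u)) => p [u' [Su' fu' pu']] /=.
by have -> : u = u' by apply: finj; rewrite ?inE// fu.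
Qed.

End Weight.

Section WeakDerivative.
Context {R : realType}.
Notation mu := (@lebesgue3 R).
Implicit Types (A : seq 'rV[R]_3) (f g eta : 'rV[R]_3 -> R) (x y v : 'rV[R]_3).

Definition axis (i : 'I_3) : 'rV[R]_3 := delta_mx 0 i.

(* The weight is evaluated at the first point only, so that difference
   quotients are dominated independently of the increment. *)
Definition klip A f := exists2 C, 0 <= C &
  forall x y, x \notin A -> `|f x - f y| <= C * wt A x * enorm (x - y).

Definition bdd f := exists M, forall x, `|f x| <= M.

Lemma klip_continuous A f x : klip A f -> x \notin A -> {for x, continuous f}.
Proof.
move=> [C C0 fC] xA; apply: (iffRL (@cvgrPdist_lt _ _ _ (nbhs x) _ _ _)) => e e0.
have K0 : 0 < C * wt A x + 1.
  by rewrite ltr_wpDl// mulr_ge0// ltW// wt_gt0.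
apply/nbhs_enormP; exists (e / (C * wt A x + 1)); first by rewrite divr_gt0.
move=> v; rewrite ltr_pdivlMr// => xv; apply: le_lt_trans (fC _ _ xA) _.
by have := enorm_ge0 (x - v); nra.
Qed.

Lemma klip_measurable A f : klip A f -> measurable_fun setT (fun p : R3 R => f (vec3 p)).
Proof. by move=> fA; apply: (@measurable_vec3 _ A) => x; exact: klip_continuous. Qed.

Lemma line_quotientE f x v t : (fun h : R => h^-1 *: (f (h *: v + (t *: v + x)) - f (t *: v + x)))
  = (fun h : R => h^-1 *: (f ((h *: 1 + t) *: v + x) - f (t *: v + x))).
Proof. by apply/funext => h; rewrite [h *: 1]mulr1 scalerDl addrA. Qed.

(** Reduces directional derivatives to one real variable, where the mean value theorem, the chain
    rule and Caratheodory's criterion are available. *)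
Lemma is_derive_lineP f x v t d :
  is_derive (t *: v + x) v f d <-> is_derive t 1 (fun s : R => f (s *: v + x)) d.
Proof.
have e := line_quotientE f x v t.
split=> -[h1 h2]; split; first by rewrite /derivable -e.
- by rewrite /derive -e.
- by rewrite /derivable e.
- by rewrite /derive e.
Qed.

(** Off its closed support [eta] vanishes in a whole neighbourhood, hence so do its derivatives. *)
Lemma test_function_partial eta i : test_function eta -> test_function (partial i eta).
Proof.
move=> [se ce]; split=> [s|].
  by have := se (rcons s i); rewrite foldr_rcons.
apply: (subclosed_compact _ ce); first exact: closed_closure.
have /closure_id -> := @closed_closure _ [set x | eta x != 0].
apply: closure_subset => x /= px; apply: contrapT => xK; apply/negP: px; rewrite negbK.
have eta0 : \near x, eta x = cst 0 x.
  have : nbhs x (~` closure [set y | eta y != 0]).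
    apply: open_nbhs_nbhs; split => //; apply: closed_openC; exact: closed_closure.
  apply: filterS => y yK; apply/eqP; apply: contra_notT yK => etay.
  exact: subset_closure.
by rewrite /partial (near_eq_derive _ eta0) derive_val eqxx.
Qed.

(** The form in which compact support enters dominated convergence: unlike a support, an exponential
    bound is stable under bounded translations up to a factor. The constant is the maximum of |eta|
    exp(c r) over the support. *)
Lemma test_function_decay eta (c : R) : 0 <= c -> test_function eta ->
  exists2 C, 0 <= C & forall x, `|eta x| <= C * expR (- c * enorm x).
Proof.
move=> c0 [se ce].
pose phi x := `|eta x| * expR (c * enorm x).
have phic : continuous phi.
  move=> x; apply: (@cvgM _ _ (nbhs x) _ (fun x => `|eta x|) (fun x => expR (c * enorm x))).
    by apply: cvg_norm; exact: (se [::]).1.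
  apply: continuous_comp; last exact: continuous_expR.
  by apply: (@cvgMr _ _ (nbhs x)); exact: continuous_enorm.
have out x : ~ closure [set y | eta y != 0] x -> eta x = 0.
  move=> xK; apply/eqP; apply: contra_notT xK => etax.
  exact: subset_closure.
have [K0|/set0P K0] := eqVneq (closure [set y | eta y != 0]) set0.
  by exists 0 => // x; rewrite mul0r out ?normr0// K0.
have [a _ ha] := EVT_max_rV K0 ce (continuous_subspaceT phic).
exists (phi a); first by rewrite mulr_ge0// expR_ge0.
move=> x; rewrite mulNr expRN -ler_pdivrMr ?invr_gt0 ?expR_gt0// invrK.
have [xK|xK] := pselect (closure [set y | eta y != 0] x).
  by apply: ha; rewrite inE.
by rewrite out// normr0 mul0r mulr_ge0// expR_ge0.
Qed.

End WeakDerivative.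

(** * Weak derivatives *)

Section IntegrationByParts.
Context {R : realType}.
Notation mu := (@lebesgue3 R).
Implicit Types (A : seq 'rV[R]_3) (f g eta : 'rV[R]_3 -> R) (x y v : 'rV[R]_3).

Definition tuple3 v : R3 R := (v 0 i0, v 0 i1, v 0 i2).

Lemma vec3_shift3 v p : vec3 (shift3 (tuple3 v) p) = vec3 p + v.
Proof. by apply/rowP => i; rewrite !mxE; move: i; apply: ord3P. Qed.

Lemma measurable_translate f v : measurable_fun setT (fun p : R3 R => f (vec3 p)) ->
  measurable_fun setT (fun p : R3 R => f (vec3 p + v)).
Proof.
move=> mf; have := measurableT_comp mf (measurable_shift3 (tuple3 v)).
by congr (measurable_fun _ _); apply/funext => p; rewrite /= vec3_shift3.
Qed.

Lemma integrable_decay (u : R3 R -> R) (C : R) : measurable_fun setT u ->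
  (forall p, `|u p| <= C * expR (- 1 * enorm (vec3 p))) -> mu.-integrable setT (EFin \o u).
Proof.
move=> m_u uC.
have := integrableZl measurableT C (integrable_expRN_enorm (ltr01 : 0 < 1 :> R)).
apply: le_integrable => //; first exact/measurable_EFinP.
move=> p _; rewrite /= lee_fin; apply: le_trans (uC p) _; exact: ler_norm.
Qed.

Lemma dominated_convergence_Rintegral (f_ : nat -> R3 R -> R) (f G : R3 R -> R) :
  (forall n, measurable_fun setT (f_ n)) -> measurable_fun setT f ->
  mu.-integrable setT (EFin \o G) ->
  {ae mu, forall p, f_ n p @[n --> \oo] --> f p} ->
  {ae mu, forall p, forall n, `|f_ n p| <= G p} ->
  mu.-integrable setT (EFin \o f) /\
  (\int[mu]_p f_ n p @[n --> \oo] --> \int[mu]_p f p).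
Proof.
move=> mf_ mf iG cf fG.
have [||||fi _ c] := @dominated_convergence _ _ _ mu setT measurableT (fun n p => (f_ n p)%:E)
  (EFin \o f) (EFin \o G) _ _ _ iG.
- by move=> n; apply/measurable_EFinP.
- exact/measurable_EFinP.
- by apply: filterS cf => p cp _; apply/fine_cvgP; split; [exact: nearW|].
- by apply: filterS fG => p Gp n _; rewrite /= lee_fin.
by split => //; apply: fine_cvg; rewrite fineK//; exact: integrable_fin_num.
Qed.

Lemma test_continuous eta : test_function eta -> continuous eta.
Proof. by move=> [se _]; exact: (se [::]).1. Qed.

Lemma test_measurable eta : test_function eta ->
  measurable_fun setT (fun p : R3 R => eta (vec3 p)).
Proof.
by move=> te; apply: (@measurable_vec3 _ [::]) => x _; exact: test_continuous.
Qed.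

Lemma expRN_enorm_near x v : enorm (v - x) <= 1 ->
  expR (- 1 * enorm v) <= expR 1 * expR (- 1 * enorm x).
Proof.
move=> vx; rewrite -expRD ler_expR.
by have := ler_enorm_dist v x; rewrite ler_norml; lra.
Qed.

(** By the mean value theorem the quotient is a partial derivative at a point at distance at most 1,
    which costs the factor [expR 1]. *)
Lemma test_quotient_decay eta i : test_function eta ->
  exists2 C, 0 <= C & forall h x, 0 < h <= 1 ->
   `|h^-1 * (eta (x + h *: axis i) - eta x)| <= C * expR (- 1 * enorm x).
Proof.
move=> te; have [C C0 hC] := test_function_decay ler01 (test_function_partial i te).
exists (C * expR 1); first by rewrite mulr_ge0// expR_ge0.
move=> h x /andP[h0 h1].
have [|c|c] := @MVT _ (fun s : R => eta (s *: axis i + x)) (fun s => partial i eta (s *: axis i + x)) 0 h h0.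
- move=> s _; apply/is_derive_lineP; apply: DeriveDef => //.
  exact: (te.1 [::]).2.
- apply: continuous_subspaceT => s.
  apply: (@continuous_comp _ _ _ (fun s : R => s *: axis i + x) eta); last exact: test_continuous.
  by apply: cvgD; [exact: scalel_continuous|exact: cvg_cst].
rewrite in_itv/= => /andP[c0 ch].
rewrite scale0r add0r subr0 (addrC (h *: axis i)) => ->; rewrite mulrCA mulVf ?gt_eqF// mulr1.
apply: le_trans (hC _) _; rewrite -mulrA ler_wpM2l//; apply: expRN_enorm_near.
by rewrite addrK enormZ enorm_delta mulr1 gtr0_norm//; lra.
Qed.

(** Integration by parts for difference quotients: translating the integral moves the shift from
    [eta] to [f], with the opposite sign. *)
Lemma shift_difference_quotient A f eta i (h : R) : 0 < h <= 1 ->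
  klip A f -> bdd f -> test_function eta ->
  \int[mu]_p (f (vec3 p) * (h^-1 * (eta (vec3 p + h *: axis i) - eta (vec3 p)))) =
  \int[mu]_p (h^-1 * (f (vec3 p - h *: axis i) - f (vec3 p)) * eta (vec3 p)).
Proof.
move=> h01 fA [M fM] te; have /andP[h0 h1] := h01.
have [C C0 hC] := test_function_decay ler01 te.
have mf := klip_measurable fA; have mt := test_measurable te.
have M0 : 0 <= M := le_trans (normr_ge0 _) (fM 0).
have i1 : mu.-integrable setT (EFin \o (fun p : R3 R => f (vec3 p) * eta (vec3 p))).
  apply: (@integrable_decay _ (M * C)); first exact: measurable_funM.
  by move=> p; rewrite normrM -mulrA ler_pM.
have i2 : mu.-integrable setT (EFin \o (fun p : R3 R => f (vec3 p) * eta (vec3 p + h *: axis i))).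
  apply: (@integrable_decay _ (M * (C * expR 1))).
    by apply: measurable_funM => //; exact: measurable_translate.
  move=> p; rewrite normrM -!mulrA ler_pM//; apply: le_trans (hC _) _.
  rewrite ler_wpM2l//; apply: expRN_enorm_near.
  by rewrite addrC addKr enormZ enorm_delta mulr1 gtr0_norm.
have i3 : mu.-integrable setT (EFin \o (fun p : R3 R => f (vec3 p - h *: axis i) * eta (vec3 p))).
  apply: (@integrable_decay _ (M * C)).
    by apply: measurable_funM => //; exact: measurable_translate.
  by move=> p; rewrite normrM -mulrA ler_pM.
transitivity (h^-1 * (\int[mu]_p (f (vec3 p) * eta (vec3 p + h *: axis i)) -
    \int[mu]_p (f (vec3 p) * eta (vec3 p)))).
  rewrite -RintegralB// -RintegralZl//; last exact: (integrableB measurableT i2 i1).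
  by apply: eq_Rintegral => p _; ring.
have -> : \int[mu]_p (f (vec3 p) * eta (vec3 p + h *: axis i)) =
    \int[mu]_p (f (vec3 p - h *: axis i) * eta (vec3 p)).
  rewrite -(Rintegral_shift3 (tuple3 (h *: axis i)) i3).
  by apply: eq_Rintegral => p _; rewrite vec3_shift3 addrK.
rewrite -RintegralB// -RintegralZl//; last exact: (integrableB measurableT i3 i1).
by apply: eq_Rintegral => p _; ring.
Qed.

Lemma ae_notin A : {ae mu, forall p : R3 R, vec3 p \notin A}.
Proof.
elim: A => [|a A ih]; first exact: aeW.
have an : {ae mu, forall p : R3 R, vec3 p != a}.
  apply: negligibleS (negligible_sphere a 0) => p /negP; rewrite negbK => /eqP /= ->.
  by rewrite subrr enorm0.
by apply: filterS2 an ih => p pa pA; rewrite inE negb_or pa.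
Qed.

(** Limit of the discrete identity along h = 1/(n+1). On the left the quotients of [eta] decay
    exponentially; on the right those of [f] are bounded by the weight at the fixed point, uniformly
    in h. *)
Lemma weak_derivative A f g i eta : klip A f -> bdd f ->
  measurable_fun setT (fun p : R3 R => g (vec3 p)) ->
  {ae mu, forall p, is_derive (vec3 p) (axis i) f (g (vec3 p))} ->
  test_function eta ->
  \int[mu]_p (f (vec3 p) * partial i eta (vec3 p)) =
  - \int[mu]_p (g (vec3 p) * eta (vec3 p)).
Proof.
move=> fA [M fM] mg dfg te.
have [C C0 hC] := test_function_decay ler01 te.
have [C' C'0 hC'] := test_quotient_decay i te.
have [K K0 hK] := fA.
have mf := klip_measurable fA; have mt := test_measurable te.
have mdt := test_measurable (test_function_partial i te).
have M0 : 0 <= M := le_trans (normr_ge0 _) (fM 0).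
pose h (n : nat) : R := n.+1%:R^-1.
have h01 n : 0 < h n <= 1 by rewrite invr_gt0 ltr0n/= invf_le1// ler1n.
have h0 n : 0 < h n by have /andP[] := h01 n.
have hc0 : h n @[n --> \oo] --> (0 : R) by exact: cvg_harmonic.
have hdn : h n @[n --> \oo] --> 0^'.
  move=> B /= [d d0 Bd]; move/cvgrPdist_lt: hc0 => /(_ d d0).
  by apply: filterS => n hn; apply: Bd; rewrite ?gt_eqF.
have [_ lhs] : mu.-integrable setT (EFin \o (fun p : R3 R => f (vec3 p) * partial i eta (vec3 p))) /\
  (\int[mu]_p (f (vec3 p) * ((h n)^-1 * (eta (vec3 p + h n *: axis i) - eta (vec3 p))))
    @[n --> \oo] --> \int[mu]_p (f (vec3 p) * partial i eta (vec3 p))).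
  apply: (@dominated_convergence_Rintegral _ _ (fun p => M * C' * expR (- 1 * enorm (vec3 p)))).
  - move=> n; apply: measurable_funM => //; apply: measurable_funM => //.
    by apply: measurable_funB => //; exact: measurable_translate.
  - exact: measurable_funM.
  - exact: (integrableZl measurableT (M * C') (integrable_expRN_enorm (ltr01 : 0 < 1 :> R))).
  - apply/aeW => p; apply: cvgMr.
    have := (te.1 [::]).2 i (vec3 p) => /= dp.
    rewrite (_ : (fun n => _) = (fun r : R => r^-1 *: (eta (r *: axis i + vec3 p) - eta (vec3 p))) \o h).
      exact: (cvg_comp _ _ hdn dp).
    by apply/funext => n /=; rewrite (addrC (vec3 p)).
  - apply/aeW => p n; rewrite normrM -mulrA ler_pM//.
    exact: hC'.
have [gi rhs] : mu.-integrable setT (EFin \o (fun p : R3 R => - g (vec3 p) * eta (vec3 p))) /\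
  (\int[mu]_p ((h n)^-1 * (f (vec3 p - h n *: axis i) - f (vec3 p)) * eta (vec3 p))
    @[n --> \oo] --> \int[mu]_p (- g (vec3 p) * eta (vec3 p))).
  (* The quotients are bounded by [wt] times the decay; a further factor [wt >= 1] is inserted to
     reuse the integrability of its square. *)
  apply: (@dominated_convergence_Rintegral _ _ (fun p => K * C * (wt A (vec3 p) ^+ 2 * expR (- 1 * enorm (vec3 p))))).
  - move=> n; apply: measurable_funM => //; apply: measurable_funM => //.
    by apply: measurable_funB => //; exact: measurable_translate.
  - by apply: measurable_funM => //; exact: measurable_funN.
  - exact: (integrableZl measurableT (K * C) (integrable_wt_sqr A (ltr01 : 0 < 1 :> R))).
  - apply: negligibleS dfg => p; apply: contra_not => /= -[dp <-]; apply: cvgMl.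
    (* The quotient divides by h an increment along -h, hence the limit [- g]. *)
    rewrite (_ : (fun n => _) = -%R \o
        ((fun r : R => r^-1 *: (f (r *: axis i + vec3 p) - f (vec3 p))) \o (-%R \o h))).
      apply: cvgN; apply: (cvg_comp _ _ _ dp).
      move=> B /= [d d0 Bd]; move/cvgrPdist_lt: hc0 => /(_ d d0).
      apply: filterS => n; rewrite sub0r normrN => hn.
      by apply: Bd; rewrite /= ?oppr_eq0 ?gt_eqF// sub0r normrN normrN.
    apply/funext => n /=; rewrite scaleNr (addrC (vec3 p)) invrN scaleNr opprK.
    by [].
  - have hA := ae_notin A; apply: filterS hA => p pA n; rewrite normrM -mulrA.
    have := hK _ (vec3 p - h n *: axis i) pA.
    rewrite distrC subKr enormZ enorm_delta mulr1 => fle.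
    rewrite [leRHS](_ : _ = (K * wt A (vec3 p)) * (wt A (vec3 p) * (C * expR (- 1 * enorm (vec3 p))))); last by ring.
    apply: ler_pM => //.
      rewrite normrM gtr0_norm ?invr_gt0// ler_pdivrMl// mulrC.
      by rewrite -[X in _ * X](gtr0_norm (h0 n)).
    by apply: le_trans (hC _) _; rewrite ler_peMl ?wt_ge1// mulr_ge0 ?expR_ge0.
have -> : - (\int[mu]_p (g (vec3 p) * eta (vec3 p))) = \int[mu]_p (- g (vec3 p) * eta (vec3 p)).
  rewrite [X in - X](_ : _ = \int[mu]_p (-1 * (- g (vec3 p) * eta (vec3 p)))).
    by rewrite RintegralZl// mulN1r opprK.
  by apply: eq_Rintegral => p _; ring.
rewrite -(cvg_lim (@Rhausdorff R) lhs) -(cvg_lim (@Rhausdorff R) rhs).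
congr (limn _); apply/funext => n.
by rewrite (shift_difference_quotient _ (h01 n) fA _ te)//; exists M.
Qed.

End IntegrationByParts.

(** * Stability of the regularity class under algebra and composition *)

Section RegularFunctions.
Context {R : realType}.
Notation mu := (@lebesgue3 R).
Implicit Types (A : seq 'rV[R]_3) (f g u : 'rV[R]_3 -> R) (x y v : 'rV[R]_3).

Lemma ae_imp (P Q : R3 R -> Prop) : {ae mu, forall p, P p} ->
  (forall p, P p -> Q p) -> {ae mu, forall p, Q p}.
Proof. by move=> aeP PQ; apply: negligibleS aeP => p; exact: contra_not (PQ p). Qed.

Lemma ae_imp2 (P1 P2 Q : R3 R -> Prop) :
  {ae mu, forall p, P1 p} -> {ae mu, forall p, P2 p} ->
  (forall p, P1 p -> P2 p -> Q p) -> {ae mu, forall p, Q p}.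
Proof.
move=> ae1 ae2 PQ; apply: negligibleS (negligibleU ae1 ae2) => p /= nQ.
by have [p1|] := pselect (P1 p); [right => p2; exact/nQ/PQ|left].
Qed.

(** Derivatives along the axes suffice, as [weak_derivative] consumes nothing more. *)
Definition aediff f := {ae mu, forall p, forall i, derivable f (vec3 p) (axis i)}.

Definition lip f := exists2 L, 0 <= L & forall x y, `|f x - f y| <= L * enorm (x - y).

Definition reg A f := [/\ klip A f, bdd f & aediff f].

(* The first derivatives are everywhere defined functions with kinks, the second
   ones exist almost everywhere and are dominated by [wt A]. *)
Definition good A u := lip u /\ exists2 g : 'I_3 -> 'rV[R]_3 -> R, (forall i, reg A (g i)) &
  {ae mu, forall p, forall i, is_derive (vec3 p) (axis i) u (g i (vec3 p))}.

Lemma lip_klip A f : lip f -> klip A f.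
Proof.
move=> [L L0 fL]; exists L => // x y _; apply: (le_trans (fL x y)).
by rewrite -mulrA ler_wpM2l// ler_peMl ?enorm_ge0// wt_ge1.
Qed.

Lemma lip_cst (a : R) : lip (fun=> a).
Proof. by exists 0 => // x y; rewrite subrr normr0 mul0r. Qed.

Lemma lipD f g : lip f -> lip g -> lip (fun x => f x + g x).
Proof.
move=> [L L0 fL] [K K0 gK]; exists (L + K); first exact: addr_ge0.
move=> x y; rewrite mulrDl opprD addrACA; apply: le_trans (ler_normD _ _) _.
exact: lerD.
Qed.

Lemma lipM f g : bdd f -> bdd g -> lip f -> lip g -> lip (fun x => f x * g x).
Proof.
move=> [M fM] [N gN] [L L0 fL] [K K0 gK].
have M0 : 0 <= M := le_trans (normr_ge0 _) (fM 0).
have N0 : 0 <= N := le_trans (normr_ge0 _) (gN 0).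
exists (M * K + N * L); first by rewrite addr_ge0// mulr_ge0.
move=> x y; have -> : f x * g x - f y * g y = f x * (g x - g y) + g y * (f x - f y) by ring.
apply: le_trans (ler_normD _ _) _; rewrite !normrM mulrDl -!mulrA.
by apply: lerD; apply: ler_pM.
Qed.

Lemma bddD f g : bdd f -> bdd g -> bdd (fun x => f x + g x).
Proof.
move=> [M fM] [N gN]; exists (M + N) => x.
by apply: le_trans (ler_normD _ _) _; exact: lerD.
Qed.

Lemma bddM f g : bdd f -> bdd g -> bdd (fun x => f x * g x).
Proof. by move=> [M fM] [N gN]; exists (M * N) => x; rewrite normrM ler_pM. Qed.

Lemma bdd_cst (a : R) : bdd (fun=> a).
Proof. by exists `|a|. Qed.

Lemma klipD A f g : klip A f -> klip A g -> klip A (fun x => f x + g x).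
Proof.
move=> [L L0 fL] [K K0 gK]; exists (L + K); first exact: addr_ge0.
move=> x y xA; rewrite !mulrDl opprD addrACA; apply: le_trans (ler_normD _ _) _.
by apply: lerD; [exact: fL|exact: gK].
Qed.

Lemma klipM A f g : bdd f -> bdd g -> klip A f -> klip A g -> klip A (fun x => f x * g x).
Proof.
move=> [M fM] [N gN] [L L0 fL] [K K0 gK].
have M0 : 0 <= M := le_trans (normr_ge0 _) (fM 0).
have N0 : 0 <= N := le_trans (normr_ge0 _) (gN 0).
exists (M * K + N * L); first by rewrite addr_ge0// mulr_ge0.
(* This splitting leaves both differences with their weight at x and evaluates only a bounded factor
   at y. *)
move=> x y xA; have -> : f x * g x - f y * g y = f x * (g x - g y) + g y * (f x - f y) by ring.
apply: le_trans (ler_normD _ _) _; rewrite !normrM !mulrDl -!(mulrA M) -!(mulrA N).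
by apply: lerD; apply: ler_pM => //; [exact: gK|exact: fL].
Qed.

(** [u] is derivable along [v] only; restriction to the line makes this the one-variable chain
    rule. *)
Lemma is_derive_comp (h : R -> R) u x v (a b : R) :
  is_derive (u x) 1 h a -> is_derive x v u b ->
  is_derive x v (fun y => h (u y)) (a * b).
Proof.
move=> dh du.
have e : 0 *: v + x = x by rewrite scale0r add0r.
suff : is_derive (0 *: v + x) v (fun y => h (u y)) (a * b) by rewrite e.
apply/is_derive_lineP.
have du' : is_derive (0 : R) 1 (fun s : R => u (s *: v + x)) b.
  by apply/is_derive_lineP; rewrite e.
apply: (@is_derive1_comp _ h (fun s : R => u (s *: v + x))) => //.
by rewrite e.
Qed.

Lemma is_deriveD2 f g x v (a b : R) : is_derive x v f a -> is_derive x v g b ->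
  is_derive x v (fun y => f y + g y) (a + b).
Proof. by move=> df dg; exact: is_deriveD. Qed.

Lemma is_deriveM2 f g x v (a b : R) : is_derive x v f a -> is_derive x v g b ->
  is_derive x v (fun y => f y * g y) (f x * b + g x * a).
Proof. by move=> df dg; exact: is_deriveM. Qed.

Lemma aediffD f g : aediff f -> aediff g -> aediff (fun x => f x + g x).
Proof.
by move=> df dg; apply: (ae_imp2 df dg) => p dp dq i; exact: derivableD.
Qed.

Lemma aediffM f g : aediff f -> aediff g -> aediff (fun x => f x * g x).
Proof.
by move=> df dg; apply: (ae_imp2 df dg) => p dp dq i; exact: derivableM.
Qed.

Lemma aediff_cst (a : R) : aediff (fun=> a).
Proof. by apply: aeW => p i; exact: derivable_cst. Qed.

Lemma good_aediff A u : good A u -> aediff u.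
Proof. by move=> [_ [g _ du]]; apply: (ae_imp du) => p dp i; case: (dp i). Qed.

Lemma good_reg A u : good A u -> bdd u -> reg A u.
Proof.
move=> gu bu; split => //; last exact: good_aediff gu.
by apply: lip_klip; case: gu.
Qed.

Lemma reg_cst A (a : R) : reg A (fun=> a).
Proof. by split; [apply/lip_klip/lip_cst|exact: bdd_cst|exact: aediff_cst]. Qed.

Lemma regD A f g : reg A f -> reg A g -> reg A (fun x => f x + g x).
Proof. by move=> [? ? ?] [? ? ?]; split; [exact: klipD|exact: bddD|exact: aediffD]. Qed.

Lemma regM A f g : reg A f -> reg A g -> reg A (fun x => f x * g x).
Proof. by move=> [? ? ?] [? ? ?]; split; [exact: klipM|exact: bddM|exact: aediffM]. Qed.

Lemma good_cst A (a : R) : good A (fun=> a).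
Proof.
split; first exact: lip_cst.
exists (fun _ _ => 0) => [i|]; first exact: reg_cst.
by apply: aeW => p i; exact: is_derive_cst.
Qed.

Lemma goodD A f g : good A f -> good A g -> good A (fun x => f x + g x).
Proof.
move=> [lf [df rf ff]] [lg [dg rg gg]]; split; first exact: lipD.
exists (fun i x => df i x + dg i x) => [i|]; first exact: regD.
by apply: (ae_imp2 ff gg) => p fp gp i; exact: is_deriveD2.
Qed.

(** The factors reappear undifferentiated in the product rule, so they must be bounded and thereby
    belong to [reg] themselves. *)
Lemma goodM A f g : bdd f -> bdd g -> good A f -> good A g -> good A (fun x => f x * g x).
Proof.
move=> bf bg gf gg.
have rf := good_reg gf bf; have rg := good_reg gg bg.
case: gf gg => [lf [df rdf ff]] [lg [dg rdg ggd]].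
split; first exact: lipM.
exists (fun i x => f x * dg i x + g x * df i x) => [i|].
  exact: (regD (regM rf (rdg i)) (regM rg (rdf i))).
by apply: (ae_imp2 ff ggd) => p fp gp i; exact: is_deriveM2.
Qed.

Definition convex_set (D : set R) := forall a b c, D a -> D b -> a <= c <= b -> D c.

Lemma lipschitz_derive (D : set R) (h h' : R -> R) (C a b : R) : convex_set D ->
  (forall c : R, is_derive c 1 h (h' c)) -> (forall c, D c -> `|h' c| <= C) ->
  D a -> D b -> `|h a - h b| <= C * `|a - b|.
Proof.
move=> cD dh hC; wlog ab : a b / a <= b => [wl Da Db|Da Db].
  have [ab|/ltW ba] := leP a b; first exact: wl.
  by rewrite distrC (distrC a) wl.
have [|c] := MVT_segment ab (fun z _ => dh z).
  apply: continuous_subspaceT => c.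
  by apply: differentiable_continuous; apply/derivable1_diffP; case: (dh c).
rewrite in_itv/= distrC => cab ->; rewrite normrM (distrC a) ler_wpM2r//.
by apply: hC; exact: cD cab.
Qed.

(** The derivatives of [h] are bounded on a convex set containing the values of [u], which admits
    exp on a bounded range and exp(-q t) on t >= 0. *)
Lemma good_comp A u (D : set R) (h h' h'' : R -> R) (C : R) :
  convex_set D -> (forall x, D (u x)) ->
  (forall c : R, is_derive c 1 h (h' c)) -> (forall c : R, is_derive c 1 h' (h'' c)) ->
  (forall c, D c -> `|h' c| <= C) -> (forall c, D c -> `|h'' c| <= C) ->
  good A u -> good A (fun x => h (u x)).
Proof.
move=> cD Du dh dh' h'C h''C [[L L0 uL] [du rdu uu]].
have C0 : 0 <= C := le_trans (normr_ge0 _) (h'C _ (Du 0)).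
have lipc (k k' : R -> R) : (forall c : R, is_derive c 1 k (k' c)) ->
    (forall c, D c -> `|k' c| <= C) -> lip (fun x => k (u x)).
  move=> dk kC; exists (C * L); first exact: mulr_ge0.
  move=> x y; apply: le_trans (lipschitz_derive cD dk kC (Du x) (Du y)) _.
  by rewrite -mulrA ler_wpM2l.
split; first exact: lipc dh h'C.
exists (fun i x => h' (u x) * du i x) => [i|]; last first.
  by apply: (ae_imp uu) => p up i; exact: is_derive_comp.
apply: (regM _ (rdu i)); split.
- by apply: lip_klip; exact: lipc dh' h''C.
- by exists C => x; exact: h'C.
- by apply: (ae_imp uu) => p up j; have [] := is_derive_comp (dh' (u (vec3 p))) (up j).
Qed.

End RegularFunctions.

(** * Weak derivatives up to order two and square integrability *)

Section SobolevMembership.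
Context {R : realType}.
Notation mu := (@lebesgue3 R).
Implicit Types (A : seq 'rV[R]_3) (f g u eta : 'rV[R]_3 -> R) (x y v : 'rV[R]_3).

Lemma harmonic_dnbhs : (n.+1%:R^-1 : R) @[n --> \oo] --> 0^'.
Proof.
have hc0 : (n.+1%:R^-1 : R) @[n --> \oo] --> (0 : R) by exact: cvg_harmonic.
move=> B /= [d d0 Bd]; move/cvgrPdist_lt: hc0 => /(_ d d0).
by apply: filterS => n hn; apply: Bd; rewrite ?gt_eqF// invr_gt0.
Qed.

Lemma quotient_cvg f x i d : is_derive x (axis i) f d ->
  (n.+1%:R * (f (x + n.+1%:R^-1 *: axis i) - f x)) @[n --> \oo] --> d.
Proof.
move=> [df <-].
rewrite (_ : (fun n => _) = (fun r : R => r^-1 *: (f (r *: axis i + x) - f x))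
   \o (fun n => n.+1%:R^-1)); first exact: (cvg_comp _ _ harmonic_dnbhs df).
by apply/funext => n /=; rewrite invrK (addrC x).
Qed.

Lemma klip_quotient A f (C : R) x (n : nat) i : 0 <= C ->
  (forall x y, x \notin A -> `|f x - f y| <= C * wt A x * enorm (x - y)) ->
  x \notin A -> `|n.+1%:R * (f (x + n.+1%:R^-1 *: axis i) - f x)| <= C * wt A x.
Proof.
move=> C0 fC xA; have n0 : (0 : R) < n.+1%:R by rewrite ltr0n.
rewrite normrM gtr0_norm// -ler_pdivlMl// distrC; apply: (le_trans (fC _ _ xA)).
by rewrite opprD addrA subrr add0r enormN enormZ enorm_delta mulr1 gtr0_norm ?invr_gt0// mulrC.
Qed.

Lemma klip_derive_le A f (C : R) x i d : 0 <= C ->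
  (forall x y, x \notin A -> `|f x - f y| <= C * wt A x * enorm (x - y)) ->
  x \notin A -> is_derive x (axis i) f d -> `|d| <= C * wt A x.
Proof.
move=> C0 fC xA /quotient_cvg /cvg_norm h.
have <- := cvg_lim (@Rhausdorff R) h.
apply: limr_le; first by apply/cvg_ex; eexists; exact: h.
by apply: nearW => n; exact: klip_quotient.
Qed.

(** The representative is the limsup of the difference quotients along 1/(n+1): it is measurable,
    and equals the derivative wherever that exists off [A]. *)
Lemma measurable_derivative A f i : klip A f -> aediff f ->
  exists2 g, measurable_fun setT (fun p : R3 R => g (vec3 p)) &
    {ae mu, forall p, is_derive (vec3 p) (axis i) f (g (vec3 p))}.
Proof.
move=> fA df; have [C C0 fC] := fA.
pose D : set (R3 R) := ~` [set p | vec3 p \in A].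
have mD : measurable D.
  apply: measurableC; rewrite (_ : mkset _ = [set p | vec3 p \in A /\ setT p]).
    exact: measurable_vec3_in.
  by apply/seteqP; split=> p //= [].
pose q (n : nat) x := n.+1%:R * (f (x + n.+1%:R^-1 *: axis i) - f x).
exists (fun x => if x \in A then 0 else limn_sup (q^~ x)).
  (* The indicator of the complement of [A] keeps the sequence of quotients bounded at every point,
     as the measurability of a limsup requires. *)
  have -> : (fun p : R3 R => if vec3 p \in A then 0 else limn_sup (q^~ (vec3 p))) =
      (fun p => limn_sup ((fun n p => q n (vec3 p) * \1_D p)^~ p)).
    apply/funext => p; rewrite indicE; case: ifPn => pA.
      rewrite memNset; last by move=> h; exact: h pA.
      under [in RHS]eq_fun do rewrite mulr0.
      by have [_ ->] := cvg_limn_inf_sup (@cvg_cst _ (0 : R) _ \oo _).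
    rewrite mem_set; last by exact/negP.
    by under [in RHS]eq_fun do rewrite mulr1.
  have bnd p n : `|q n (vec3 p) * \1_D p| <= C * wt A (vec3 p).
    rewrite indicE; case: (boolP (vec3 p \in A)) => pA.
      rewrite memNset; last by move=> h; exact: h pA.
      by rewrite mulr0 normr0 mulr_ge0// ltW// wt_gt0.
    rewrite mem_set ?mulr1; last by exact/negP.
    exact: klip_quotient.
  apply: measurable_fun_limn_sup => [p _|p _|n].
  - by exists (C * wt A (vec3 p)) => _ [n _ <-]; apply: le_trans (bnd p n); exact: ler_norm.
  - exists (- (C * wt A (vec3 p))) => _ [n _ <-]; rewrite lerNl.
    by apply: le_trans (bnd p n); rewrite -normrN; exact: ler_norm.
  - apply: measurable_funM; last exact: measurable_indic.
    have mf := klip_measurable fA.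
    apply: measurable_funM => //; apply: measurable_funB => //.
    exact: measurable_translate.
apply: (ae_imp2 (ae_notin A) df) => p pA dp.
rewrite (negbTE pA); have d := derivableP (dp i).
by have [_ ->] := cvg_limn_inf_sup (quotient_cvg d).
Qed.

Lemma is_derive_expRZ (c t : R) : is_derive t 1 (fun s => expR (c * s)) (c * expR (c * t)).
Proof.
have h : is_derive t 1 (fun s : R => c * s) c.
  by apply: is_derive_eq; rewrite [LHS]mulr1.
by have := is_derive1_comp (is_derive_expR (c * t)) h; rewrite mulrC.
Qed.

Lemma good_expRN A (q : R) : 0 <= q -> good A (@enorm R) ->
  good A (fun x => expR (- q * enorm x)).
Proof.
move=> q0 gr.
have d1 (c t : R) : is_derive t 1 (fun s => c * expR (- q * s)) (c * (- q * expR (- q * t))).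
  exact: (@is_deriveZ _ _ _ (fun s : R => expR (- q * s)) c t 1 _ (is_derive_expRZ (- q) t)).
have d2 (t : R) : is_derive t 1 (fun s => - q * expR (- q * s)) (q ^+ 2 * expR (- q * t)).
  by have := d1 (- q) t; rewrite mulrA mulrNN.
have le1 t : 0 <= t -> expR (- q * t) <= 1.
  by move=> t0; rewrite -expR0 ler_expR mulNr oppr_le0 mulr_ge0.
apply: (@good_comp _ A _ [set t | 0 <= t] _ _ _ (q + q ^+ 2) _ _ (is_derive_expRZ (- q)) d2) => //.
- by move=> a b c /= a0 _ /andP[ac _]; exact: le_trans ac.
- by move=> x; exact: enorm_ge0.
- move=> t /= t0; rewrite normrM normrN (ger0_norm q0) (ger0_norm (expR_ge0 _)).
  by have := le1 _ t0; have := expR_ge0 (- q * t); nra.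
- move=> t /= t0; rewrite normrM (ger0_norm (sqr_ge0 _)) (ger0_norm (expR_ge0 _)).
  by have := le1 _ t0; have := expR_ge0 (- q * t); nra.
Qed.

Lemma mi_deriv_cases (kappa : 'I_3 -> nat) : (mi_order kappa <= 2)%N ->
  [\/ mi_order kappa = 0%N /\ forall eta : 'rV[R]_3 -> R, mi_deriv kappa eta = eta,
      mi_order kappa = 1%N /\
        exists i, forall eta : 'rV[R]_3 -> R, mi_deriv kappa eta = partial i eta |
      mi_order kappa = 2%N /\
        exists i j, forall eta : 'rV[R]_3 -> R, mi_deriv kappa eta = partial i (partial j eta)].
Proof.
have enum3 : enum 'I_3 = [:: i0; i1; i2].
  by apply: (inj_map val_inj); rewrite val_enum_ord.
have order3 : mi_order kappa = (kappa i0 + kappa i1 + kappa i2)%N.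
  rewrite /mi_order !big_ord_recr big_ord0 /= add0n.
  by congr (kappa _ + kappa _ + kappa _)%N; exact: val_inj.
have d3 (eta : 'rV[R]_3 -> R) : mi_deriv kappa eta =
    iter (kappa i0) (partial i0) (iter (kappa i1) (partial i1) (iter (kappa i2) (partial i2) eta)).
  by rewrite /mi_deriv enum3.
rewrite order3.
case: (kappa i0) d3 => [|[|[|//]]]; case: (kappa i1) => [|[|[|//]]];
  case: (kappa i2) => [|[|[|//]]] //= d3 _;
  first [ by apply: Or31; split=> //; exact: d3
        | by apply: Or32; split=> //; eexists; exact: d3
        | by apply: Or33; split=> //; eexists; eexists; exact: d3 ].
Qed.

(** The first derivative [G i] is again weighted Lipschitz and bounded, so [weak_derivative] applies
    a second time; its own derivative is only measurable, with a bound by the weight times the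
    decay. *)
Lemma sobolev_real A u (q : R) : 0 < q -> good A (@enorm R) -> bdd u -> good A u ->
  let F := fun x => u x * expR (- q * enorm x) in
  (fun p => F (vec3 p)) \in Lfun mu 2%:E /\
  forall kappa : 'I_3 -> nat, (mi_order kappa <= 2)%N ->
    exists2 g : 'rV[R]_3 -> R, (fun p => g (vec3 p)) \in Lfun mu 2%:E &
      forall eta, test_function eta ->
        \int[mu]_p (F (vec3 p) * mi_deriv kappa eta (vec3 p)) =
        (-1) ^+ mi_order kappa * \int[mu]_p (g (vec3 p) * eta (vec3 p)).
Proof.
move=> q0 gr [M uM] gu F.
have bu : bdd u by exists M.
have M0 : 0 <= M := le_trans (normr_ge0 _) (uM 0).
pose W x : R := expR (- q * enorm x).
have gW : good A W by apply: good_expRN => //; exact: ltW.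
have W0 x : 0 <= W x by exact: expR_ge0.
have bW : bdd W.
  exists 1 => x; rewrite ger0_norm// -expR0 ler_expR mulNr oppr_le0.
  by rewrite mulr_ge0 ?enorm_ge0 ?ltW.
have rW := good_reg gW bW.
have [_ [r_ rr rd]] := gr.
have gF : good A F by exact: goodM.
have bF : bdd F by exact: bddM.
have kF : klip A F by apply: lip_klip; case: gF.
case: gu => [lu [u_ ru ud]].
(* The derivative of u exp(-q r) is exp(-q r) times [H i], [r_] being the gradient of r. *)
pose H i x := u_ i x + - q * (u x * r_ i x).
have ruu : reg A u by exact: (good_reg (conj lu (ex_intro2 _ _ u_ ru ud)) bu).
have rH i : reg A (H i).
  exact: (regD (ru i) (regM (reg_cst A (- q)) (regM ruu (rr i)))).
have Wd : {ae mu, forall p, forall i, is_derive (vec3 p) (axis i) W (- q * W (vec3 p) * r_ i (vec3 p))}.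
  apply: (ae_imp rd) => p rp i.
  exact: (is_derive_comp (is_derive_expRZ (- q) _) (rp i)).
pose G i x := H i x * W x.
have rG i : reg A (G i) by exact: (regM (rH i) rW).
have Fd : {ae mu, forall p, forall i, is_derive (vec3 p) (axis i) F (G i (vec3 p))}.
  apply: (ae_imp2 ud Wd) => p up wp i.
  by have := is_deriveM2 (up i) (wp i); rewrite /G /H; congr is_derive; ring.
have L2 (g : 'rV[R]_3 -> R) (C : R) : measurable_fun setT (fun p : R3 R => g (vec3 p)) ->
    {ae mu, forall p, `|g (vec3 p)| <= C * (wt A (vec3 p) * W (vec3 p))} ->
    (fun p => g (vec3 p)) \in Lfun mu 2%:E.
  by move=> mg gC; exact: (Lfun2_le_wt q0 mg gC).
have L2b (g : 'rV[R]_3 -> R) : klip A (fun x => g x * W x) -> bdd g ->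
    (fun p => g (vec3 p) * W (vec3 p)) \in Lfun mu 2%:E.
  move=> kg [N gN]; apply: (L2 (fun x => g x * W x) N); first exact: (klip_measurable kg).
  apply: aeW => p; rewrite normrM (ger0_norm (W0 _)).
  have N0 : 0 <= N := le_trans (normr_ge0 _) (gN 0).
  by apply: ler_pM => //; rewrite ler_peMl// wt_ge1.
have FL2 : (fun p => F (vec3 p)) \in Lfun mu 2%:E by exact: L2b.
split => // kappa /mi_deriv_cases[[-> kE]|[-> [i kE]]|[-> [i [j kE]]]].
- by exists F => // eta teta; rewrite expr0 mul1r kE.
- exists (G i); first by apply: L2b; [case: (rG i)|case: (rH i)].
  move=> eta teta; rewrite expr1 mulN1r kE; apply: (weak_derivative kF bF) => //.
    by apply: (@klip_measurable _ A); case: (rG i).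
  by apply: (ae_imp Fd).
have [kG bG dG] := rG i.
have [g mg gd] := measurable_derivative j kG dG.
have [[CH CH0 hCH] [NH hNH] dH] := rH i.
have [_ [Nr hNr] _] := rr j.
exists g; last first.
  move=> eta teta; rewrite kE.
  have tj := test_function_partial j teta.
  rewrite (@weak_derivative _ A F (G i))//; last 2 first.
  - exact: klip_measurable kG.
  - by apply: (ae_imp Fd).
  by rewrite (@weak_derivative _ A (G i) g)// opprK expr2 mulrNN mulr1 mul1r.
(* Product rule for [H i * W]: the first summand bounds [H i] times the derivative of [W], the
   second the derivative of [H i], which carries the weight. *)
apply: (L2 g (NH * (q * Nr) + CH) mg).
apply: (ae_imp2 (ae_notin A) (ae_imp2 gd (ae_imp2 dH Wd (fun p a b => conj a b)) (fun p a b => conj a b))) => p pA.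
move=> [dg [/(_ j) /derivableP dHj /(_ j) dWj]].
have -> : g (vec3 p) = H i (vec3 p) * (- q * W (vec3 p) * r_ j (vec3 p)) + W (vec3 p) * 'D_(axis j) (H i) (vec3 p).
  by have := is_deriveM2 dHj dWj; rewrite -/(G i) => -[_ <-]; case: dg => _ <-.
have w1 := wt_ge1 A (vec3 p).
have hD := klip_derive_le CH0 hCH pA dHj.
have Wp := W0 (vec3 p).
have NH0 := le_trans (normr_ge0 _) (hNH (vec3 p)).
have Nr0 := le_trans (normr_ge0 _) (hNr (vec3 p)).
apply: le_trans (ler_normD _ _) _.
rewrite !normrM normrN (gtr0_norm q0) (ger0_norm Wp) mulrDl; apply: lerD.
  have : `|H i (vec3 p)| * (q * `|r_ j (vec3 p)|) <= NH * (q * Nr).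
    apply: ler_pM; [by []|exact: mulr_ge0 (ltW q0) (normr_ge0 _)|exact: hNH|].
    by rewrite ler_pM2l.
  move=> h.
  rewrite (_ : _ * (_ * _ * _) = `|H i (vec3 p)| * (q * `|r_ j (vec3 p)|) * W (vec3 p)); last by ring.
  apply: ler_pM; [|by []|by []|by rewrite ler_peMl].
  exact: mulr_ge0 (normr_ge0 _) (mulr_ge0 (ltW q0) (normr_ge0 _)).
by rewrite mulrC (mulrA CH) ler_wpM2r.
Qed.

Lemma W22_decay A (u1 u2 : 'rV[R]_3 -> R) (f : 'rV[R]_3 -> R[i]) (q : R) : 0 < q ->
  good A (@enorm R) -> bdd u1 -> good A u1 -> bdd u2 -> good A u2 ->
  (forall x, complex.Re (f x) = u1 x * expR (- q * enorm x)) ->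
  (forall x, complex.Im (f x) = u2 x * expR (- q * enorm x)) -> W22 f.
Proof.
move=> q0 gr b1 g1 b2 g2 fRe fIm.
have [L1 W1] := sobolev_real q0 gr b1 g1; have [L2 W2] := sobolev_real q0 gr b2 g2.
have eRe : (fun p => complex.Re (f (vec3 p))) = fun p => u1 (vec3 p) * expR (- q * enorm (vec3 p)).
  by apply/funext => p; rewrite fRe.
have eIm : (fun p => complex.Im (f (vec3 p))) = fun p => u2 (vec3 p) * expR (- q * enorm (vec3 p)).
  by apply/funext => p; rewrite fIm.
split; first by split; rewrite ?eRe ?eIm.
move=> kappa k2; have [d1 Ld1 hd1] := W1 _ k2; have [d2 Ld2 hd2] := W2 _ k2.
exists (fun x => (d1 x +i* d2 x)%C); first by split.
move=> eta teta; split.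
- by under eq_Rintegral do rewrite fRe; exact: hd1.
- by under eq_Rintegral do rewrite fIm; exact: hd2.
Qed.

End SobolevMembership.

(** * Complex-valued functions and quasi-polynomials *)

Section ComplexRegular.
Context {R : realType}.
Implicit Types (A : seq 'rV[R]_3) (f g : 'rV[R]_3 -> R[i]) (u : 'rV[R]_3 -> R).
Local Notation Re := complex.Re.
Local Notation Im := complex.Im.

Lemma good_cos A u : good A u -> good A (fun x => cos (u x)).
Proof.
apply: (@good_comp _ A u setT cos (fun t => - sin t) (fun t => - cos t) 1) => //.
- by move=> c _; rewrite normrN ler_norml sin_geN1 sin_le1.
- by move=> c _; rewrite normrN ler_norml cos_geN1 cos_le1.
Qed.

Lemma good_sin A u : good A u -> good A (fun x => sin (u x)).
Proof.
apply: (@good_comp _ A u setT sin cos (fun t => - sin t) 1) => //.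
- by move=> c _; rewrite ler_norml cos_geN1 cos_le1.
- by move=> c _; rewrite normrN ler_norml sin_geN1 sin_le1.
Qed.

Lemma bdd_cos u : bdd (fun x => cos (u x)).
Proof. by exists 1 => x; rewrite ler_norml cos_geN1 cos_le1. Qed.

Lemma bdd_sin u : bdd (fun x => sin (u x)).
Proof. by exists 1 => x; rewrite ler_norml sin_geN1 sin_le1. Qed.

Lemma bdd_expR u : bdd u -> bdd (fun x => expR (u x)).
Proof.
move=> [M uM]; exists (expR M) => x; rewrite (ger0_norm (expR_ge0 _)) ler_expR.
by apply: le_trans (uM x); exact: ler_norm.
Qed.

Lemma good_expR A u : bdd u -> good A u -> good A (fun x => expR (u x)).
Proof.
move=> [M uM]; apply: (@good_comp _ A u [set t | t <= M] expR expR expR (expR M)) => //.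
- by move=> a b c _ /= bM /andP[_ cb]; exact: le_trans cb bM.
- by move=> x /=; apply: le_trans (uM x); exact: ler_norm.
- by move=> c /= cM; rewrite (ger0_norm (expR_ge0 _)) ler_expR.
- by move=> c /= cM; rewrite (ger0_norm (expR_ge0 _)) ler_expR.
Qed.

Lemma goodZ A (a : R) u : good A u -> good A (fun x => a * u x).
Proof.
move=> [[L L0 uL] [du rdu ud]]; split.
  exists (`|a| * L); first exact: mulr_ge0.
  by move=> x y; rewrite -mulrBr normrM -mulrA ler_wpM2l.
exists (fun i x => a * du i x) => [i|]; first exact: (regM (reg_cst A a) (rdu i)).
apply: (ae_imp ud) => p up i.
have := is_deriveM2 (is_derive_cst a (vec3 p) (axis i)) (up i).
by rewrite mulr0 addr0.
Qed.

Definition cgood A f := (bdd (fun x => Re (f x)) /\ good A (fun x => Re (f x))) /\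
  (bdd (fun x => Im (f x)) /\ good A (fun x => Im (f x))).

Lemma cgood_cst A (a : R[i]) : cgood A (fun=> a).
Proof. by split; split; [exact: bdd_cst|exact: good_cst..|exact: bdd_cst|exact: good_cst]. Qed.

Lemma cgoodD A f g : cgood A f -> cgood A g -> cgood A (fun x => f x + g x).
Proof.
move=> [[b1 g1] [b2 g2]] [[c1 h1] [c2 h2]]; split.
- rewrite (_ : (fun x => _) = fun x => Re (f x) + Re (g x)).
    by split; [exact: bddD|exact: goodD].
  by apply/funext => x; case: (f x) (g x) => ? ? [].
- rewrite (_ : (fun x => _) = fun x => Im (f x) + Im (g x)).
    by split; [exact: bddD|exact: goodD].
  by apply/funext => x; case: (f x) (g x) => ? ? [].
Qed.

Lemma cgoodM A f g : cgood A f -> cgood A g -> cgood A (fun x => f x * g x).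
Proof.
move=> [[b1 g1] [b2 g2]] [[c1 h1] [c2 h2]].
have bM := @bddM R; have bD := @bddD R.
have bN u : bdd u -> bdd (fun x => (-1) * u x) by move=> bu; exact: (bM _ _ (bdd_cst _) bu).
split.
- rewrite (_ : (fun x => _) = fun x => Re (f x) * Re (g x) + -1 * (Im (f x) * Im (g x))).
    split; first exact: (bD _ _ (bM _ _ b1 c1) (bN _ (bM _ _ b2 c2))).
    exact: (goodD (goodM b1 c1 g1 h1) (goodZ (-1) (goodM b2 c2 g2 h2))).
  by apply/funext => x; case: (f x) (g x) => ? ? [? ?] /=; rewrite mulN1r.
- rewrite (_ : (fun x => _) = fun x => Re (f x) * Im (g x) + Im (f x) * Re (g x)).
    split; first exact: (bD _ _ (bM _ _ b1 c2) (bM _ _ b2 c1)).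
    exact: (goodD (goodM b1 c2 g1 h2) (goodM b2 c1 g2 h1)).
  by apply/funext => x; case: (f x) (g x) => ? ? [? ?].
Qed.

(** Only the real part of the exponent has to be bounded: the phase, which may grow like |x|, enters
    through cos and sin. *)
Lemma cgood_cexp A f : bdd (fun x => Re (f x)) -> good A (fun x => Re (f x)) ->
  good A (fun x => Im (f x)) -> cgood A (fun x => cexp (f x)).
Proof.
move=> b1 g1 g2; have be := bdd_expR b1; have ge := good_expR b1 g1.
split.
- rewrite (_ : (fun x => _) = fun x => expR (Re (f x)) * cos (Im (f x))).
    split; first exact: (bddM be (bdd_cos _)).
    exact: (goodM be (bdd_cos _) ge (good_cos g2)).
  by apply/funext => x; rewrite /cexp /= mul0r subr0.
- rewrite (_ : (fun x => _) = fun x => expR (Re (f x)) * sin (Im (f x))).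
    split; first exact: (bddM be (bdd_sin _)).
    exact: (goodM be (bdd_sin _) ge (good_sin g2)).
  by apply/funext => x; rewrite /cexp /= mul0r addr0.
Qed.

Lemma cgood_horner A f (P : {poly R[i]}) : cgood A f -> cgood A (fun x => P.[f x]).
Proof.
move=> gf; elim/poly_ind: P => [|P c ih].
  by under eq_fun do rewrite horner0; exact: cgood_cst.
under eq_fun do rewrite hornerMXaddC.
exact: (cgoodD (cgoodM ih gf) (cgood_cst A c)).
Qed.

(** Boundedness of [f] bounds the real parts of the exponents, one reason why [cgood] includes
    it. *)
Lemma cgood_quasi_polynomial A f P : quasi_polynomial P -> cgood A f ->
  cgood A (fun x => P (f x)).
Proof.
move=> [s Ps] gf; rewrite (funext (fun x => Ps (f x))).
elim: s {Ps} => [|[p l] s ih].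
  by under eq_fun do rewrite big_nil; exact: cgood_cst.
under eq_fun do rewrite big_cons.
apply: (cgoodD _ ih); apply: (cgoodM (cgood_horner p gf)).
have [[b1 g1] [b2 g2]] := cgoodM (cgood_cst A l) gf.
exact: cgood_cexp.
Qed.

(** The phase does not depend on x and is absorbed into [f] as a constant factor. *)
Lemma W22_cgood A f (w q : R) : 0 < q -> good A (@enorm R) -> cgood A f ->
  W22 (fun x => f x * cexp ('i%C * w%:C%C - (q * enorm x)%:C%C)).
Proof.
move=> q0 gr gf.
have [[b1 g1] [b2 g2]] := cgoodM gf (cgood_cst A (cos w +i* sin w)%C).
apply: (W22_decay q0 gr b1 g1 b2 g2) => x; rewrite /cexp /=;
  rewrite !(mul0r, mul1r, mulr0, add0r, addr0, subr0, oppr0, sub0r, mulNr, mulrN, opprK);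
  case: (f x) => a b /=; ring.
Qed.

End ComplexRegular.

(** * Delay functions *)

Section Delay.
Context {R : realType}.
Variables (s : R) (X : R -> 'rV[R]_3) (c t : R).
Hypotheses (s1 : `|s| = 1) (c01 : 0 <= c < 1)
  (Xc : forall u u', enorm (X u - X u') <= c * `|u - u'|).
Implicit Types (x y : 'rV[R]_3).

Local Notation phi := (delay s X t).
Local Notation tdev := (deviating_time s X t).

Let c0 : 0 <= c. Proof. by case/andP: c01. Qed.
Let c1 : 0 < 1 - c. Proof. by case/andP: c01 => _; rewrite subr_gt0. Qed.

Lemma lipschitz_continuous_enorm_sub x :
  continuous (fun d : R => enorm (x - X (t + s * d))).
Proof.
move=> d; apply/cvgrPdist_lt => e e0; near=> d'.
apply: le_lt_trans (ler_enorm_dist _ _) _.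
rewrite opprB addrC addrA subrK; apply: le_lt_trans (Xc _ _) _.
rewrite opprD addrACA subrr add0r -mulrBr normrM s1 mul1r.
apply: (@le_lt_trans _ _ `|d - d'|).
  by rewrite distrC ler_piMl// -subr_ge0 ltW.
by near: d'; apply/nbhs_ballP; exists e.
Unshelve. all: by end_near. Qed.

(** Intermediate value theorem for d - |x - X(t + s d)|: it is at most 0 at 0, and at least 0 at [D]
    because |x - X t| + c D = D. *)
Lemma delay_ex x : exists d, 0 <= d /\ d = enorm (x - X (t + s * d)).
Proof.
pose D := enorm (x - X t) / (1 - c).
have D0 : 0 <= D by rewrite divr_ge0 ?enorm_ge0// ltW.
pose h d := d - enorm (x - X (t + s * d)).
have hc : {within `[0, D], continuous h}.
  apply: continuous_subspaceT => d; apply: cvgB; first exact: cvg_id.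
  exact: lipschitz_continuous_enorm_sub.
have h0 : h 0 <= 0 by rewrite /h sub0r oppr_le0 enorm_ge0.
have hD : 0 <= h D.
  rewrite /h subr_ge0; apply: le_trans (ler_enorm_distD (X t) _ _) _.
  have := Xc t (t + s * D); rewrite opprD addrA subrr add0r normrN normrM s1 mul1r ger0_norm//.
  have : D * (1 - c) = enorm (x - X t) by rewrite /D divfK// gt_eqF.
  lra.
have [|d] := IVT D0 hc (v := 0).
  by rewrite ge_min h0/= le_max hD orbT.
rewrite in_itv/= => /andP[d0 _] /eqP; rewrite subr_eq0 => /eqP hd.
by exists d.
Qed.

Lemma delayP x : 0 <= phi x /\ phi x = enorm (x - X (tdev x)).
Proof. exact: (getPex (delay_ex x)). Qed.

Lemma delay_ge0 x : 0 <= phi x. Proof. by case: (delayP x). Qed.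

Lemma delayE x : phi x = enorm (x - X (tdev x)). Proof. by case: (delayP x). Qed.

(** As c < 1, the function d - |x - X(t + s d)| increases, so its sign at d decides the comparison.
    Only the position at the single time t + s d matters, which makes two trajectories comparable
    where they meet. *)
Lemma delay_leP x d : 0 <= d -> (phi x <= d) = (enorm (x - X (t + s * d)) <= d).
Proof.
move=> d0; have h : enorm (X (tdev x) - X (t + s * d)) <= c * `|phi x - d|.
  apply: le_trans (Xc _ _) _.
  by rewrite /deviating_time opprD addrACA subrr add0r -mulrBr normrM s1 mul1r.
have h1 := ler_enorm_distD (X (tdev x)) x (X (t + s * d)).
have h2 := ler_enorm_distD (X (t + s * d)) x (X (tdev x)).
rewrite (enormC (X (t + s * d))) in h2; rewrite -delayE in h1 h2.
have [pd|pd] := leP (phi x) d.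
  rewrite ler0_norm ?subr_le0// in h; apply/esym/idP.
  have : 0 <= (1 - c) * (d - phi x) by apply: (mulr_ge0 (ltW c1)); rewrite subr_ge0.
  by lra.
rewrite gtr0_norm ?subr_gt0// in h; apply/esym/negbTE; rewrite -ltNge.
have : 0 < (1 - c) * (phi x - d) by apply: (mulr_gt0 c1); rewrite subr_gt0.
by lra.
Qed.

Lemma delay_uniq x d : 0 <= d -> d = enorm (x - X (t + s * d)) -> phi x = d.
Proof.
move=> d0 dE; apply/eqP; rewrite eq_le delay_leP// -dE lexx/=.
have h : enorm (X (t + s * d) - X (tdev x)) <= c * `|d - phi x|.
  apply: le_trans (Xc _ _) _.
  by rewrite /deviating_time opprD addrACA subrr add0r -mulrBr normrM s1 mul1r.
have h1 := ler_enorm_distD (X (tdev x)) x (X (t + s * d)).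
rewrite -delayE -dE enormC in h1.
rewrite leNgt; apply/negP => pd; rewrite gtr0_norm ?subr_gt0// in h.
have : 0 < (1 - c) * (d - phi x) by apply: (mulr_gt0 c1); rewrite subr_gt0.
by lra.
Qed.

Lemma tdev_dist x y : `|tdev x - tdev y| = `|phi x - phi y|.
Proof. by rewrite /deviating_time opprD addrACA subrr add0r -mulrBr normrM s1 mul1r. Qed.

(** The position used moves by at most c times the change of the delay, and this term is absorbed on
    the left. *)
Lemma delay_lip x y : `|phi x - phi y| <= (1 - c)^-1 * enorm (x - y).
Proof.
rewrite ler_pdivlMl//.
have h : `|phi x - phi y| <= enorm (x - y) + c * `|phi x - phi y|.
  rewrite {1}delayE {1}(delayE y); apply: le_trans (ler_enorm_dist _ _) _.
  rewrite (_ : _ - _ = (x - y) + (X (tdev y) - X (tdev x))); last first.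
    by rewrite opprB (addrC (X (tdev y)) (- y)) addrACA (addrC (- X _)).
  apply: le_trans (ler_enormD _ _) _; rewrite lerD2l.
  by apply: le_trans (Xc _ _) _; rewrite tdev_dist distrC.
by move: h; rewrite mulrBl mul1r; lra.
Qed.

(** During the delay the trajectory moves by at most c times the delay, and 1 + c <= 2. This
    converts 1/phi into the weight at the tip [X t]. *)
Lemma delay_ge x : enorm (x - X t) <= 2 * phi x.
Proof.
have := ler_enorm_distD (X (tdev x)) x (X t); rewrite -delayE.
have e : `|tdev x - t| = phi x.
  by rewrite /deviating_time (addrC t) addrK normrM s1 mul1r ger0_norm ?delay_ge0.
have := Xc (tdev x) t; rewrite e.
have : 0 <= (1 - c) * phi x by apply: (mulr_ge0 (ltW c1)); exact: delay_ge0.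
by lra.
Qed.

Lemma delay_gt0 x : x != X t -> 0 < phi x.
Proof.
move=> xt; have : 0 < enorm (x - X t) by apply: enorm_gt0; rewrite subr_eq0.
by have := delay_ge x; lra.
Qed.

Lemma nhatE x : nhat s X t x = (phi x)^-1 *: (x - X (tdev x)).
Proof. by rewrite /nhat /= -delayE. Qed.

Lemma enorm_nhat_le1 x : enorm (nhat s X t x) <= 1.
Proof.
rewrite /nhat /= enormZ ger0_norm ?invr_ge0 ?enorm_ge0//.
by have [->|w0] := eqVneq (enorm (x - X (tdev x))) 0; rewrite ?mulr0// mulVf.
Qed.

End Delay.

Section Normalisation.
Context {R : realType}.
Implicit Types (w : 'rV[R]_3).

(** Only |w| appears in the bound, in keeping with a weight at one point; when [w'] is 0 its
    normalisation is 0 by convention. *)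
Lemma normalise_dist w w' : w != 0 ->
  enorm ((enorm w)^-1 *: w - (enorm w')^-1 *: w') <= 2 * (enorm w)^-1 * enorm (w - w').
Proof.
move=> w0; have n0 := enorm_gt0 w0.
rewrite (_ : _ - _ = (enorm w)^-1 *: (w - w') + ((enorm w)^-1 - (enorm w')^-1) *: w'); last first.
  by rewrite scalerBr scalerBl addrA subrK.
apply: le_trans (ler_enormD _ _) _; rewrite !enormZ gtr0_norm ?invr_gt0//.
suff : `|(enorm w)^-1 - (enorm w')^-1| * enorm w' <= (enorm w)^-1 * enorm (w - w') by lra.
have [w'0|w'0] := eqVneq w' 0.
  by rewrite w'0 enorm0 mulr0 mulr_ge0 ?enorm_ge0// invr_ge0 ltW.
have n'0 := enorm_gt0 w'0.
rewrite -[X in _ * X](gtr0_norm n'0) -normrM mulrBl mulVf ?gt_eqF//.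
have -> : (enorm w)^-1 * enorm w' - 1 = (enorm w)^-1 * (enorm w' - enorm w).
  by rewrite mulrBr mulVf// gt_eqF.
rewrite normrM gtr0_norm ?invr_gt0// ler_wpM2l ?invr_ge0 ?(ltW n0)//.
by rewrite enormC; exact: ler_enorm_dist.
Qed.

End Normalisation.

Lemma wt_ge (R : realType) (A : seq 'rV[R]_3) a x : a \in A -> (enorm (x - a))^-1 <= wt A x.
Proof.
elim: A => // b A ih; rewrite inE wt_cons => /orP[/eqP->|/ih aA].
  by rewrite lerDr ltW// wt_gt0.
by apply: le_trans aA _; rewrite lerDl invr_ge0 enorm_ge0.
Qed.

(** * Direction vector and derivative of one delay function *)

Section DelayDerivative.
Context {R : realType}.
Variables (s : R) (X : R -> 'rV[R]_3) (c t : R).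
Hypotheses (s1 : `|s| = 1) (c01 : 0 <= c < 1)
  (Xc : forall u u', enorm (X u - X u') <= c * `|u - u'|).
Implicit Types (x y v : 'rV[R]_3) (A : seq 'rV[R]_3).

Local Notation phi := (delay s X t).
Local Notation tdev := (deviating_time s X t).

Let c0 : 0 <= c. Proof. by case/andP: c01. Qed.
Let c1 : 0 < 1 - c. Proof. by case/andP: c01 => _; rewrite subr_gt0. Qed.

Let dE := delayE t s1 c01 Xc.
Let dlip := delay_lip t s1 c01 Xc.
Let dge0 := delay_ge0 t s1 c01 Xc.
Let dgt0 x := @delay_gt0 R s X c t s1 c01 Xc x.
Let tdist := tdev_dist X t s1.

Lemma nhat_klip A : X t \in A -> exists2 C, 0 <= C & forall x y, x \notin A ->
  enorm (nhat s X t x - nhat s X t y) <= C * wt A x * enorm (x - y).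
Proof.
move=> XA; exists (4 * (1 - c)^-1); first by rewrite mulr_ge0// invr_ge0 ltW.
move=> x y xA.
have xt : x != X t by apply: contraNneq xA => ->.
have p0 := dgt0 xt.
have w0 : x - X (tdev x) != 0.
  by apply: contraTneq p0 => w0; rewrite dE w0 enorm0 ltxx.
apply: le_trans (normalise_dist _ w0) _; rewrite -dE.
have h1 : enorm (x - X (tdev x) - (y - X (tdev y))) <= (1 - c)^-1 * enorm (x - y).
  rewrite (_ : _ - _ = (x - y) + (X (tdev y) - X (tdev x))); last first.
    by rewrite opprB (addrC (X (tdev y)) (- y)) addrACA (addrC (- X _)).
  apply: le_trans (ler_enormD _ _) _.
  have h : enorm (X (tdev y) - X (tdev x)) <= c * ((1 - c)^-1 * enorm (x - y)).
    apply: le_trans (Xc _ _) _; rewrite tdist ler_wpM2l// distrC.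
    exact: dlip.
  apply: (le_trans (lerD (lexx _) h)); rewrite le_eqVlt; apply/orP; left; apply/eqP.
  by field; rewrite gt_eqF.
(* The previous bound uses 1 + c / (1 - c) = 1 / (1 - c); this one, together with [normalise_dist],
   accounts for the factor 4. *)
have h2 : (phi x)^-1 <= 2 * wt A x.
  apply: (@le_trans _ _ (2 * (enorm (x - X t))^-1)); last by rewrite ler_pM2l// wt_ge.
  have e0 : 0 < enorm (x - X t) by rewrite enorm_gt0// subr_eq0.
  by rewrite ler_pdivlMr// ler_pdivrMl// mulrC (delay_ge t s1 c01 Xc).
rewrite (_ : 4 * _ * _ * _ = (2 * (2 * wt A x)) * ((1 - c)^-1 * enorm (x - y))); last by ring.
apply: ler_pM; rewrite ?mulr_ge0 ?invr_ge0 ?enorm_ge0 ?(ltW p0)//.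
by rewrite ler_pM2l.
Qed.

(** Caratheodory's criterion with an explicit slope. Along the line psi(h)^2 - phi(x)^2 is the dot
    product of P h - p and P h + p, and P h - p is affine in psi(h) - phi(x); solving for this
    difference gives the slope. The trajectory is differentiated at the single time [tdev x]. *)
Lemma delay_derive x i v : x != X t ->
  (forall k, is_derive (tdev x) 1 (fun u => X u 0 k) (v 0 k)) -> enorm v <= c ->
  is_derive x (axis i) phi (nhat s X t x 0 i / (1 + s * dot (nhat s X t x) v)).
Proof.
move=> xt dX vc.
have p0 := dgt0 xt.
pose p := x - X (tdev x).
have /choice[g gP] : forall k, exists g : R -> R, [/\ forall u, X u 0 k - X (tdev x) 0 k = g u * (u - tdev x),
    {for tdev x, continuous g} & g (tdev x) = v 0 k].
  by move=> k; exact/is_derive1_caratheodory.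
(* The difference quotient of the trajectory from [tdev x], extended there by [v]; the Lipschitz
   bound keeps its length at most [c] at every time. *)
pose gv u : 'rV[R]_3 := \row_k g k u.
have gvE u : X u - X (tdev x) = (u - tdev x) *: gv u.
  by apply/rowP => k; rewrite !mxE; have [-> _ _] := gP k; rewrite mulrC.
have gvc u : enorm (gv u) <= c.
  have [->|u0] := eqVneq u (tdev x).
    suff -> : gv (tdev x) = v by [].
    by apply/rowP => k; rewrite mxE; have [_ _ ->] := gP k.
  have := Xc u (tdev x); rewrite gvE enormZ mulrC ler_pM2r// normr_gt0 subr_eq0//.
pose psi (h : R) := phi (h *: axis i + x).
pose P (h : R) := h *: axis i + x - X (tdev (h *: axis i + x)).
pose den h := psi h + phi x + s * dot (gv (tdev (h *: axis i + x))) (P h + p).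
have psi0 : psi 0 = phi x by rewrite /psi scale0r add0r.
(* The dot product is at most c (psi h + phi x), so the slope has a positive denominator for all h,
   not only near 0. *)
have den0 h : 0 < den h.
  have P1 : enorm (P h) = psi h by rewrite /P /psi [RHS]dE.
  have p1 : enorm p = phi x by rewrite /p [RHS]dE.
  have h1 : `|s * dot (gv (tdev (h *: axis i + x))) (P h + p)| <= c * (psi h + phi x).
    rewrite normrM s1 mul1r; apply: le_trans (ler_dot _ _) _.
    apply: ler_pM; rewrite ?enorm_ge0//; apply: le_trans (ler_enormD _ _) _.
    by rewrite P1 p1.
  have : 0 < (1 - c) * (psi h + phi x).
    by apply: (mulr_gt0 c1); rewrite ltr_wpDl// /psi; exact: dge0.
  by move: h1; rewrite ler_norml /den => /andP[]; lra.
have Pdiff h : P h - p = h *: axis i - (s * (psi h - phi x)) *: gv (tdev (h *: axis i + x)).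
    have -> : s * (psi h - phi x) = tdev (h *: axis i + x) - tdev x.
      by rewrite /deviating_time opprD addrACA subrr add0r mulrBr.
    rewrite -gvE /P /p opprB; move: (X (tdev _)) (X (tdev x)) => a b.
    by apply/rowP => k; rewrite !mxE; ring.
have key h : psi h - psi 0 = (P h + p) 0 i / den h * (h - 0).
  rewrite subr0 psi0; apply: (mulIf (lt0r_neq0 (den0 h))).
  rewrite mulrAC divfK ?lt0r_neq0//.
  have e := Pdiff h.
  have e2 : psi h ^+ 2 - phi x ^+ 2 = dot (P h - p) (P h + p).
    rewrite (_ : psi h = enorm (P h)); last by rewrite /psi [LHS]dE.
    rewrite (_ : phi x = enorm p); last by rewrite [LHS]dE.
    move: (P h) {+}p => a b; rewrite !sqr_enorm dotBl !dotDr (dotC b a); ring.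
  rewrite /den mulrDr.
  move: e2; rewrite e dotBl !dotZl dot_delta => e2.
  have -> : (psi h - phi x) * (psi h + phi x) = psi h ^+ 2 - phi x ^+ 2 by ring.
  by rewrite e2; ring.
have psic : {for 0, continuous psi}.
  apply/cvgrPdist_lt => e e0; near=> h; rewrite /psi.
  apply: le_lt_trans (dlip _ _) _; rewrite scale0r add0r opprD (addrC x) subrK enormN enormZ enorm_delta mulr1.
  rewrite mulrC ltr_pdivrMr// -[h]subr0 distrC.
  by near: h; apply/nbhs_ballP; exists (e * (1 - c)) => //=; exact: mulr_gt0.
pose td (h : R) := tdev (h *: axis i + x).
have td0 : td 0 = tdev x by rewrite /td scale0r add0r.
have tdc : {for 0, continuous td}.
  by apply: cvgD; [exact: cvg_cst|apply: cvgMr; exact: psic].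
have gtc k : {for 0, continuous (fun h => g k (td h))}.
  apply: (@continuous_comp _ _ _ td (g k)) => //.
  by rewrite td0; have [] := gP k.
have Pc k : {for 0, continuous (fun h => P h 0 k)}.
  have PE : (fun h => P h 0 k) = fun h => p 0 k + (h * axis i 0 k - s * (psi h - phi x) * g k (td h)).
    apply/funext => h; have /rowP/(_ k) := Pdiff h; rewrite !mxE => <-; ring.
  rewrite PE; apply: cvgD; first exact: cvg_cst.
  apply: cvgB; first by apply: cvgMl; exact: cvg_id.
  apply: cvgM; last exact: gtc.
  by apply: cvgMr; apply: cvgB; [exact: psic|exact: cvg_cst].
have denc : {for 0, continuous den}.
  have denE : den = fun h => psi h + phi x + s * (g i0 (td h) * (P h 0 i0 + p 0 i0) +
      g i1 (td h) * (P h 0 i1 + p 0 i1) + g i2 (td h) * (P h 0 i2 + p 0 i2)).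
    by apply/funext => h; rewrite /den dotE !mxE.
  have Ppc k : {for 0, continuous (fun h => g k (td h) * (P h 0 k + p 0 k))}.
    by apply: cvgM; [exact: gtc|apply: cvgD; [exact: Pc|exact: cvg_cst]].
  rewrite denE; apply: cvgD; first by apply: cvgD; [exact: psic|exact: cvg_cst].
  by apply: cvgMr; apply: cvgD; [apply: cvgD|]; exact: Ppc.
have x0 : 0 *: axis i + x = x by rewrite scale0r add0r.
suff : is_derive (0 *: axis i + x) (axis i) phi (nhat s X t x 0 i / (1 + s * dot (nhat s X t x) v)) by rewrite x0.
apply/is_derive_lineP/is_derive1_caratheodory.
exists (fun h => (P h + p) 0 i / den h); split => //.
- apply: cvgM; last by apply: cvgV; [exact: lt0r_neq0|exact: denc].
  suff : {for 0, continuous (fun h => (P h + p) 0 i)} by [].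
  have -> : (fun h => (P h + p) 0 i) = fun h => P h 0 i + p 0 i by apply/funext => h; rewrite mxE.
  by apply: cvgD; [exact: Pc|exact: cvg_cst].
have P0 : P 0 = p by rewrite /P x0.
have gv0 : gv (tdev x) = v by apply/rowP => k; rewrite mxE; have [_ _ ->] := gP k.
have := den0 0; rewrite /den psi0 P0 x0 gv0 (nhatE t s1 c01 Xc) -/p.
have E1 (a : R) (w : 'rV[R]_3) : (a *: w) 0 i = a * w 0 i by rewrite mxE.
have E2 (w : 'rV[R]_3) : (w + w) 0 i = w 0 i + w 0 i by rewrite mxE.
rewrite dotZl E1 E2 dotDr (dotC v p) => dpos.
field; rewrite (gt_eqF p0) (gt_eqF dpos) /= andbT; apply: lt0r_neq0.
by move: dpos; lra.
Unshelve. all: by end_near. Qed.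

End DelayDerivative.

(** * The gradient formula as a function of direction and velocity *)

Section RetardedGradient.
Context {R : realType}.
Variables (s c : R).
Hypotheses (s1 : `|s| = 1) (c01 : 0 <= c < 1).
Implicit Types (n v x y : 'rV[R]_3).

Let c0 : 0 <= c. Proof. by case/andP: c01. Qed.
Let c1 : 0 < 1 - c. Proof. by case/andP: c01 => _; rewrite subr_gt0. Qed.

Definition gradN i n v : R := n 0 i / (1 + s * dot n v).

Lemma gradN_den n v : enorm n <= 1 -> enorm v <= c -> 1 - c <= 1 + s * dot n v.
Proof.
move=> n1 vc; have : `|s * dot n v| <= c.
  rewrite normrM s1 mul1r; apply: le_trans (ler_dot _ _) _.
  by rewrite -[leRHS]mul1r ler_pM ?enorm_ge0.
by rewrite ler_norml; lra.
Qed.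

Lemma gradN_bound i n v : enorm n <= 1 -> enorm v <= c -> `|gradN i n v| <= (1 - c)^-1.
Proof.
move=> n1 vc; have h := gradN_den n1 vc; have h0 := lt_le_trans c1 h.
rewrite /gradN normrM normfV (gtr0_norm h0) -[leRHS]mul1r.
apply: ler_pM => //; [by rewrite invr_ge0 ltW|exact: le_trans (ler_coord_enorm _ _) n1|].
by rewrite lef_pV2 ?posrE.
Qed.

(** Both denominators are at least 1 - c, and they differ by at most the sum of the two
    distances. *)
Lemma gradN_lip i n v n' v' : enorm n <= 1 -> enorm v <= c -> enorm n' <= 1 -> enorm v' <= c ->
  `|gradN i n v - gradN i n' v'| <= 2 * (1 - c)^-2 * (enorm (n - n') + enorm (v - v')).
Proof.
move=> n1 vc n'1 v'c; have h := gradN_den n1 vc; have h' := gradN_den n'1 v'c.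
have h0 := lt_le_trans c1 h; have h'0 := lt_le_trans c1 h'.
set E := enorm _ + enorm _; set D := 1 + s * dot n v in h h0; set D' := 1 + s * dot n' v' in h' h'0.
have E0 : 0 <= E by rewrite addr_ge0 ?enorm_ge0.
have DD : `|D' - D| <= E.
  have -> : D' - D = s * (dot (n' - n) v' + dot n (v' - v)).
    by rewrite /D /D' dotBl dotBr; ring.
  rewrite normrM s1 mul1r; apply: le_trans (ler_normD _ _) _; apply: lerD.
    apply: le_trans (ler_dot _ _) _; rewrite enormC ler_piMr ?enorm_ge0//.
    by apply: (le_trans v'c); rewrite -subr_ge0 ltW.
  by apply: le_trans (ler_dot _ _) _; rewrite (enormC v') ler_piMl ?enorm_ge0.
have -> : gradN i n v - gradN i n' v' = (n - n') 0 i / D + (n' 0 i / D') * ((D' - D) / D).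
  rewrite /gradN -/D -/D' mxE [(- n') 0 i]mxE; field.
  by rewrite (gt_eqF h0) (gt_eqF h'0).
have Dinv : D^-1 <= (1 - c)^-1 by rewrite lef_pV2 ?posrE.
have D'inv : D'^-1 <= (1 - c)^-1 by rewrite lef_pV2 ?posrE.
have Dp : 0 <= D^-1 by rewrite invr_ge0 ltW.
have D'p : 0 <= D'^-1 by rewrite invr_ge0 ltW.
have k1 : 1 <= (1 - c)^-1.
  by rewrite invf_ge1// lerBlDr lerDl.
apply: le_trans (ler_normD _ _) _; rewrite !normrM !normfV (gtr0_norm h0) (gtr0_norm h'0).
have ni : `|(n - n') 0 i| <= E.
  by apply: (le_trans (ler_coord_enorm _ _)); rewrite lerDl enorm_ge0.
have n'i : `|n' 0 i| <= 1 by exact: le_trans (ler_coord_enorm _ _) n'1.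
rewrite (_ : 2 * _ * E = E * (1 - c)^-2 + 1 * (1 - c)^-1 * (E * (1 - c)^-1)); last by rewrite -exprVn; ring.
apply: lerD; last by rewrite !ler_pM// mulr_ge0.
apply: ler_pM => //; apply: (le_trans Dinv).
by rewrite -exprVn expr2 ler_peMl// invr_ge0 ltW.
Qed.

End RetardedGradient.

Section DerivableGradient.
Context {R : realType}.
Implicit Types (f g : 'rV[R]_3 -> R) (x v : 'rV[R]_3).

Lemma derivable_add f g x v : derivable f x v -> derivable g x v ->
  derivable (fun y => f y + g y) x v.
Proof. exact: derivableD. Qed.

Lemma derivable_mul f g x v : derivable f x v -> derivable g x v ->
  derivable (fun y => f y * g y) x v.
Proof. exact: derivableM. Qed.

Lemma derivable_inv f x v : f x != 0 -> derivable f x v ->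
  derivable (fun y => (f y)^-1) x v.
Proof. exact: derivableV. Qed.

Lemma derivable_comp (h : R -> R) f x v : derivable h (f x) 1 -> derivable f x v ->
  derivable (fun y => h (f y)) x v.
Proof. by move=> /derivableP dh /derivableP df; have [] := is_derive_comp dh df. Qed.

Lemma derivable_coord x v k : derivable (fun y : 'rV[R]_3 => y 0 k) x v.
Proof.
have /derivable_mxP/(_ 0 k) : derivable (@id 'rV[R]_3) x v by [].
by [].
Qed.

Variables (s c t : R) (Z V : R -> 'rV[R]_3).
Hypotheses (s1 : `|s| = 1) (c01 : 0 <= c < 1)
  (Zc : forall u u', enorm (Z u - Z u') <= c * `|u - u'|)
  (Vc : forall u, enorm (V u) <= c).
Local Notation u := (deviating_time s Z t).

Lemma gradN_derive x j : x != Z t ->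
  (forall k, is_derive (u x) 1 (fun r => Z r 0 k) (V (u x) 0 k)) ->
  is_derive x (axis j) (delay s Z t) (gradN s j (nhat s Z t x) (V (u x))).
Proof. by move=> xZ dZ; exact: (delay_derive s1 c01 Zc j xZ dZ (Vc _)). Qed.

(** Only existence is recorded: the size of the second derivatives comes from the weighted Lipschitz
    bound on the gradient. *)
Lemma gradN_derivable x i j : x != Z t ->
  (forall k, is_derive (u x) 1 (fun r => Z r 0 k) (V (u x) 0 k)) ->
  (forall k, derivable (fun r => V r 0 k) (u x) 1) ->
  derivable (fun y => gradN s i (nhat s Z t y) (V (u y))) x (axis j).
Proof.
move=> xZ dZ dV.
have [dphi _] := gradN_derive j xZ dZ.
have dcst (a : R) : derivable (fun=> a) x (axis j) by exact: derivable_cst.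
have du : derivable u x (axis j).
  exact: (derivable_add (dcst t) (derivable_mul (dcst s) dphi)).
have dZu k : derivable (fun y => Z (u y) 0 k) x (axis j).
  apply: (@derivable_comp (fun r => Z r 0 k) u) => //; by case: (dZ k).
have dVu k : derivable (fun y => V (u y) 0 k) x (axis j).
  exact: (@derivable_comp (fun r => V r 0 k) u).
have p0 : delay s Z t x != 0 by rewrite gt_eqF// (delay_gt0 s1 c01 Zc).
have dn k : derivable (fun y => nhat s Z t y 0 k) x (axis j).
  have -> : (fun y => nhat s Z t y 0 k) =
      fun y => (delay s Z t y)^-1 * (y 0 k + -1 * Z (u y) 0 k).
    by apply/funext => y; rewrite (nhatE t s1 c01 Zc) !mxE mulN1r.
  apply: derivable_mul; first exact: derivable_inv.
  apply: derivable_add; first exact: derivable_coord.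
  exact: (derivable_mul (dcst (-1)) (dZu k)).
rewrite /gradN; apply: derivable_mul => //; apply: derivable_inv.
  apply: lt0r_neq0; apply: lt_le_trans (gradN_den s1 (enorm_nhat_le1 _ _ _ _) (Vc _)).
  by case/andP: c01 => _; rewrite subr_gt0.
apply: (derivable_add (dcst 1)); apply: (derivable_mul (dcst s)).
have -> : (fun y => dot (nhat s Z t y) (V (u y))) = fun y =>
   nhat s Z t y 0 i0 * V (u y) 0 i0 + nhat s Z t y 0 i1 * V (u y) 0 i1 + nhat s Z t y 0 i2 * V (u y) 0 i2.
  by apply/funext => y; rewrite dotE.
have dm k := derivable_mul (dn k) (dVu k).
exact: (derivable_add (derivable_add (dm i0) (dm i1)) (dm i2)).
Qed.

End DerivableGradient.

(** * Difference of two delay functions *)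

Section DelayDifference.
Context {R : realType}.
(** [B] stands for the breaking times, [S] for a countable set off which trajectories and velocities
    are derivable. [VX] and [VY] are everywhere defined velocities that may jump on [B], but by [wL]
    their difference does not. *)
Variables (s c a0 t : R) (X Y VX VY : R -> 'rV[R]_3) (B S : set R).
Hypotheses (s1 : s = 1 \/ s = -1) (c01 : 0 <= c < 1) (a00 : 0 <= a0)
  (Xc : forall u u', enorm (X u - X u') <= c * `|u - u'|)
  (Yc : forall u u', enorm (Y u - Y u') <= c * `|u - u'|)
  (VXc : forall u, enorm (VX u) <= c) (VYc : forall u, enorm (VY u) <= c)
  (VXB : forall a b, a <= b -> (forall u, B u -> ~ (a < u <= b)) ->
    enorm (VX a - VX b) <= a0 * `|a - b|)
  (wL : forall u u', enorm ((VY u - VX u) - (VY u' - VX u')) <= a0 * `|u - u'|)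
  (wB : forall u, B u -> VY u = VX u) (XYB : forall u, B u -> X u = Y u)
  (cS : countable S)
  (dX : forall u, ~ S u -> forall k, is_derive u 1 (fun u => X u 0 k) (VX u 0 k))
  (dY : forall u, ~ S u -> forall k, is_derive u 1 (fun u => Y u 0 k) (VY u 0 k))
  (dVX : forall u, ~ S u -> forall k, derivable (fun u => VX u 0 k) u 1)
  (dVY : forall u, ~ S u -> forall k, derivable (fun u => VY u 0 k) u 1).
Variable A : seq 'rV[R]_3.
Hypotheses (XA : X t \in A) (YA : Y t \in A).
Implicit Types (x y z : 'rV[R]_3).

Let abs_s : `|s| = 1.
Proof. by case: s1 => ->; rewrite ?normrN normr1. Qed.
Let ss : s * s = 1.
Proof. by case: s1 => ->; rewrite ?mulrNN mulr1. Qed.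
Let c0 : 0 <= c. Proof. by case/andP: c01. Qed.
Let c1 : 0 < 1 - c. Proof. by case/andP: c01 => _; rewrite subr_gt0. Qed.

Local Notation phiX := (delay s X t).
Local Notation phiY := (delay s Y t).
Local Notation uX := (deviating_time s X t).
Local Notation uY := (deviating_time s Y t).
Local Notation nX := (nhat s X t).
Local Notation nY := (nhat s Y t).
Local Notation N := (gradN s).
Local Notation g := (fun (i : 'I_3) x => N i (nX x) (VX (uX x)) - N i (nY x) (VY (uY x))).
Local Notation w := (fun u => VY u - VX u).

Let L := (1 - c)^-1.
Let L0 : 0 < L. Proof. by rewrite invr_gt0. Qed.

Lemma delay_le_agree x d : X (t + s * d) = Y (t + s * d) ->
  (phiX x <= d) = (phiY x <= d).
Proof.
move=> XYd; have [d0|d0] := leP 0 d.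
  by rewrite (delay_leP t abs_s c01 Xc)// (delay_leP t abs_s c01 Yc)// XYd.
rewrite leNgt (lt_le_trans d0) ?(delay_ge0 t abs_s c01 Xc)//=.
by rewrite leNgt (lt_le_trans d0) ?(delay_ge0 t abs_s c01 Yc).
Qed.

Lemma delay_eq_agree x d : X (t + s * d) = Y (t + s * d) -> phiX x = d -> phiY x = d.
Proof.
move=> XYd pd; apply: (delay_uniq abs_s c01 Yc).
  by rewrite -pd; exact: delay_ge0 t abs_s c01 Xc x.
by rewrite -XYd -pd; exact: delayE t abs_s c01 Xc x.
Qed.

Lemma delay_lt_agree x d : X (t + s * d) = Y (t + s * d) ->
  (phiX x < d) = (phiY x < d).
Proof.
move=> XYd; rewrite !lt_neqAle delay_le_agree//; congr (~~ _ && _).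
apply/eqP/eqP; first exact: delay_eq_agree.
move=> pd; apply: (delay_uniq abs_s c01 Xc).
  by rewrite -pd; exact: delay_ge0 t abs_s c01 Yc x.
by rewrite XYd -pd; exact: delayE t abs_s c01 Yc x.
Qed.

Lemma XY_break b : B b -> X (t + s * (s * (b - t))) = Y (t + s * (s * (b - t))).
Proof. by move=> Bb; rewrite mulrA ss mul1r addrC subrK XYB. Qed.

(** The trajectories share the event at [b], hence its light cone, so x is on the same side of it
    for both. For s = -1 the order of deviating times is opposite to that of delays, which calls for
    [delay_le_agree]. *)
Lemma tdev_lt_agree x b : B b -> (uX x < b) = (uY x < b).
Proof.
move=> /XY_break XYd; rewrite /deviating_time -!ltrBrDl.
have -> : b - t = s * (s * (b - t)) by rewrite mulrA ss mul1r.
case: s1 => es.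
  have s0 : 0 < s by rewrite es.
  by rewrite !(ltr_pM2l s0) delay_lt_agree.
have s0 : s < 0 by rewrite es oppr_lt0.
by rewrite !(ltr_nM2l s0) !ltNge delay_le_agree.
Qed.

Lemma tdev_break z b : B b -> uX z = b ->
  [/\ uY z = b, phiX z = phiY z & nX z = nY z].
Proof.
move=> Bb uz; have XYd := XY_break Bb.
have pz : phiX z = s * (b - t) by rewrite -uz /deviating_time addrC addKr mulrA ss mul1r.
have pY := delay_eq_agree XYd pz.
have uYz : uY z = b by rewrite /deviating_time pY mulrA ss mul1r addrC subrK.
by split; rewrite ?pY// (nhatE t abs_s c01 Xc) (nhatE t abs_s c01 Yc) pz pY uYz uz XYB.
Qed.

Let nX1 x : enorm (nX x) <= 1. Proof. exact: enorm_nhat_le1. Qed.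
Let nY1 x : enorm (nY x) <= 1. Proof. exact: enorm_nhat_le1. Qed.

(** Measures the disagreement of the data entering the two gradients. The velocity of [X], which
    jumps, does not occur alone: only the Lipschitz difference [w] does. *)
Definition gap x := enorm (nX x - nY x) + `|uX x - uY x| + enorm (w (uY x)).

Lemma gap_break z b : B b -> uX z = b -> gap z = 0.
Proof.
move=> Bb uz; have [uYz _ nz] := tdev_break Bb uz.
by rewrite /gap nz uYz uz wB// !subrr normr0 enorm0 !addr0.
Qed.

Lemma no_break_VX a b : (forall u, B u -> ~ (a < u <= b) /\ ~ (b < u <= a)) ->
  enorm (VX a - VX b) <= a0 * `|a - b|.
Proof.
move=> nb; have [ab|/ltW ba] := leP a b.
  by apply: VXB => // u /nb[].
by rewrite enormC distrC; apply: VXB => // u /nb[].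
Qed.

(** By [tdev_lt_agree] no breaking time separates [uX x] from [uY x], so the velocities of [X] at
    these two times are Lipschitz close; what remains is [w]. *)
Lemma grad_le_gap : exists2 K, 0 <= K & forall i x, `|g i x| <= K * gap x.
Proof.
pose K1 := 2 * (1 - c)^-2.
have K10 : 0 <= K1 by rewrite mulr_ge0// invr_ge0 sqr_ge0.
exists (K1 * (1 + a0)); first by rewrite mulr_ge0// addr_ge0.
move=> i x; apply: le_trans (gradN_lip abs_s c01 i (nX1 _) (VXc _) (nY1 _) (VYc _)) _.
rewrite -/K1 -(mulrA K1); apply: ler_wpM2l => //.
have h1 : enorm (VX (uX x) - VX (uY x)) <= a0 * `|uX x - uY x|.
  apply: no_break_VX => u Bu; have e := tdev_lt_agree x Bu.
  by split=> /andP[]; rewrite ?e leNgt -?e => ->.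
have h2 : enorm (VX (uX x) - VY (uY x)) <= a0 * `|uX x - uY x| + enorm (w (uY x)).
  apply: le_trans (ler_enorm_distD (VX (uY x)) _ _) _.
  by rewrite (enormC _ (VY _)) lerD.
rewrite /gap.
have h3 := mulr_ge0 a00 (enorm_ge0 (nX x - nY x)).
have h4 := mulr_ge0 a00 (enorm_ge0 (w (uY x))).
have := normr_ge0 (uX x - uY x).
by lra.
Qed.

(** Valid across breaking cones too: directions, deviating times and [w] are all insensitive to the
    jumps. *)
Lemma gap_klip : exists2 K, 0 <= K & forall x y, x \notin A ->
  `|gap x - gap y| <= K * wt A x * enorm (x - y).
Proof.
have [CX CX0 hX] := nhat_klip abs_s c01 Xc XA.
have [CY CY0 hY] := nhat_klip abs_s c01 Yc YA.
exists (CX + CY + L + L + a0 * L).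
  by rewrite !addr_ge0 ?mulr_ge0// ltW.
move=> x y xA.
have w1 := wt_ge1 A x; have e0 := enorm_ge0 (x - y).
have uXl : `|uX x - uX y| <= L * enorm (x - y).
  by rewrite (tdev_dist X t abs_s); exact: delay_lip t abs_s c01 Xc x y.
have uYl : `|uY x - uY y| <= L * enorm (x - y).
  by rewrite (tdev_dist Y t abs_s); exact: delay_lip t abs_s c01 Yc x y.
have le_wt (a : R) : 0 <= a -> a * enorm (x - y) <= a * wt A x * enorm (x - y).
  by move=> ap; rewrite -mulrA ler_wpM2l// ler_peMl.
have h1 : `|enorm (nX x - nY x) - enorm (nX y - nY y)| <= (CX + CY) * wt A x * enorm (x - y).
  apply: le_trans (ler_enorm_dist _ _) _.
  have -> : nX x - nY x - (nX y - nY y) = (nX x - nX y) - (nY x - nY y).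
    by rewrite !opprB addrACA [in RHS]addrACA (addrC (- nX y)).
  apply: le_trans (ler_enormB _ _) _; rewrite !mulrDl.
  by apply: lerD; [exact: hX|exact: hY].
have h2 : `| `|uX x - uY x| - `|uX y - uY y| | <= (L + L) * wt A x * enorm (x - y).
  apply: le_trans (ler_dist_dist _ _) _.
  rewrite (_ : _ - _ = (uX x - uX y) - (uY x - uY y)); last first.
    by move: (uX x) (uY x) (uX y) (uY y) => p q p' q'; ring.
  apply: le_trans (ler_normB _ _) _; apply: le_trans (le_wt _ (addr_ge0 (ltW L0) (ltW L0))).
  by rewrite mulrDl; exact: lerD.
have h3 : `|enorm (w (uY x)) - enorm (w (uY y))| <= a0 * L * wt A x * enorm (x - y).
  apply: le_trans (ler_enorm_dist _ _) _; apply: le_trans (wL _ _) _.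
  apply: le_trans (le_wt _ (mulr_ge0 a00 (ltW L0))).
  by rewrite -mulrA ler_wpM2l.
have dist3 (p q r p' q' r' : R) : p + q + r - (p' + q' + r') = (p - p') + (q - q') + (r - r').
  by ring.
have sum3 (p q r W D : R) : (p + q + r) * W * D = p * W * D + q * W * D + r * W * D by ring.
rewrite /gap dist3 -(addrA (CX + CY)) sum3.
apply: le_trans (ler_normD _ _) _; apply: lerD h3.
by apply: le_trans (ler_normD _ _) _; exact: lerD.
Qed.

(** The deviating time is continuous along the segment from x to y, hence takes the value [b] on
    it. *)
Lemma segment_break x y b : (uX x < b <= uX y) \/ (uX y < b <= uX x) ->
  exists z, uX z = b /\ enorm (x - z) <= enorm (x - y).
Proof.
move=> bb; pose f (r : R) := uX (r *: (y - x) + x).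
have fc : {within `[0, 1], continuous f}.
  apply: continuous_subspaceT => r; apply/cvgrPdist_lt => e e0.
  have K0 : 0 < L * enorm (y - x) + 1 by rewrite ltr_wpDl// mulr_ge0 ?enorm_ge0// ltW.
  apply/nbhs_ballP; exists (e / (L * enorm (y - x) + 1)) => [|r' /= rr'].
    by rewrite /= divr_gt0.
  rewrite /f (tdev_dist X t abs_s); apply: le_lt_trans (delay_lip t abs_s c01 Xc _ _) _.
  rewrite opprD addrACA subrr addr0 -scalerBl enormZ -/L.
  move: rr'; rewrite /ball /= ltr_pdivlMr// => rr'.
  by have := normr_ge0 (r - r'); have := enorm_ge0 (y - x); nra.
have f0 : f 0 = uX x by rewrite /f scale0r add0r.
have f1 : f 1 = uX y by rewrite /f scale1r subrK.
have [|r] := IVT (ler01 : 0 <= 1 :> R) fc (v := b).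
  by rewrite f0 f1 ge_min le_max; case: bb => /andP[/ltW -> ->]; rewrite ?orbT.
rewrite in_itv/= => /andP[r0 r1] fr; exists (r *: (y - x) + x); split => //.
rewrite opprD addrC subrK enormN enormZ ger0_norm// (enormC x).
by rewrite ler_piMl ?enorm_ge0.
Qed.

(** If a breaking time separates x and y, both values are small because [gap] vanishes at a point
    between them; otherwise each velocity is Lipschitz between its two deviating times, and the two
    gradients are estimated separately. *)
Lemma grad_klip i : klip A (g i).
Proof.
have [K K0 gK] := grad_le_gap; have [E E0 hE] := gap_klip.
have [CX CX0 hX] := nhat_klip abs_s c01 Xc XA.
have [CY CY0 hY] := nhat_klip abs_s c01 Yc YA.
pose K1 := 2 * (1 - c)^-2.
have K10 : 0 <= K1 by rewrite mulr_ge0// invr_ge0 sqr_ge0.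
pose C1 := K1 * (CX + CY + 3 * (a0 * L)).
have a0L : 0 <= a0 * L by rewrite mulr_ge0// ltW.
have C10 : 0 <= C1 by rewrite mulr_ge0// !addr_ge0// mulr_ge0.
exists (C1 + 3 * (K * E)); first by rewrite addr_ge0// !mulr_ge0.
move=> x y xA; have w1 := wt_ge1 A x; have e0 := enorm_ge0 (x - y).
have W0 : 0 <= wt A x * enorm (x - y) by rewrite mulr_ge0// ltW// wt_gt0.
rewrite -mulrA mulrDl.
have [[b [Bb bb]]|nb] := pselect (exists b, B b /\
    ((uX x < b <= uX y) \/ (uX y < b <= uX x))).
  have [z [uz xz]] := segment_break bb.
  have gz := gap_break Bb uz.
  have Kxz : wt A x * enorm (x - z) <= wt A x * enorm (x - y).
    by rewrite ler_wpM2l// ltW// wt_gt0.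
  have hx : gap x <= E * (wt A x * enorm (x - y)).
    have := hE x z xA; rewrite gz subr0 => /(le_trans (ler_norm _)).
    by move/le_trans; apply; rewrite -mulrA ler_wpM2l.
  (* The bound at y passes through x, where the weight must be taken; this doubles it and yields the
     factor 3 in the total. *)
  have hy : gap y <= 2 * (E * (wt A x * enorm (x - y))).
    have := hE x y xA; rewrite -mulrA ler_norml; move: hx.
    by move: (gap x) (gap y) (E * _) => p q r; lra.
  apply: le_trans (ler_normB _ _) _.
  have gx := le_trans (gK i x) (ler_wpM2l K0 hx).
  have gy := le_trans (gK i y) (ler_wpM2l K0 hy).
  have h0 : 0 <= C1 * (wt A x * enorm (x - y)) by rewrite mulr_ge0.
  apply: le_trans (lerD gx gy) _.
  rewrite (_ : 3 * (K * E) * _ = K * (E * (wt A x * enorm (x - y))) +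
    K * (2 * (E * (wt A x * enorm (x - y))))).
    by rewrite lerDr.
  by move: (wt A x * _) => r; ring.
have nbX u : B u -> ~ (uX x < u <= uX y) /\ ~ (uX y < u <= uX x).
  by move=> Bu; split=> h; apply: nb; exists u; split => //; [left|right].
have nbY u : B u -> ~ (uY x < u <= uY y) /\ ~ (uY y < u <= uY x).
  move=> Bu; have [h1 h2] := nbX _ Bu.
  have ex := tdev_lt_agree x Bu; have ey := tdev_lt_agree y Bu.
  split=> /andP[p q]; [apply: h1|apply: h2]; apply/andP; split.
  - by rewrite ex.
  - by rewrite leNgt ey -leNgt.
  - by rewrite ey.
  - by rewrite leNgt ex -leNgt.
have uXl : `|uX x - uX y| <= L * enorm (x - y).
  by rewrite (tdev_dist X t abs_s); exact: delay_lip t abs_s c01 Xc x y.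
have uYl : `|uY x - uY y| <= L * enorm (x - y).
  by rewrite (tdev_dist Y t abs_s); exact: delay_lip t abs_s c01 Yc x y.
have le_wt (a : R) : 0 <= a -> a * enorm (x - y) <= a * (wt A x * enorm (x - y)).
  by move=> ap; rewrite ler_wpM2l// ler_peMl.
have vX : enorm (VX (uX x) - VX (uX y)) <= a0 * L * (wt A x * enorm (x - y)).
  apply: le_trans (no_break_VX nbX) _; apply: le_trans (le_wt _ a0L).
  by rewrite -mulrA ler_wpM2l.
(* Between breaking times [VY] inherits the Lipschitz bound of [VX] through [w]. *)
have vY : enorm (VY (uY x) - VY (uY y)) <= 2 * (a0 * L) * (wt A x * enorm (x - y)).
  have -> : VY (uY x) - VY (uY y) = (w (uY x) - w (uY y)) + (VX (uY x) - VX (uY y)).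
    move: (VY (uY x)) (VY (uY y)) (VX (uY x)) (VX (uY y)) => p q p' q'.
    by apply/rowP => k; rewrite !mxE; ring.
  apply: le_trans (ler_enormD _ _) _.
  apply: (@le_trans _ _ (2 * (a0 * L) * enorm (x - y))); last first.
    by apply: le_wt; rewrite mulr_ge0.
  rewrite -mulrA mulr_natl mulr2n lerD//.
    by apply: le_trans (wL _ _) _; rewrite -mulrA ler_wpM2l.
  by apply: le_trans (no_break_VX nbY) _; rewrite -mulrA ler_wpM2l.
have gX := gradN_lip abs_s c01 i (nX1 x) (VXc (uX x)) (nX1 y) (VXc (uX y)).
have gY := gradN_lip abs_s c01 i (nY1 x) (VYc (uY x)) (nY1 y) (VYc (uY y)).
have hX' := hX x y xA; have hY' := hY x y xA; rewrite -!mulrA in hX' hY'.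
have KE : 0 <= 3 * (K * E) * (wt A x * enorm (x - y)) by rewrite !mulr_ge0// ltW// wt_gt0.
apply: (@le_trans _ _ (C1 * (wt A x * enorm (x - y)))); last by rewrite lerDl.
have dist2 (p q p' q' : R) : p - q - (p' - q') = (p - p') - (q - q') by ring.
rewrite dist2; apply: le_trans (ler_normB _ _) _; apply: le_trans (lerD gX gY) _.
rewrite -/K1 -mulrDr /C1 -mulrA ler_wpM2l//.
move: hX' hY' vX vY; move: (wt A x * enorm (x - y)) => r.
move: (enorm (nX x - _)) (enorm (VX _ - _)) (enorm (nY x - _)) (enorm (VY _ - _)) => p q p' q'.
by lra.
Qed.

Lemma grad_bdd i : bdd (g i).
Proof.
exists ((1 - c)^-1 + (1 - c)^-1) => x; apply: le_trans (ler_normB _ _) _.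
by apply: lerD; apply: (gradN_bound abs_s c01).
Qed.

(** A point with deviating time u lies on the sphere about the position at u of radius
    [s * (u - t)], and [S] is countable. *)
Lemma ae_regular_times : {ae @lebesgue3 R, forall p, [/\ vec3 p != X t, vec3 p != Y t,
  ~ S (uX (vec3 p)) & ~ S (uY (vec3 p))]}.
Proof.
have hA := ae_notin A.
have nS (Z : R -> 'rV[R]_3) : (forall u u', enorm (Z u - Z u') <= c * `|u - u'|) ->
    {ae @lebesgue3 R, forall p, ~ S (deviating_time s Z t (vec3 p))}.
  move=> Zc; apply: negligibleS (negligible_spheres Z (fun u => s * (u - t)) cS).
  move=> p /contrapT Sp; exists (deviating_time s Z t (vec3 p)) => //.
  by rewrite -(delayE t abs_s c01 Zc) /deviating_time addrC addKr mulrA ss mul1r.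
apply: (ae_imp2 hA (ae_imp2 (nS _ Xc) (nS _ Yc) (fun p a b => conj a b))) => p pA [SX SY].
by split => //; apply: contraNneq pA => ->.
Qed.

Lemma good_delay_difference : good A (fun x => phiX x - phiY x).
Proof.
split.
  exists (L + L); first by rewrite addr_ge0// ltW.
  move=> x y; have dist2 (p q p' q' : R) : p - q - (p' - q') = (p - p') - (q - q') by ring.
  rewrite dist2 mulrDl; apply: le_trans (ler_normB _ _) _; apply: lerD.
    exact: delay_lip t abs_s c01 Xc x y.
  exact: delay_lip t abs_s c01 Yc x y.
have tae := ae_regular_times.
exists (fun i => g i) => [i|].
  split; [exact: grad_klip|exact: grad_bdd|].
  apply: (ae_imp tae) => p [pX pY SX SY] j.
  have h1 := @gradN_derivable _ s c t X VX abs_s c01 Xc VXc (vec3 p) i j pX (dX SX) (dVX SX).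
  have h2 := @gradN_derivable _ s c t Y VY abs_s c01 Yc VYc (vec3 p) i j pY (dY SY) (dVY SY).
  exact: derivableB.
apply: (ae_imp tae) => p [pX pY SX SY] j.
have h1 := @gradN_derive _ s c t X VX abs_s c01 Xc VXc (vec3 p) j pX (dX SX).
have h2 := @gradN_derive _ s c t Y VY abs_s c01 Yc VYc (vec3 p) j pY (dY SY).
exact: is_deriveB.
Qed.

End DelayDifference.

(** * The radial variable, and boundedness of delay differences *)

Section Radial.
Context {R : realType}.
Implicit Types (A : seq 'rV[R]_3) (x : 'rV[R]_3).

(* [|x|] is the delay function of the trajectory at rest at the origin. *)
Lemma good_enorm A : 0 \in A -> good A (@enorm R).
Proof.
move=> A0; pose Z : R -> 'rV[R]_3 := fun=> 0.
have s1 : `|1 : R| = 1 by rewrite normr1.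
have c01 : 0 <= (0 : R) < 1 by rewrite lexx ltr01.
have Zc u u' : enorm (Z u - Z u') <= 0 * `|u - u'| by rewrite subrr enorm0 mul0r.
have Vc u : enorm (Z u) <= 0 by rewrite enorm0.
have dE : delay 1 Z 0 = @enorm R.
  apply/funext => x; apply: (delay_uniq s1 c01 Zc); first exact: enorm_ge0.
  by rewrite subr0.
have n1 x : enorm (nhat 1 Z 0 x) <= 1 by exact: enorm_nhat_le1.
have gE i x : gradN 1 i (nhat 1 Z 0 x) 0 = nhat 1 Z 0 x 0 i.
  by rewrite /gradN dotC -(scale0r (0 : 'rV[R]_3)) dotZl mul0r mulr0 addr0 divr1.
have tae : {ae @lebesgue3 R, forall p, vec3 p != Z 0}.
  by apply: (ae_imp (ae_notin A)) => p; apply: contraNneq => ->.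
split.
  by exists 1 => // x y; rewrite mul1r; exact: ler_enorm_dist.
exists (fun i x => gradN 1 i (nhat 1 Z 0 x) 0) => [i|]; last first.
  apply: (ae_imp tae) => p p0 i; rewrite -[X in is_derive _ _ X _]dE.
  apply: (@gradN_derive _ 1 0 0 Z Z s1 c01 Zc Vc (vec3 p) i p0) => k.
  by under eq_fun do rewrite mxE; rewrite mxE; exact: is_derive_cst.
split.
- have [C C0 hC] := nhat_klip s1 c01 Zc (A0 : Z 0 \in A).
  exists C => // x y xA; rewrite !gE; apply: le_trans (hC x y xA).
  by have := ler_coord_enorm (nhat 1 Z 0 x - nhat 1 Z 0 y) i; rewrite !mxE.
- by exists 1 => x; rewrite gE; apply: le_trans (ler_coord_enorm _ _) (n1 x).
- apply: (ae_imp tae) => p p0 j.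
  apply: (@gradN_derivable _ 1 0 0 Z Z s1 c01 Zc Vc (vec3 p) i j p0) => k.
    by under eq_fun do rewrite mxE; rewrite mxE; exact: is_derive_cst.
  by under eq_fun do rewrite mxE; exact: derivable_cst.
Qed.

(** Each delay grows like |x|, but both are distances from x to bounded trajectories, so they differ
    at most by the distance between two such positions. *)
Lemma bdd_delay_difference (s c t : R) (X Y : R -> 'rV[R]_3) : `|s| = 1 -> 0 <= c < 1 ->
  (forall u u', enorm (X u - X u') <= c * `|u - u'|) ->
  (forall u u', enorm (Y u - Y u') <= c * `|u - u'|) ->
  bounded_map X -> bounded_map Y -> bdd (fun x => delay s X t x - delay s Y t x).
Proof.
move=> s1 c01 Xc Yc [M XM] [K YK]; exists (M + K) => x.
rewrite (delayE t s1 c01 Xc x) (delayE t s1 c01 Yc x).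
apply: le_trans (ler_enorm_dist _ _) _.
move: (deviating_time s X t x) (deviating_time s Y t x) => u u'.
rewrite (_ : _ - _ = Y u' - X u); last by rewrite opprB addrC addrA subrK.
by apply: le_trans (ler_enormB _ _) _; rewrite addrC lerD.
Qed.

End Radial.

(** * Mean value inequalities for vector functions with isolated kinks *)

Section PiecewiseLipschitz.
Context {R : realType}.
Implicit Types (F : R -> 'rV[R]_3) (w : 'rV[R]_3).

Lemma continuous_dot w : continuous (dot w).
Proof.
move=> x; apply: (iffRL (@cvgrPdist_lt _ _ _ (nbhs x) _ _ _)) => e e0.
have K0 : 0 < enorm w + 1 by rewrite ltr_wpDl// enorm_ge0.
apply/nbhs_enormP; exists (e / (enorm w + 1)); first by rewrite divr_gt0.
move=> v; rewrite ltr_pdivlMr// -dotBr => xv; apply: le_lt_trans (ler_dot _ _) _.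
by have := enorm_ge0 (x - v); nra.
Qed.

Lemma cvg_dot (T : Type) (G : set_system T) (F : T -> 'rV[R]_3) w l : Filter G ->
  F @ G --> l -> dot w (F x) @[x --> G] --> dot w l.
Proof. by move=> FG Fl; exact: (continuous_cvg _ (@continuous_dot w l) Fl). Qed.

Lemma is_derive_dot F w u : derivable F u 1 ->
  is_derive u 1 (fun r => dot w (F r)) (dot w (derive1 F u)).
Proof.
move=> dF.
have h : (fun h : R => h^-1 *: (dot w (F (h *: 1 + u)) - dot w (F u))) @ 0^' --> dot w ('D_1 F u).
  have -> : (fun h : R => h^-1 *: (dot w (F (h *: 1 + u)) - dot w (F u))) =
      fun h => dot w (h^-1 *: (F (h *: 1 + u) - F u)).
    by apply/funext => h; rewrite dotZr dotBr.
  exact: cvg_dot.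
rewrite derive1E; apply: DeriveDef; first by apply/cvg_ex; eexists; exact: h.
exact: cvg_lim h.
Qed.

(** The scalar mean value theorem for the projection on F b - F a, whose increment is |F b - F
    a|^2. *)
Lemma mean_value_enorm F (a b C : R) : a < b ->
  (forall u, a < u < b -> derivable F u 1 /\ enorm (derive1 F u) <= C) ->
  F @ a^'+ --> F a -> F @ b^'- --> F b -> enorm (F b - F a) <= C * (b - a).
Proof.
move=> ab dF Fa Fb; pose w := F b - F a.
have dw u : a < u < b -> is_derive u 1 (fun r => dot w (F r)) (dot w (derive1 F u)).
  by move=> /dF[+ _]; exact: is_derive_dot.
have dw' u : u \in `]a, b[ -> is_derive u 1 (fun r => dot w (F r)) (dot w (derive1 F u)).
  by rewrite in_itv/=; exact: dw.
have [|u] := MVT ab dw'.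
  apply/(continuous_within_itvP _ ab); split.
  - move=> u; rewrite in_itv/= => /dw[du _].
    by apply: differentiable_continuous; apply/derivable1_diffP.
  - exact: cvg_dot.
  - exact: cvg_dot.
rewrite in_itv/= => uab; rewrite -dotBr -/w -sqr_enorm => e.
have [_ hC] := dF _ uab.
have ba : 0 < b - a by rewrite subr_gt0.
have [w0|w0] := eqVneq (enorm w) 0.
  rewrite w0; apply: mulr_ge0 (ltW ba); exact: le_trans (enorm_ge0 _) hC.
have wp : 0 < enorm w by rewrite lt_def w0 enorm_ge0.
rewrite -(ler_pM2l wp) -expr2 e mulrA ler_wpM2r ?(ltW ba)//.
apply: le_trans (ler_norm _) _; apply: le_trans (ler_dot _ _) _.
by rewrite ler_wpM2l// enorm_ge0.
Qed.

(* Real induction on [a, b]: near each point the mean value inequality applies on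
   both sides. *)
Lemma piecewise_lipschitz F (a b C : R) : a <= b -> 0 <= C ->
  (forall t, \forall u \near t^', derivable F u 1 /\ enorm (derive1 F u) <= C) ->
  (forall t, a <= t < b -> F @ t^'+ --> F t) ->
  (forall t, a < t <= b -> F @ t^'- --> F t) ->
  enorm (F b - F a) <= C * (b - a).
Proof.
move=> ab C0 dF Fr Fl.
have reg t : exists2 d, 0 < d & forall u, u != t -> `|t - u| < d ->
    derivable F u 1 /\ enorm (derive1 F u) <= C.
  have [d /= d0 hd] := dF t; exists d => // u ut tu; exact: hd.
have sub_cvgr t r : a <= t < r -> r <= b -> F @ t^'+ --> F t.
  by move=> /andP[at_ tr] rb; apply: Fr; rewrite at_ (lt_le_trans tr).
have sub_cvgl t r : a <= r < t -> t <= b -> F @ t^'- --> F t.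
  by move=> /andP[ar rt] tb; apply: Fl; rewrite tb (le_lt_trans ar).
(* The inequality is required on all of [a, r], so that it holds at every point below the
   supremum. *)
pose S := [set r | a <= r <= b /\ forall r', a <= r' <= r -> enorm (F r' - F a) <= C * (r' - a)].
have Sa : S a.
  split; first by rewrite lexx.
  by move=> r' /le_anti <-; rewrite !subrr enorm0 mulr0.
have Sub : ubound S b by move=> r [/andP[]].
have Ssup : has_sup S by split; [exists a|exists b].
set m := sup S.
have am : a <= m by apply: sup_upper_bound.
have mb : m <= b by apply: sup_le_ub => //; exists a.
have Sdown r : a <= r < m -> enorm (F r - F a) <= C * (r - a).
  move=> /andP[ar rm]; have m0 : 0 < m - r by rewrite subr_gt0.
  have [r' [Sr' hr'] rr'] := sup_adherent m0 Ssup.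
  by apply: hr'; rewrite ar; rewrite subKr in rr'; exact: ltW.
have [d d0 hd] := reg m.
have Fm : enorm (F m - F a) <= C * (m - a).
  have [->|am'] := eqVneq m a; first by rewrite !subrr enorm0 mulr0.
  have {}am' : a < m by rewrite lt_def am'.
  pose r := Num.max a (m - d / 2).
  have ar : a <= r by rewrite le_max lexx.
  have rm : r < m by rewrite gt_max am' ltrBlDr ltrDl divr_gt0.
  have rd : m - d / 2 <= r by rewrite le_max lexx orbT.
  have : enorm (F m - F r) <= C * (m - r).
    apply: mean_value_enorm => //.
    - move=> u /andP[ru um]; apply: hd; first by rewrite lt_eqF.
      by rewrite gtr0_norm ?subr_gt0//; lra.
    - by apply: (@sub_cvgr _ m) => //; rewrite ar.
    - by apply: (@sub_cvgl _ r) => //; rewrite ar.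
  have := Sdown r; rewrite ar rm => /(_ isT).
  have := ler_enorm_distD (F r) (F m) (F a); lra.
have [mb'|bm] := ltP m b; last first.
  by have <- : m = b by apply/eqP; rewrite eq_le mb.
pose r := Num.min b (m + d / 2).
have rb : r <= b by rewrite ge_min lexx.
have mr : m < r by rewrite lt_min mb' ltrDl divr_gt0.
have rd : r <= m + d / 2 by rewrite ge_min lexx orbT.
suff Sr : S r by have := sup_upper_bound Ssup Sr; rewrite -/m leNgt mr.
split; first by rewrite rb (le_trans am) ?ltW.
move=> r' /andP[ar' r'r].
have [r'm|mr'] := ltP r' m; first by apply: Sdown; rewrite ar'.
have [->//|mr''] := eqVneq r' m.
have {mr' mr''} mr' : m < r' by rewrite lt_def mr''.
have : enorm (F r' - F m) <= C * (r' - m).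
  apply: mean_value_enorm => //.
  - move=> u /andP[mu ur']; apply: hd; first by rewrite gt_eqF.
    by rewrite ltr0_norm ?subr_lt0//; lra.
  - by apply: (@sub_cvgr _ r'); rewrite ?am//; exact: le_trans r'r rb.
  - by apply: (@sub_cvgl _ m); rewrite ?am//; exact: le_trans r'r rb.
have := ler_enorm_distD (F m) (F r') (F a); lra.
Qed.

End PiecewiseLipschitz.

(** * Piecewise smooth trajectories *)

Section Trajectory.
Context {R : realType}.
Variables (Z : R -> 'rV[R]_3) (T : R).
Hypotheses (Zcont : continuous Z) (ZC2 : piecewise_C2 Z) (T0 : 0 < T)
  (ZT : Defs.periodic T Z) (Zlt : velocities_lt1 Z).

Lemma near_C2 t : \forall u \near t^', C2_at Z u.
Proof.
have [fin _] := ZC2.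
pose F := [set u | t - 1 <= u <= t + 1 /\ ~ C2_at Z u] `\ t.
have Fc : closed F.
  apply: (iffLR (@accessible_finite_set_closed R)); first exact/hausdorff_accessible/Rhausdorff.
  by apply: finite_setD; exact: fin.
have Ft : nbhs t (~` F).
  by apply: open_nbhs_nbhs; split; [exact: closed_openC|case=> _; apply].
have near1 : nbhs t [set u | t - 1 <= u <= t + 1].
  apply/nbhs_ballP; exists 1 => //= u; rewrite /ball/= ltr_norml => /andP[]; lra.
apply: filterS (filterI near1 Ft) => u [u1 nF] ut.
apply: contrapT => nC; apply: nF; split=> //.
by move=> e; rewrite e eqxx in ut.
Qed.

Lemma C2_derivable u : C2_at Z u -> derivable Z u 1 /\ derivable (vel Z) u 1.
Proof. by move=> /nbhs_singleton[]. Qed.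

Lemma C2_near u : C2_at Z u -> \forall v \near u, C2_at Z v.
Proof. by move=> Cu; exact: nbhs_interior. Qed.

Lemma derivable_continuous (F : R -> 'rV[R]_3) u : derivable F u 1 -> {for u, continuous F}.
Proof. by move=> /derivable1_diffP; exact: differentiable_continuous. Qed.

Lemma rvel_continuous u : {for u, continuous (vel Z)} -> rvel Z u = vel Z u.
Proof. by move=> cu; apply: (cvg_lim (@norm_hausdorff _ _)); exact: cvg_at_right_filter. Qed.

Lemma lvel_continuous u : {for u, continuous (vel Z)} -> lvel Z u = vel Z u.
Proof. by move=> cu; apply: (cvg_lim (@norm_hausdorff _ _)); exact: cvg_at_left_filter. Qed.

Lemma rvel_C2 u : C2_at Z u -> rvel Z u = vel Z u.
Proof. by move=> /C2_derivable[_ dV]; exact/rvel_continuous/derivable_continuous. Qed.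

Lemma vel_right t : vel Z @ t^'+ --> rvel Z t.
Proof. have [_ h] := ZC2; have [_ c _ _] := h t; exact: c. Qed.

Lemma vel_left t : vel Z @ t^'- --> lvel Z t.
Proof. have [_ h] := ZC2; have [c _ _ _] := h t; exact: c. Qed.

Lemma at_right_dnbhs (t : R) (P : set R) : (\forall u \near t^', P u) -> \forall u \near t^'+, P u.
Proof. by move=> [d /= d0 hd]; exists d => //= u tu ut; apply: hd => //; rewrite gt_eqF. Qed.

Lemma at_left_dnbhs (t : R) (P : set R) : (\forall u \near t^', P u) -> \forall u \near t^'-, P u.
Proof. by move=> [d /= d0 hd]; exists d => //= u tu ut; apply: hd => //; rewrite lt_eqF. Qed.

(** [rvel] serves as the everywhere defined velocity: it is right-continuous with left limits
    [lvel], and equals [vel] at the C^2 times. *)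
Lemma rvel_right t : rvel Z @ t^'+ --> rvel Z t.
Proof.
apply: cvg_trans (@vel_right t); apply: near_eq_cvg.
by apply: filterS (at_right_dnbhs (near_C2 t)) => u /rvel_C2.
Qed.

Lemma rvel_left t : rvel Z @ t^'- --> lvel Z t.
Proof.
apply: cvg_trans (@vel_left t); apply: near_eq_cvg.
by apply: filterS (at_left_dnbhs (near_C2 t)) => u /rvel_C2.
Qed.

Lemma rvel_derive u : C2_at Z u -> derivable (rvel Z) u 1 /\ derive1 (rvel Z) u = acc Z u.
Proof.
move=> Cu; have eV : {near u, vel Z =1 rvel Z}.
  by apply: filterS (C2_near Cu) => v /rvel_C2.
have [_ dv] := C2_derivable Cu.
split; first exact: near_eq_derivable eV dv.
by rewrite /acc !derive1E; apply: near_eq_derive; apply: filterS eV => v ->.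
Qed.

Lemma lvel_nonbreaking u : ~ breaking_times Z u -> lvel Z u = rvel Z u /\ derivable Z u 1.
Proof.
move=> /contrapT[dZ cv]; split => //.
by rewrite rvel_continuous// lvel_continuous.
Qed.

Lemma near_split (t : R) (P : set R) :
  (\forall u \near t^'-, P u) -> (\forall u \near t^'+, P u) -> P t -> \forall u \near t, P u.
Proof.
move=> [d /= d0 hd] [d' /= d0' hd'] Pt.
apply/nbhs_ballP; exists (Num.min d d') => /=; first by rewrite lt_min d0.
move=> u; rewrite /ball/= lt_min => /andP[ud ud'].
by have [ut|tu|->//] := ltgtP u t; [exact: hd|exact: hd'].
Qed.

(** Conditional on existence, because [vel] and [acc] have meaningless values elsewhere. *)
Definition speed_acc_le (M N u : R) : Prop :=
  (derivable Z u 1 -> enorm (vel Z u) <= M) /\ (derivable (vel Z) u 1 -> enorm (acc Z u) <= N).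

Lemma speed_acc_leW M N M' N' u : M <= M' -> N <= N' -> speed_acc_le M N u -> speed_acc_le M' N' u.
Proof. by move=> MM NN [hM hN]; split=> [/hM|/hN] h; exact: le_trans h _. Qed.

Lemma one_sided_bounds (F : set_system R) (v a : 'rV[R]_3) (M N : R) : Filter F ->
  vel Z @ F --> v -> acc Z @ F --> a -> enorm v < M -> enorm a < N ->
  \forall u \near F, speed_acc_le M N u.
Proof.
move=> FF Fv Fa vM aN.
have cv : enorm (vel Z u) @[u --> F] --> enorm v by exact: (continuous_cvg _ (@continuous_enorm R v) Fv).
have ca : enorm (acc Z u) @[u --> F] --> enorm a by exact: (continuous_cvg _ (@continuous_enorm R a) Fa).
have hv : \forall u \near F, enorm (vel Z u) <= M by exact: (cvgr_le _ cv).
have ha : \forall u \near F, enorm (acc Z u) <= N by exact: (cvgr_le _ ca).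
by apply: filterS2 hv ha => u ? ?; split.
Qed.

Let sum3_bound (p r s : R) : 0 <= p -> 0 <= r -> 0 <= s ->
  [/\ p <= p + r + s + 1, r < p + r + s + 1 & s < p + r + s + 1].
Proof. by move=> p0 r0 s0; split; lra. Qed.

Let between1 (p : R) : p < 1 -> exists2 M, p < M & M < 1.
Proof. by move=> p1; exists ((p + 1) / 2); lra. Qed.

(** Near t the speed is controlled by numbers below 1: the two one-sided limits and, where it
    exists, the velocity at t itself. *)
Lemma local_bounds (t : R) : exists M N : R, M < 1 /\ \forall u \near t, speed_acc_le M N u.
Proof.
have [Zt lt1 rt1] := Zlt t; have [_ /(_ t)[_ _ al ar]] := ZC2.
pose M0 := if pselect (derivable Z t 1) then enorm (vel Z t) else 0.
have M01 : M0 < 1 by rewrite /M0; case: pselect => // /Zt.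
pose m := Num.max M0 (Num.max (enorm (lvel Z t)) (enorm (rvel Z t))).
have m1 : m < 1 by rewrite !gt_max M01 lt1.
pose N := enorm (acc Z t) + enorm (lim (acc Z @ t^'-)) + enorm (lim (acc Z @ t^'+)) + 1.
have [N0 N1 N2] : [/\ enorm (acc Z t) <= N, enorm (lim (acc Z @ t^'-)) < N &
    enorm (lim (acc Z @ t^'+)) < N].
  by apply: sum3_bound; exact: enorm_ge0.
have [M mM M1] : exists2 M, m < M & M < 1 by exact: between1.
exists M, N; split=> //; move: mM; rewrite !gt_max => /andP[M0M /andP[lM rM]].
apply: near_split.
- exact: (@one_sided_bounds (t^'-) _ _ _ _ _ (@vel_left t) al lM N1).
- exact: (@one_sided_bounds (t^'+) _ _ _ _ _ (@vel_right t) ar rM N2).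
- split=> [dZ|_]; last exact: N0.
  apply: le_trans (ltW M0M).
  by rewrite /M0; case: pselect.
Qed.

Lemma derive1_periodic (F : R -> 'rV[R]_3) : Defs.periodic T F ->
  Defs.periodic T (derive1 F) /\ forall u, derivable F (u + T) 1 = derivable F u 1.
Proof.
move=> FT.
have e u : (fun h : R => h^-1 *: (F (h *: 1 + (u + T)) - F (u + T))) =
    fun h => h^-1 *: (F (h *: 1 + u) - F u).
  by apply/funext => h; rewrite addrA !FT.
by split=> u; [rewrite !derive1E /derive|rewrite /derivable]; rewrite e.
Qed.

(** Compactness of a period. One integer n encodes both bounds, speed at most 1 - 1/(n+1) and
    acceleration at most n; both weaken as n grows, so one n serves the whole period. *)
Lemma uniform_bounds : exists c a0 : R, [/\ 0 <= c < 1, 0 <= a0 & forall u, speed_acc_le c a0 u].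
Proof.
pose P (n : nat) u := speed_acc_le (1 - n.+1%:R^-1) n%:R u.
have : compact `[0, T] by exact: segment_compact.
move=> /compact_near_coveringP/(_ nat \oo P _)[].
  move=> t _; have [M [N [M1 hMN]]] := local_bounds t.
  have [m hm] : exists m : nat, M <= 1 - m.+1%:R^-1 /\ N <= m%:R.
    have M0 : 0 < 1 - M by rewrite subr_gt0.
    have m1 := archi_boundP (ltW (etrans (invr_gt0 (1 - M)) M0)); have m2 := archi_boundP (normr_ge0 N).
    set a := Num.bound _ in m1; set b := Num.bound _ in m2.
    exists (a + b)%N; split; last first.
      by apply: (le_trans (ler_norm N)); apply: (le_trans (ltW m2)); rewrite ler_nat leq_addl.
    have h : (a + b).+1%:R^-1 <= 1 - M.
      rewrite -[leRHS]invrK lef_pV2 ?posrE ?ltr0n ?invr_gt0//; apply: (le_trans (ltW m1)).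
      by rewrite ler_nat -addSn leqW// leq_addr.
    by rewrite lerBrDr addrC -lerBrDr.
  exists ([set u | speed_acc_le M N u], [set n | (m <= n)%N]) => /=.
    by split=> //; exists m.
  move=> [u n] /= [hu mn]; apply: speed_acc_leW hu.
    apply: (le_trans hm.1); rewrite lerD2l lerN2 lef_pV2 ?posrE ?ltr0n// ler_nat//.
  by apply: (le_trans hm.2); rewrite ler_nat.
move=> n _ /(_ n (leqnn n)) hn.
exists (1 - n.+1%:R^-1), n%:R; split => //.
  rewrite subr_ge0 invf_le1 ?ltr0n// ler1n/= ltrBlDr ltrDl invr_gt0 ltr0n//.
have [ZdT dZT] := derive1_periodic ZT.
have [ZaT aZT] := derive1_periodic ZdT.
have PT u : P n (u + T) = P n u.
  by rewrite /P /speed_acc_le dZT /vel aZT /acc ZdT ZaT.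
have PTn m u : P n (u + m%:R * T) = P n u.
  elim: m => [|m IH]; first by rewrite mul0r addr0.
  by rewrite -addn1 natrD mulrDl mul1r addrA PT.
move=> u; change (P n u); pose z := Num.floor (u / T).
suff [v [v0 vT <-]] : exists v, [/\ 0 <= v, v <= T & P n v = P n u].
  by apply: hn; rewrite /= in_itv/= v0.
exists (u - z%:~R * T); split.
- by rewrite subr_ge0 -ler_pdivlMr// ?floor_le.
- have := floorD1_gt (u / T); rewrite -/z ltr_pdivrMr//; rewrite intrD mulrDl mul1r; lra.
- case: z => m.
    by rewrite -[in RHS](subrK (m%:R * T) u) PTn.
  by rewrite NegzE mulrNz mulNr opprK PTn.
Qed.

Lemma countable_nonC2 : countable [set u | ~ C2_at Z u].
Proof.
have [fin _] := ZC2.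
have -> : [set u | ~ C2_at Z u] =
    \bigcup_(n : nat) [set u | - n%:R <= u <= n%:R /\ ~ C2_at Z u].
  apply/seteqP; split=> [u Cu|u [n _ []]//].
  exists (Num.bound `|u|) => //; split => //; rewrite -ler_norml.
  by apply/ltW/archi_boundP; exact: normr_ge0.
by apply: bigcup_countable => // n _; exact/finite_set_countable/fin.
Qed.

Lemma is_derive_coord (F : R -> 'rV[R]_3) u k : derivable F u 1 ->
  is_derive u 1 (fun r => F r 0 k) (derive1 F u 0 k).
Proof.
move=> /(@is_derive_dot R F (delta_mx 0 k)); rewrite dot_delta.
by under eq_fun do rewrite dot_delta.
Qed.

Lemma coord_C2 u k : C2_at Z u ->
  is_derive u 1 (fun r => Z r 0 k) (rvel Z u 0 k) /\ derivable (fun r => rvel Z r 0 k) u 1.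
Proof.
move=> Cu; rewrite {1}rvel_C2//; have [dZ _] := C2_derivable Cu.
split; first exact: is_derive_coord.
have [drv _] := rvel_derive Cu.
have d := is_derive_coord k drv; exact: ex_derive.
Qed.

Section Bounds.
Variables (c a0 : R).
Hypothesis hca : forall u, speed_acc_le c a0 u.

Lemma trajectory_lip u u' : enorm (Z u - Z u') <= c * `|u - u'|.
Proof.
have c0 : 0 <= c.
  have [v Cv] : exists v, C2_at Z v by apply: (@filter_ex R (0 : R)^'); exact: near_C2.
  by have [dv _] := C2_derivable Cv; have [h _] := hca v; apply: le_trans (h dv); exact: enorm_ge0.
wlog uu' : u u' / u' <= u => [h|].
  have [uu'|/ltW uu'] := leP u' u; first exact: h.
  by rewrite enormC distrC; exact: h.
rewrite ger0_norm ?subr_ge0//; apply: piecewise_lipschitz => //.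
- move=> t; apply: (filterS _ (near_C2 t)) => v Cv.
  by have [dv _] := C2_derivable Cv; have [h _] := hca v; split => //; exact: h.
- by move=> t _; apply: cvg_at_right_filter; exact: Zcont.
- by move=> t _; apply: cvg_at_left_filter; exact: Zcont.
Qed.

Lemma rvel_le u : enorm (rvel Z u) <= c.
Proof.
have cv : enorm (vel Z r) @[r --> u^'+] --> enorm (rvel Z u).
  exact: (continuous_cvg _ (@continuous_enorm R (rvel Z u)) (@vel_right u)).
rewrite -(cvg_lim (@Rhausdorff R) cv); apply: limr_le.
  by apply/cvg_ex; eexists; exact: cv.
apply: (filterS _ (at_right_dnbhs (near_C2 u))) => v Cv.
by have [dv _] := C2_derivable Cv; have [h _] := hca v; exact: h.
Qed.

Lemma near_rvel_derivable t :
  \forall u \near t^', derivable (rvel Z) u 1 /\ enorm (derive1 (rvel Z) u) <= a0.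
Proof.
apply: (filterS _ (near_C2 t)) => v Cv.
have [dv ->] := rvel_derive Cv; have [_ d2] := C2_derivable Cv; have [_ h] := hca v.
by split => //; exact: h.
Qed.

End Bounds.

End Trajectory.

(** * Time shifts of trajectories *)

Section Shift.
Context {R : realType}.

Lemma derivable_shift (V : normedModType R) (F : R -> V) (tau u : R) :
  derivable (fun r => F (r + tau)) u 1 = derivable F (u + tau) 1 /\
  derive1 (fun r => F (r + tau)) u = derive1 F (u + tau).
Proof.
have e : (fun h : R => h^-1 *: (F (h *: 1 + u + tau) - F (u + tau))) =
    fun h => h^-1 *: (F (h *: 1 + (u + tau)) - F (u + tau)).
  by apply/funext => h; rewrite addrA.
by split; [rewrite /derivable|rewrite !derive1E /derive]; rewrite e.
Qed.

Lemma is_derive_shift (F : R -> R) (tau u l : R) :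
  is_derive (u + tau) 1 F l -> is_derive u 1 (fun r => F (r + tau)) l.
Proof.
move=> d; have [e1 e2] := derivable_shift F tau u.
apply: DeriveDef; first by rewrite e1; exact: ex_derive.
by rewrite -derive1E e2 derive1E; exact: derive_val.
Qed.

Lemma dnbhs_shift (t tau : R) (P : set R) :
  (\forall u \near (t + tau)^', P u) -> \forall u \near t^', P (u + tau).
Proof.
move=> [d /= d0 hd]; exists d => // u /= tu ut; apply: hd.
  by rewrite /= opprD addrACA subrr addr0.
by rewrite (inj_eq (addIr tau)).
Qed.

Lemma at_right_shift (t tau : R) (P : set R) :
  (\forall u \near (t + tau)^'+, P u) -> \forall u \near t^'+, P (u + tau).
Proof.
move=> [d /= d0 hd]; exists d => // u /= tu ut; apply: hd.
  by rewrite /= opprD addrACA subrr addr0.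
by rewrite ltrD2r.
Qed.

Lemma at_left_shift (t tau : R) (P : set R) :
  (\forall u \near (t + tau)^'-, P u) -> \forall u \near t^'-, P (u + tau).
Proof.
move=> [d /= d0 hd]; exists d => // u /= tu ut; apply: hd.
  by rewrite /= opprD addrACA subrr addr0.
by rewrite ltrD2r.
Qed.

Lemma cvg_right_shift (V : topologicalType) (F : R -> V) (t tau : R) (l : V) :
  F @ (t + tau)^'+ --> l -> F (u + tau) @[u --> t^'+] --> l.
Proof. by move=> h A /h; exact: (@at_right_shift t tau (F @^-1` A)). Qed.

Lemma cvg_left_shift (V : topologicalType) (F : R -> V) (t tau : R) (l : V) :
  F @ (t + tau)^'- --> l -> F (u + tau) @[u --> t^'-] --> l.
Proof. by move=> h A /h; exact: (@at_left_shift t tau (F @^-1` A)). Qed.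

End Shift.

(** * Regularity of the image trajectory *)

Section Image.
Context {R : realType}.
Variables (mu : R) (G Z : R -> 'rV[R]_3).
Hypotheses (GC2 : forall t, C2_at G t) (Zcont : continuous Z) (ZC2 : piecewise_C2 Z).
Let I := image_trajectory mu G Z.

Lemma derive1_affine (F H : R -> 'rV[R]_3) u : derivable F u 1 -> derivable H u 1 ->
  derivable (fun r => - F r + mu *: H r) u 1 /\
  derive1 (fun r => - F r + mu *: H r) u = - derive1 F u + mu *: derive1 H u.
Proof.
move=> dF dH; have dN := derivableN dF; have dS := derivableZ (k := mu) dH.
rewrite !derive1E; split; first exact: derivableD dN dS.
by rewrite (deriveD dN dS) (deriveN dF) (deriveZ mu dH).
Qed.

Lemma cvg_affine (F : set_system R) (a b : R -> 'rV[R]_3) (la lb : 'rV[R]_3) : Filter F ->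
  a @ F --> la -> b @ F --> lb -> - a r + mu *: b r @[r --> F] --> - la + mu *: lb.
Proof. by move=> FF ca cb; exact: (cvgD (cvgN ca) (@cvgZr _ _ _ _ _ mu _ _ cb)). Qed.

Lemma image_C2 t : C2_at Z t ->
  [/\ C2_at I t, vel I t = - vel G t + mu *: vel Z t & acc I t = - acc G t + mu *: acc Z t].
Proof.
move=> Zt.
have dI u : C2_at Z u -> derivable I u 1 /\ vel I u = - vel G u + mu *: vel Z u.
  move=> /C2_derivable[dZ _]; have [dG _] := C2_derivable (GC2 u).
  exact: derive1_affine.
have dV u : C2_at Z u -> derivable (vel I) u 1 /\ acc I u = - acc G u + mu *: acc Z u.
  move=> Zu; have [_ dZ] := C2_derivable Zu; have [_ dG] := C2_derivable (GC2 u).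
  have e : {near u, (fun r => - vel G r + mu *: vel Z r) =1 vel I}.
    by apply: (filterS _ (C2_near Zu)) => v /dI[_ h]; exact: esym h.
  have [d1 d2] := derive1_affine dG dZ.
  split; first exact: near_eq_derivable e d1.
  rewrite -d2 /acc !derive1E; apply: near_eq_derive.
  by apply: (filterS _ e) => v ->.
split; [|by have [] := dI _ Zt|by have [] := dV _ Zt].
apply: (filterS _ (C2_near Zt)) => u Zu; split.
- by have [] := dI _ Zu.
- by have [] := dV _ Zu.
- have [_ _ cZ] := nbhs_singleton Zu; have [_ _ cG] := nbhs_singleton (GC2 u).
  have [_ e0] := dV _ Zu.
  have c : - acc G r + mu *: acc Z r @[r --> u] --> acc I u.
    by rewrite e0; exact: cvg_affine cG cZ.
  apply: cvg_trans c; apply: near_eq_cvg.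
  by apply: (filterS _ (C2_near Zu)) => v /dV[_ h]; exact: esym h.
Qed.

Lemma is_cvg_affine (F : set_system R) (a b f : R -> 'rV[R]_3) : Filter F ->
  (\forall u \near F, f u = - a u + mu *: b u) -> cvg (a @ F) -> cvg (b @ F) -> cvg (f @ F).
Proof.
move=> FF ef ca cb.
have c : - a r + mu *: b r @[r --> F] --> - lim (a @ F) + mu *: lim (b @ F).
  exact: cvg_affine ca cb.
apply/cvg_ex; eexists; apply: cvg_trans c; apply: near_eq_cvg.
by apply: (filterS _ ef) => v h; exact: esym h.
Qed.

(** [G] is C^2, so the singular times of the image are among those of [Z]. *)
Lemma image_piecewise_C2 : piecewise_C2 I.
Proof.
have [fin lims] := ZC2; split=> [a b|t].
  apply: sub_finite_set (fin a b) => u [uab nC]; split; first exact: uab.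
  by move=> Zu; have [h _ _] := image_C2 Zu; exact: nC h.
have [_ dG] := C2_derivable (GC2 t); have [_ _ cG] := nbhs_singleton (GC2 t).
have cvG := derivable_continuous dG.
have [vl vr al ar] := lims t.
have near_vel : \forall u \near t^', vel I u = - vel G u + mu *: vel Z u.
  by apply: (filterS _ (near_C2 ZC2 t)) => u /image_C2[_ ? ?].
have near_acc : \forall u \near t^', acc I u = - acc G u + mu *: acc Z u.
  by apply: (filterS _ (near_C2 ZC2 t)) => u /image_C2[_ ? ?].
split.
- have cGt : cvg (vel G @ t^'-) by apply/cvg_ex; eexists; exact: cvg_at_left_filter cvG.
  exact: (@is_cvg_affine (t^'-) (vel G) (vel Z) (vel I) _ (at_left_dnbhs near_vel) cGt vl).
- have cGt : cvg (vel G @ t^'+) by apply/cvg_ex; eexists; exact: cvg_at_right_filter cvG.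
  exact: (@is_cvg_affine (t^'+) (vel G) (vel Z) (vel I) _ (at_right_dnbhs near_vel) cGt vr).
- have cGt : cvg (acc G @ t^'-) by apply/cvg_ex; eexists; exact: cvg_at_left_filter cG.
  exact: (@is_cvg_affine (t^'-) (acc G) (acc Z) (acc I) _ (at_left_dnbhs near_acc) cGt al).
- have cGt : cvg (acc G @ t^'+) by apply/cvg_ex; eexists; exact: cvg_at_right_filter cG.
  exact: (@is_cvg_affine (t^'+) (acc G) (acc Z) (acc I) _ (at_right_dnbhs near_acc) cGt ar).
Qed.

Lemma continuous_image : continuous I.
Proof.
move=> t; have [dG _] := C2_derivable (GC2 t).
exact: (@cvg_affine (nbhs t) G Z (G t) (Z t) _ (derivable_continuous dG) (@Zcont t)).
Qed.

Lemma bounded_image : bounded_map G -> bounded_map Z -> bounded_map I.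
Proof.
move=> [M hM] [N hN]; exists (M + `|mu| * N) => t; apply: le_trans (ler_enormD _ _) _.
by rewrite enormN enormZ lerD// ler_wpM2l.
Qed.

End Image.

Lemma enorm_derive1B (R : realType) (F H : R -> 'rV[R]_3) (v a b : R) :
  derivable F v 1 -> enorm (derive1 F v) <= a -> derivable H v 1 -> enorm (derive1 H v) <= b ->
  derivable (fun r => F r - H r) v 1 /\ enorm (derive1 (fun r => F r - H r) v) <= a + b.
Proof.
rewrite !derive1E => dF Fa dH Hb; split; first exact: derivableB dF dH.
rewrite (deriveB dF dH); exact: le_trans (ler_enormB _ _) (lerD Fa Hb).
Qed.

(** * Musical orbits *)

Section Musical.
Context {R : realType}.
Variables (Mp : R) (xe xp : R -> 'rV[R]_3) (T mu : R) (G : R -> 'rV[R]_3) (tau : R).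
Hypothesis hmus : musical_orbit Mp xe xp T mu G tau.
Let I := image_trajectory mu G xe.
Let h2 := musical_2 hmus.
Let h3 := musical_3 hmus.
Let ty := musical_type_ii hmus.
Let orb := type_ii_orbit_orbit ty.

Lemma musical_image_C2 : piecewise_C2 I.
Proof. apply: image_piecewise_C2; [exact: P2_G_C2 h2|exact: orbit_C2_e orb]. Qed.

Lemma musical_image_continuous : continuous I.
Proof. apply: continuous_image; [exact: P2_G_C2 h2|exact: (orbit_bounded_e orb).1]. Qed.

Lemma breaking_shift t : breaking_times I (t + tau) <-> breaking_times xp t.
Proof.
have [f1 f2 f3] := P2_correspondence h2; split=> [/f3[u Bu /addIr <-]//|Bt].
exact: f1 t Bt.
Qed.

(** Sub-luminality concerns only times where the velocity exists, and a one-sided limit of length 1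
    would ruin the uniform bound. At breaking times (P3) identifies the one-sided velocities with
    those of the proton. *)
Lemma image_lt1 : velocities_lt1 I.
Proof.
move=> t; have [_ sl] := P2_sub_luminal h2.
have [Bt|nBt] := pselect (breaking_times I t); last first.
  have [dI cI] := contrapT nBt.
  have v1 := sl t dI.
  by split=> [_||]; [exact: v1|rewrite (lvel_continuous cI); exact: v1|rewrite (rvel_continuous cI); exact: v1].
have : breaking_times I (t - tau + tau) by rewrite subrK.
move=> /breaking_shift B'; have [el er] := h3 B'; rewrite subrK in el er.
have [_ l1 r1] := type_ii_lt1_p ty (t - tau).
split; [exact: sl t|rewrite -el; exact: l1|rewrite -er; exact: r1].
Qed.

Lemma musical_bounds : exists c a0 : R, [/\ 0 <= c < 1, 0 <= a0,
  forall u, speed_acc_le xp c a0 u & forall u, speed_acc_le I c a0 u].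
Proof.
have [c [a [/andP[c0 c1] a0 hX]]] := uniform_bounds (orbit_C2_p orb) (type_ii_T_gt0 ty)
  (type_ii_periodic_p ty) (type_ii_lt1_p ty).
have [c' [a' [/andP[c0' c1'] a0' hI]]] := uniform_bounds musical_image_C2 (type_ii_T_gt0 ty)
  (P2_periodic h2) image_lt1.
exists (Num.max c c'), (Num.max a a'); split.
- by rewrite le_max c0 gt_max c1.
- by rewrite le_max a0.
- by move=> u; apply: (speed_acc_leW _ _ (hX u)); rewrite le_max lexx.
- by move=> u; apply: (speed_acc_leW _ _ (hI u)); rewrite le_max lexx orbT.
Qed.

(** At a time that is not breaking [rvel] is continuous even if the acceleration jumps, so the
    acceleration bound integrates. *)
Lemma rvel_no_break (Z : R -> 'rV[R]_3) (c a0 a b : R) : piecewise_C2 Z -> 0 <= a0 ->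
  (forall u, speed_acc_le Z c a0 u) -> a <= b ->
  (forall u, breaking_times Z u -> ~ (a < u <= b)) ->
  enorm (rvel Z a - rvel Z b) <= a0 * `|a - b|.
Proof.
move=> ZC2 a00 hb ab nB; rewrite enormC distrC ger0_norm ?subr_ge0//.
have nd := near_rvel_derivable ZC2 hb.
apply: (@piecewise_lipschitz R (rvel Z) a b a0 ab a00 nd).
- by move=> t _; exact: rvel_right.
- move=> t tab; have [<- _] := lvel_nonbreaking (fun B => nB t B tab).
  exact: rvel_left.
Qed.

Let w u := rvel I (u + tau) - rvel xp u.

(** By (P3) the jumps of the two velocities cancel, so the acceleration bounds integrate across
    breaking times as well and add up. *)
Lemma rvel_gap_lip (c a0 u u' : R) : 0 <= a0 ->
  (forall u, speed_acc_le xp c a0 u) -> (forall u, speed_acc_le I c a0 u) ->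
  enorm (w u - w u') <= (a0 + a0) * `|u - u'|.
Proof.
move=> a00 hX hI.
wlog uu' : u u' / u' <= u => [h|].
  have [uu'|/ltW uu'] := leP u' u; first exact: h.
  by rewrite enormC distrC; exact: h.
have XC2 := orbit_C2_p orb.
have nd t : \forall v \near t^', derivable w v 1 /\ enorm (derive1 w v) <= a0 + a0.
  have n1 := near_rvel_derivable XC2 hX t.
  have n2 := dnbhs_shift (near_rvel_derivable musical_image_C2 hI (t + tau)).
  apply: (filterS _ (filterI n1 n2)) => v [[d1 b1] [d2 b2]].
  have [e1 e2] := derivable_shift (rvel I) tau v.
  rewrite -e1 in d2; rewrite -e2 in b2.
  exact: enorm_derive1B d2 b2 d1 b1.
rewrite ger0_norm ?subr_ge0//.
apply: (@piecewise_lipschitz R w u' u (a0 + a0) uu' (addr_ge0 a00 a00) nd).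
- move=> t _; apply: (@cvgB _ _ _ (t^'+)); last exact: rvel_right.
  by apply: cvg_right_shift; exact: (rvel_right musical_image_C2).
(* Left continuity: at a breaking time both sides are 0 by (P3); elsewhere left and right velocities
   coincide. *)
- move=> t _; have -> : w t = lvel I (t + tau) - lvel xp t.
    have [Bt|nBt] := pselect (breaking_times xp t).
      by have [el er] := h3 Bt; rewrite /w -er el !subrr.
    have nBI : ~ breaking_times I (t + tau) by move/breaking_shift.
    by rewrite /w; have [-> _] := lvel_nonbreaking nBt; have [-> _] := lvel_nonbreaking nBI.
  apply: (@cvgB _ _ _ (t^'-)); last exact: rvel_left.
  by apply: cvg_left_shift; exact: (rvel_left musical_image_C2).
Qed.

End Musical.

(** Moves [tau] into the trajectory, so that both delays are taken at the same time t. *)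
Lemma delay_shift (R : realType) (s t tau : R) (Z : R -> 'rV[R]_3) x :
  delay s Z (t + tau) x = delay s (fun u => Z (u + tau)) t x.
Proof. by rewrite /delay; congr get; apply/funext => d /=; rewrite addrAC. Qed.

Section DeltaGood.
Context {R : realType}.
Variables (Mp : R) (xe xp : R -> 'rV[R]_3) (T mu : R) (G : R -> 'rV[R]_3) (tau : R).
Hypothesis hmus : musical_orbit Mp xe xp T mu G tau.
Let I := image_trajectory mu G xe.

Lemma good_Delta_s (s t : R) (A : seq 'rV[R]_3) : s = 1 \/ s = -1 ->
  xp t \in A -> I (t + tau) \in A ->
  bdd (Delta_s s xe xp mu G tau t) /\ good A (Delta_s s xe xp mu G tau t).
Proof.
move=> s1 XA YA; pose Y u := I (u + tau).
have -> : Delta_s s xe xp mu G tau t = fun x => delay s xp t x - delay s Y t x.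
  by apply/funext => x; rewrite /Delta_s delay_shift.
have [c [a0 [c01 a00 hX hI]]] := musical_bounds hmus.
have orb := type_ii_orbit_orbit (musical_type_ii hmus).
have [Xcont Xbdd] := orbit_bounded_p orb; have XC2 := orbit_C2_p orb.
have IC2 := musical_image_C2 hmus; have Icont := musical_image_continuous hmus.
have h2 := musical_2 hmus.
have Xc := trajectory_lip Xcont XC2 hX.
have Yc u u' : enorm (Y u - Y u') <= c * `|u - u'|.
  have e : u - u' = u + tau - (u' + tau) by rewrite opprD addrACA subrr addr0.
  by rewrite e; exact: (trajectory_lip Icont IC2 hI).
have Ybdd : bounded_map Y.
  have [M hM] := bounded_image mu (P2_G_bounded h2) (orbit_bounded_e orb).2.
  by exists M => u; exact: hM.
split.
  have as1 : `|s| = 1 by case: s1 => ->; rewrite ?normrN normr1.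
  exact: (bdd_delay_difference t as1 c01 Xc Yc Xbdd Ybdd).
(* The times where the proton or the shifted image is not C^2, as a union indexed by a boolean. *)
pose S := \bigcup_(b in [set: bool])
  (if b then [set u | ~ C2_at xp u] else (fun v => v - tau) @` [set v | ~ C2_at I v]).
have cS : countable S.
  apply: bigcup_countable => [|[] _]; first exact: countableP.
    exact: countable_nonC2.
  exact: sub_countable (card_image_le _ _) (countable_nonC2 IC2).
have nSX u : ~ S u -> C2_at xp u by move=> nS; apply: contrapT => h; apply: nS; exists true.
have nSI u : ~ S u -> C2_at I (u + tau) by move=> nS; apply: contrapT => h; apply: nS; exists false => //; exists (u + tau); rewrite ?addrK.
apply: (@good_delay_difference R s c (a0 + a0) t xp Y (rvel xp) (fun u => rvel I (u + tau))
  (breaking_times xp) S s1 c01 (addr_ge0 a00 a00) Xc Yc (rvel_le XC2 hX)).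
- by move=> u; exact: (rvel_le IC2 hI).
- move=> a b ab nB; apply: (le_trans (rvel_no_break XC2 a00 hX ab nB)).
  by rewrite ler_wpM2r// lerDl.
- by move=> u u'; exact: (rvel_gap_lip hmus u u' a00 hX hI).
- by move=> u /(musical_3 hmus)[_ ->].
- by move=> u /(P2_position h2).
- exact: cS.
- by move=> u /nSX Cu k; have [] := coord_C2 k Cu.
- by move=> u /nSI Cu k; have [d _] := coord_C2 k Cu; exact: is_derive_shift d.
- by move=> u /nSX Cu k; have [] := coord_C2 k Cu.
- move=> u /nSI Cu k; have [_ d] := coord_C2 k Cu.
  by have [-> _] := derivable_shift (fun r => rvel I r 0 k) tau u.
- exact: XA.
- exact: YA.
Qed.

Lemma cgood_wave (s k w t : R) (A : seq 'rV[R]_3) : s = 1 \/ s = -1 -> 0 \in A ->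
  xp t \in A -> I (t + tau) \in A -> cgood A (wave s xe xp mu G tau k w t).
Proof.
move=> s1 A0 XA YA; have [bD gD] := good_Delta_s s1 XA YA.
apply: cgoodM.
  have eR z : complex.Re ('i%C * z%:C%C : R[i]) = 0 by rewrite /= mul0r mul1r subrr.
  have eI z : complex.Im ('i%C * z%:C%C : R[i]) = z by rewrite /= mul0r mul1r add0r.
  apply: cgood_cexp.
  - by under eq_fun do rewrite eR; exact: bdd_cst.
  - by under eq_fun do rewrite eR; exact: good_cst.
  - under eq_fun do rewrite eI.
    by apply: goodD; [apply: goodZ; exact: good_enorm|exact: good_cst].
by split; split => //; [exact: bdd_cst|exact: good_cst].
Qed.

End DeltaGood.

Local Open Scope complex_scope.

Theorem theorem3p1 (R : realType) (Mp : R) (hMp : 0 < Mp)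
    (xe xp : R -> 'rV[R]_3) (T mu : R) (G : R -> 'rV[R]_3) (tau : R)
    (hmus : musical_orbit Mp xe xp T mu G tau)
    (alpha beta : R[i]) (kq wq wo : R)
    (P : R[i] -> R[i]) (hP : quasi_polynomial P)
    (q : R) (hq : 0 < q) (t : R) :
  W22 (fun x : 'rV[R]_3 =>
         P (varphi xe xp mu G tau alpha beta kq wq t x)
         * cexp ('i%C * (wo * t)%:C - (q * enorm x)%:C)) /\
  W22 (fun x : 'rV[R]_3 =>
         P (varphi_dagger xe xp mu G tau alpha beta kq wq t x)
         * cexp ('i%C * (wo * t)%:C - (q * enorm x)%:C)).
Proof.
pose A := [:: 0; xp t; image_trajectory mu G xe (t + tau)].
have [A0 XA YA] : [/\ 0 \in A, xp t \in A & image_trajectory mu G xe (t + tau) \in A].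
  by rewrite !inE !eqxx !orbT.
have gr : good A (@enorm R) by exact: good_enorm.
have gw (s : R) : s = 1 \/ s = -1 -> cgood A (wave s xe xp mu G tau kq wq t).
  by move=> s1; exact: (cgood_wave hmus kq wq s1 A0 XA YA).
have gp := gw 1 (or_introl erefl); have gm := gw (-1) (or_intror erefl).
have gphi (b : R[i]) : cgood A
    (fun x => alpha * wave 1 xe xp mu G tau kq wq t x + b * wave (-1) xe xp mu G tau kq wq t x).
  by apply: cgoodD; apply: cgoodM => //; exact: cgood_cst.
split; apply: (W22_cgood _ hq gr (cgood_quasi_polynomial hP _)); first exact: gphi.
(* The second function is the first with [beta] replaced by its opposite. *)
rewrite (_ : varphi_dagger _ _ _ _ _ _ _ _ _ _ = (fun x => alpha * wave 1 xe xp mu G tau kq wq t x +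
  - beta * wave (-1) xe xp mu G tau kq wq t x)) //.
by apply/funext => x; rewrite mulNr.
Qed.
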